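(* Let $k\geq 2$ be a fixed integer, and let $Q$ be large. There exists a constant $c_k>0$ (depending only on $k$) for which there are at least $Q\exp\left(-c_k\frac{\log Q}{\log\log Q}\right)$ primitive Dirichlet characters $\chi$ of order $k$ and conductor $q\leq Q$ such that $$|L(1,\chi)|\geq e^{\gamma}\log\log Q+O_k(1).$$
   Context: $\gamma$ is the Euler–Mascheroni constant and $L(s,\chi)$ is the Dirichlet $L$-function attached to $\chi$. The order of a Dirichlet character is its order as an element of the group of characters modulo its conductor. $O_k(1)$ denotes a quantity bounded in absolute value by a constant depending only on $k$; ''$Q$ large'' means $Q$ is a sufficiently large real number (in terms of $k$). *)

(* Defs.v *)
From HB Require Import structures.
From mathcomp Require Import all_boot all_order all_algebra complex finmap.
From mathcomp Require Import all_classical all_reals all_analysis.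

Set Implicit Arguments.
Unset Strict Implicit.
Unset Printing Implicit Defensive.

Import Order.TTheory GRing.Theory Num.Theory.
Import numFieldNormedType.Exports.

Local Open Scope classical_set_scope.
Local Open Scope complex_scope.
Local Open Scope ring_scope.

Definition euler_gamma (R : realType) : R :=
  limn (fun n : nat => \sum_(1 <= i < n.+1) (i%:R)^-1 - ln (n%:R) : R).

(* Characters are functions on nat; by periodicity this is the same as
   functions on the integers. The equation chi 1 = 1 follows from
   multiplicativity and chi 1 != 0. *)
Definition dirichlet_character (R : realType) (q : nat) (chi : nat -> R[i])
    : Prop :=
  [/\ (0 < q)%N,
      forall m n : nat, chi (m * n)%N = chi m * chi n,
      forall n : nat, chi (n + q)%N = chi n &
      forall n : nat, (chi n != 0) = coprime n q].

Definition principal_character (R : realType) (q : nat) : nat -> R[i] :=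
  fun n => (coprime n q)%:R.

Definition is_order (R : realType) (q : nat) (chi : nat -> R[i]) (k : nat)
    : Prop :=
  [/\ (0 < k)%N,
      (fun n => chi n ^+ k) = principal_character R q &
      forall j : nat, (0 < j < k)%N ->
        (fun n => chi n ^+ j) <> principal_character R q].

Definition induced_from (R : realType) (d q : nat) (chi : nat -> R[i])
    : Prop :=
  (d %| q)%N /\
  exists psi : nat -> R[i], dirichlet_character d psi /\
    forall n : nat, coprime n q -> chi n = psi n.

Definition is_conductor (R : realType) (q : nat) (chi : nat -> R[i]) (d : nat)
    : Prop :=
  induced_from d q chi /\
  forall e : nat, induced_from e q chi -> (d <= e)%N.

Definition primitive_character (R : realType) (q : nat) (chi : nat -> R[i])
    : Prop :=
  dirichlet_character q chi /\ is_conductor q chi q.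

Definition cexp (R : realType) (z : R[i]) : R[i] :=
  (expR (complex.Re z))%:C *
  (cos (complex.Im z) +i* sin (complex.Im z)).

(* n ^ (-s) for n > 0 *)
Definition dirichlet_term (R : realType) (n : nat) (s : R[i]) : R[i] :=
  cexp (- s * (ln (n%:R : R))%:C).

(* The sum, in the sense of convergence of the partial sums, of the Dirichlet
   series. For a nonprincipal character the series converges (conditionally)
   to L(s, chi) in the half-plane Re s > 0, so s = 1 is included; outside the
   domain of convergence the value is meaningless. The alias R[i]^o carries
   the topology of the norm of R[i]. *)
Definition dirichlet_L (R : realType) (chi : nat -> R[i]) (s : R[i]) : R[i] :=
  limn (fun N : nat =>
    (\sum_(1 <= n < N.+1) chi n * dirichlet_term n s : (R[i])^o)).

(* Main.v *)
(* Every product chi1 * conj chi2 of characters of order k modulo distinct primes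
   q1, q2 <= sqrt Q, both congruent to 1 modulo k, is primitive of order k and of
   conductor q1 q2 <= Q.  Put y = log Q.  By the pigeonhole principle many primes
   q <= sqrt Q, at least Q^(1/2) exp(- O(log Q / log log Q)) of them, carry
   characters chi_q which agree at all primes p <= y.  Let c be this set of primes.
   For every m the sum of chi_q1(m) conj(chi_q2(m)) over the pairs in c is
   |sum_q chi_q(m)|^2 >= 0, and it equals |c|^2 when m is y-smooth; hence the
   average of Re L(1, chi_q1 conj chi_q2) over the pairs is at least the sum of 1/m
   over y-smooth m, up to O(1), which is e^gamma log log Q + O(1) by Mertens.  As
   |L(1, chi)| <= log Q + O(1) always, a proportion >> 1 / log Q of the pairs
   reaches the average up to O(1).  Enough primes congruent to 1 modulo k are
   supplied by an elementary proof of Dirichlet's theorem: Lambda-weighted sums of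
   chi(n) / n are bounded as soon as L(1, chi) <> 0. *)

Require Import Defs.
From HB Require Import structures.
From mathcomp Require Import cyclic all_field all_character.
From mathcomp Require Import all_boot all_order all_algebra complex finmap.
From mathcomp Require Import all_classical all_reals all_analysis.
From mathcomp Require Import ring lra zify.

Set Implicit Arguments.
Unset Strict Implicit.
Unset Printing Implicit Defensive.

Import Order.TTheory GRing.Theory Num.Theory.
Import numFieldNormedType.Exports.

Local Open Scope complex_scope.
Local Open Scope ring_scope.

(** The truncation point [H] is free: the partial sum of L(1, chi) up to H is within 1 of the limit
    as soon as H is at least twice the conductor, so H may be taken huge, beyond every y-smooth
    number with exponents at most y. The price appears only on the diagonal q1 = q2, where the
    character is principal and the sum can be as large as 1 + log H, with log H of order (log Q)^2
    log log Q. Diagonal pairs are one in |c|, so it suffices that |c| >= 1 + log H. Positivity of a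
    square stands in for any estimate at the non-smooth m, which is why pairs are taken rather than
    single characters chi_q. The pigeonhole step costs a factor k^pi(y) with pi(y) = O(log Q / log
    log Q), and passing to pairs squares it: this is the origin of c_k, here 40 log k + 1. Of gamma
    only one inequality enters, gamma <= 1 + 1/2 + ... + 1/n - log n. *)

Local Notation cabs := Normc.normc.

(* [lra] normalises casts of successors inside atoms, which prevents it from
   identifying equal atoms; [glra] abstracts them beforehand. *)
Ltac glra := repeat match goal with
  | |- context [@ln ?R ?x] => move: (@ln R x)
  | |- context [@GRing.inv ?R ?x] => move: (@GRing.inv R x)
  end; intros; lra.

(** * Logarithms, harmonic sums and Euler's constant *)

Lemma ln_le_subr1 (R : realType) (x : R) : 0 < x -> ln x <= x - 1.
Proof.
move=> x0; have := @le_ln1Dx R (x - 1); rewrite addrCA subrr addr0; apply; lra.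
Qed.

Lemma ln_ge_1subV (R : realType) (x : R) : 0 < x -> 1 - x^-1 <= ln x.
Proof.
move=> x0; have := @ln_le_subr1 R x^-1; rewrite invr_gt0 lnV ?posrE // => /(_ x0); lra.
Qed.

Lemma lnS_le (R : realType) (n : nat) : (0 < n)%N ->
  ln (n.+1%:R : R) - ln n%:R <= n%:R^-1.
Proof.
move=> n0; have n0R : (0 : R) < n%:R by rewrite ltr0n.
rewrite -ln_div ?posrE ?ltr0n //; apply: (le_trans (ln_le_subr1 _)).
  by rewrite divr_gt0 ?ltr0n.
by rewrite -[n.+1]addn1 natrD mulrDl divff ?gt_eqF // mul1r addrAC subrr add0r.
Qed.

Lemma lnS_ge (R : realType) (n : nat) : (0 < n)%N ->
  n.+1%:R^-1 <= ln (n.+1%:R : R) - ln n%:R.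
Proof.
move=> n0; have n0R : (0 : R) < n%:R by rewrite ltr0n.
rewrite -ln_div ?posrE ?ltr0n //; apply: (le_trans _ (ln_ge_1subV _)); last first.
  by rewrite divr_gt0 ?ltr0n.
rewrite invf_div -[X in X - _](@divff _ n.+1%:R) ?pnatr_eq0 // -mulrBl.
by rewrite -natrB // subSnn mul1r.
Qed.

Lemma ler_ln_nat (R : realType) (m n : nat) : (0 < m)%N -> (m <= n)%N ->
  ln (m%:R : R) <= ln n%:R.
Proof.
move=> m0 mn; rewrite ler_ln ?posrE ?ltr0n ?ler_nat //; exact: leq_trans mn.
Qed.

Lemma ln_nat_ge0 (R : realType) (n : nat) : 0 <= ln (n%:R : R).
Proof.
case: n => [|n]; first by rewrite ln0.
by apply: ln_ge0; rewrite ler1n.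
Qed.

Definition harmonic_sum (R : realType) (n : nat) : R := \sum_(1 <= i < n.+1) i%:R^-1.

Lemma harmonic_sumS (R : realType) n :
  harmonic_sum R n.+1 = harmonic_sum R n + n.+1%:R^-1.
Proof. by rewrite /harmonic_sum big_nat_recr. Qed.

Lemma harmonic_sum0 (R : realType) : harmonic_sum R 0 = 0.
Proof. by rewrite /harmonic_sum big_geq. Qed.

Lemma harmonic_sum_le (R : realType) n : (0 < n)%N ->
  harmonic_sum R n <= 1 + ln n%:R.
Proof.
elim: n => // -[_ _|n IH _]; first by rewrite harmonic_sumS harmonic_sum0 ln1 invr1; lra.
rewrite harmonic_sumS; have := IH isT; have := @lnS_ge R n.+1 isT; glra.
Qed.

Lemma harmonic_sum_ge_ln (R : realType) n : (0 < n)%N ->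
  ln n.+1%:R <= harmonic_sum R n.
Proof.
elim: n => // -[_ _|n IH _].
  by rewrite harmonic_sumS harmonic_sum0; have := @lnS_le R 1 isT; rewrite ln1; lra.
rewrite harmonic_sumS; have := IH isT; have := @lnS_le R n.+2 isT; glra.
Qed.

Lemma euler_gamma_le (R : realType) (n : nat) : (0 < n)%N ->
  euler_gamma R <= harmonic_sum R n - ln n%:R.
Proof.
case: n => // n _; rewrite /euler_gamma.
(* As [ln 0 = 0], the value [u 0 = 0] lies below [u 1 = 1]; the sequence decreases only from index 1
   on, hence the shift [v]. *)
pose u n : R := harmonic_sum R n - ln n%:R.
pose v n := u n.+1.
have vdec : {homo v : n m / (n <= m)%N >-> (m <= n)%R}.
  apply: homo_leq => [x|x y z yx zy|i]; [exact: lexx|exact: le_trans zy yx|].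
  rewrite /v /u harmonic_sumS; have := @lnS_ge R i.+1 isT; glra.
have vlb : has_lbound (range v).
  exists 0 => _ [i _ <-]; rewrite /v /u.
  have := @harmonic_sum_ge_ln R i.+1 isT.
  have := @ler_ln_nat R i.+1 i.+2 isT (leqnSn _); glra.
have vc := nonincreasing_cvgn vdec vlb.
have -> : (limn (fun n : nat => \sum_(1 <= i < n.+1) (i%:R)^-1 - ln (n%:R) : R))
   = limn v.
  apply: cvg_lim => //.
  have vl : (v n @[n --> \oo] --> limn v)%classic by apply/cvg_ex; exists (inf (range v)).
  by rewrite -cvg_shiftS.
apply: nonincreasing_cvgn_ge => //.
by apply/cvg_ex; exists (inf (range v)).
Qed.

(** * Chebyshev's and Mertens' estimates *)

(** Splitting off a full prime power makes every divisor a product p^j e; the divisor sums of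
    Lambda, mu and chi are all computed this way. *)
Lemma ppart_ind (P : nat -> Prop) : P 1%N ->
  (forall p a m, prime p -> (0 < a)%N -> (0 < m)%N -> ~~ (p %| m)%N -> P m ->
     P (p ^ a * m)%N) ->
  forall n, (0 < n)%N -> P n.
Proof.
move=> P1 Pm; elim/ltn_ind=> n IH n0.
have [->//|n1] := eqVneq n 1%N.
have {}n1 : (1 < n)%N by rewrite ltn_neqAle eq_sym n1.
have pp := pdiv_prime n1; set p := pdiv n in pp.
have [m cpm nE] := pfactor_coprime pp n0.
have a0 : (0 < logn p n)%N by rewrite logn_gt0 mem_primes pp n0 pdiv_dvd.
have m0 : (0 < m)%N by move: n0; rewrite nE muln_gt0 => /andP[].
rewrite nE mulnC; apply: Pm => //; first by rewrite -prime_coprime.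
apply: IH => //; rewrite [X in (_ < X)%N]nE ltn_Pmulr //.
by rewrite (@leq_trans p) // ?prime_gt1 // -{1}(expn1 p) leq_exp2l ?prime_gt1.
Qed.

Lemma perm_divisors_ppart p a m : prime p -> (0 < m)%N -> ~~ (p %| m)%N ->
  perm_eq (divisors (p ^ a * m))
    [seq (p ^ j * e)%N | j <- iota 0 a.+1, e <- divisors m].
Proof.
move=> pp m0 pm; have p0 := prime_gt0 pp; have p1 := prime_gt1 pp.
have pa0 : (0 < p ^ a * m)%N by rewrite muln_gt0 expn_gt0 p0.
have lE j e : e \in divisors m -> logn p (p ^ j * e) = j.
  rewrite -dvdn_divisors // => em; have e0 := dvdn_gt0 m0 em.
  rewrite lognM ?expn_gt0 ?p0 // pfactorK // lognE pp e0 /=.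
  by rewrite ifN ?addn0 //; apply: contra pm => /dvdn_trans; apply.
apply: uniq_perm; first exact: divisors_uniq.
  apply: allpairs_uniq; [exact: iota_uniq|exact: divisors_uniq|].
  move=> x y /allpairsP hx /allpairsP hy.
  case: hx hy => -[j1 e1] [/= h1 h2 ->] [[j2 e2] [/= h3 h4 ->]] /= E.
  have jj : j1 = j2 by rewrite -(lE j1 e1) // -(lE j2 e2) // E.
  move: E; rewrite jj => /eqP; rewrite eqn_pmul2l ?expn_gt0 ?p0 //.
  by move=> /eqP ->.
move=> d; rewrite -dvdn_divisors //; apply/idP/allpairsP.
  move=> dd; have d0 := dvdn_gt0 pa0 dd.
  have [e cpe dE] := pfactor_coprime pp d0.
  exists (logn p d, e); split => /=; last by rewrite mulnC.
    rewrite -[0%N :: _]/(iota 0 a.+1) mem_iota add0n ltnS /=.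
    have : (p ^ logn p d %| p ^ a * m)%N by apply: dvdn_trans dd; rewrite {2}dE dvdn_mull.
    rewrite mulnC Gauss_dvdr; last by rewrite coprimeXl // prime_coprime.
    by rewrite dvdn_Pexp2l.
  rewrite -dvdn_divisors //.
  have : (e %| p ^ a * m)%N by apply: dvdn_trans dd; rewrite dE dvdn_mulr.
  by rewrite Gauss_dvdr // coprimeXr // coprime_sym.
move=> [[j e]]; rewrite [(j,e).1]/= [(j,e).2]/= mem_iota ltnS /= => -[ja]; rewrite -dvdn_divisors // => em ->.
by rewrite dvdn_mul // dvdn_Pexp2l.
Qed.

Lemma sum_divisors_ppart (V : nmodType) (F : nat -> V) p a m :
  prime p -> (0 < m)%N -> ~~ (p %| m)%N ->
  \sum_(d <- divisors (p ^ a * m)) F d =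
  \sum_(0 <= j < a.+1) \sum_(e <- divisors m) F (p ^ j * e)%N.
Proof.
move=> pp m0 pm; rewrite (perm_big _ (perm_divisors_ppart a pp m0 pm)).
by rewrite big_allpairs_dep /index_iota subn0.
Qed.

Lemma sum_divisorsE (V : nmodType) (F : nat -> V) n : (0 < n)%N ->
  \sum_(d <- divisors n) F d = \sum_(1 <= d < n.+1 | (d %| n)%N) F d.
Proof.
move=> n0; rewrite -[RHS]big_filter; apply: perm_big; apply: uniq_perm.
- exact: divisors_uniq.
- by rewrite filter_uniq // iota_uniq.
move=> d; rewrite mem_filter -dvdn_divisors // mem_index_iota ltnS.
case dn : (d %| n)%N => //=; rewrite (dvdn_gt0 n0 dn) /=; apply/esym.
exact: dvdn_leq.
Qed.

(** Both sides run over the pairs with d m <= N. In the induction, passing to N + 1 raises the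
    quotient N / d by one exactly when d divides N + 1. *)
Lemma sum_divisors_swap (V : nmodType) (F : nat -> nat -> V) N :
  \sum_(1 <= n < N.+1) \sum_(d <- divisors n) F d (n %/ d)%N =
  \sum_(1 <= d < N.+1) \sum_(1 <= m < (N %/ d).+1) F d m.
Proof.
elim: N => [|N IH]; first by rewrite !big_geq.
rewrite big_nat_recr //= IH sum_divisorsE // [in LHS]big_mkcond /=.
rewrite [in RHS]big_nat_recr //= divnn /= big_nat1.
rewrite [X in _ + X]big_mkcond /= [X in _ + X]big_nat_recr //= dvdnn divnn /= addrA.
congr (_ + _).
rewrite -big_split /=; apply: eq_big_nat => d /andP[d0 dN].
rewrite divnS //; case: ifP => dd; last by rewrite addr0.
by rewrite dd add1n [RHS]big_nat_recr.
Qed.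

Section vonMangoldt.
Variable R : realType.

Definition Lam (n : nat) : R := if primes n is [:: p] then ln p%:R else 0.

Lemma Lam_ge0 n : 0 <= Lam n.
Proof. by rewrite /Lam; case: (primes n) => [|p [|]] //; exact: ln_nat_ge0. Qed.

Lemma Lam_ppow p a : prime p -> (0 < a)%N -> Lam (p ^ a) = ln p%:R.
Proof. by move=> pp a0; rewrite /Lam primesX // primes_prime. Qed.

Lemma Lam_prime p : prime p -> Lam p = ln p%:R.
Proof. by move=> pp; rewrite -(Lam_ppow pp (ltn0Sn 0)). Qed.

Lemma Lam1 : Lam 1 = 0. Proof. by []. Qed.

Lemma Lam_neq0 n : Lam n != 0 -> exists p a, [/\ prime p, (0 < a)%N & n = (p ^ a)%N].
Proof.
rewrite /Lam; case E : (primes n) => [|p [|]]; rewrite ?eqxx // => _.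
have : p \in primes n by rewrite E inE.
rewrite mem_primes => /and3P[pp n0 pn].
exists p, (logn p n); split => //; first by rewrite logn_gt0 E inE.
rewrite {1}(prod_prime_decomp n0) prime_decompE E /= big_seq1 //.
Qed.

Lemma Lam_mul_eq0 p j e : prime p -> (0 < j)%N -> (1 < e)%N -> ~~ (p %| e)%N ->
  Lam (p ^ j * e) = 0.
Proof.
move=> pp j0 e1 pe; rewrite /Lam.
have e0 : (0 < e)%N by apply: ltnW.
have pj0 : (0 < p ^ j)%N by rewrite expn_gt0 prime_gt0.
have n0 : (0 < p ^ j * e)%N by rewrite muln_gt0 pj0.
have h1 : p \in primes (p ^ j * e) by rewrite mem_primes pp n0 dvdn_mulr // dvdn_exp.
have h2 : pdiv e \in primes (p ^ j * e).
  by rewrite mem_primes pdiv_prime // n0 dvdn_mull // pdiv_dvd.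
case E : (primes _) h1 h2 => [|q [|]] //; rewrite !inE => /eqP pq /eqP eq.
by move: pe; rewrite pq -eq pdiv_dvd.
Qed.

Lemma sum_Lam_divisors n : (0 < n)%N -> \sum_(d <- divisors n) Lam d = ln n%:R.
Proof.
move: n; apply: ppart_ind; first by rewrite big_seq1 Lam1 ln1.
move=> p a m pp a0 m0 pm IH.
rewrite sum_divisors_ppart // big_nat_recl //.
rewrite (eq_bigr (fun e => Lam e)); last by move=> e _; rewrite mul1n.
have p0 := prime_gt0 pp.
rewrite IH natrM natrX lnM ?posrE ?exprn_gt0 ?ltr0n //.
rewrite lnXn ?ltr0n // addrC; congr (_ + _).
rewrite (eq_big_nat _ _ (F2 := fun=> ln p%:R)); first by rewrite big_const_nat iter_addr subn0 addr0.
move=> j _; rewrite (bigD1_seq 1%N) ?divisors_uniq -?dvdn_divisors ?dvd1n //=.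
rewrite muln1 Lam_ppow // big_seq_cond big1 ?addr0 // => e /andP[].
rewrite -dvdn_divisors // => em e1; have e0 := dvdn_gt0 m0 em.
apply: Lam_mul_eq0 => //; first by rewrite ltn_neqAle eq_sym e1.
by apply: contra pm => /dvdn_trans; apply.
Qed.

Definition psi N : R := \sum_(1 <= n < N.+1) Lam n.

Lemma ln_factE N : ln N`!%:R = \sum_(1 <= n < N.+1) ln (n%:R : R).
Proof.
elim: N => [|N IH]; first by rewrite big_geq // fact0 ln1.
rewrite factS big_nat_recr //= -IH natrM lnM ?posrE ?ltr0n ?fact_gt0 // addrC //.
Qed.

Lemma ln_fact_Lam N : ln N`!%:R = \sum_(1 <= d < N.+1) Lam d * (N %/ d)%:R.
Proof.
rewrite ln_factE; under eq_big_nat => n /andP[n0 _] do rewrite -sum_Lam_divisors //.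
rewrite (sum_divisors_swap (fun d _ => Lam d)); apply: eq_bigr => d _.
by rewrite big_const_nat iter_addr subn1 /= addr0 mulr_natr.
Qed.

Lemma psiS N : psi N.+1 = psi N + Lam N.+1.
Proof. by rewrite /psi big_nat_recr. Qed.

Lemma psi0 : psi 0 = 0. Proof. by rewrite /psi big_geq. Qed.

Lemma psi_mono : {homo psi : m n / (m <= n)%N >-> m <= n}.
Proof.
apply: homo_leq => [//|x y z xy yz|i]; first exact: le_trans xy yz.
by rewrite psiS lerDl Lam_ge0.
Qed.

Lemma bin_le_exp2 n m : ('C(n, m) <= 2 ^ n)%N.
Proof.
elim: n m => [|n IH] [|m]; rewrite ?bin0 ?bin0n ?expn_gt0 //.
by rewrite binS expnS mul2n -addnn leq_add.
Qed.

(* The factor floor(2N/d) - 2 floor(N/d) equals 1 for N < d <= 2N. *)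
Lemma psi_double N : psi N.*2 - psi N <= 2 * N%:R.
Proof.
have ln2 : ln (2 : R) <= 1.
  by apply: (le_trans (ln_le_subr1 _)); lra.
have E : ln ('C(N.*2, N))%:R = ln (N.*2)`!%:R - 2 * ln (N`!%:R : R).
  have -> : (N.*2)`! = ('C(N.*2, N) * (N`! * N`!))%N.
    by rewrite -{5}(addnK N N) addnn bin_fact // -addnn leq_addr.
  rewrite !natrM !lnM ?posrE ?mulr_gt0 ?ltr0n ?fact_gt0 ?bin_gt0 -?addnn ?leq_addr //.
  lra.
have U : ln ('C(N.*2, N))%:R <= 2 * N%:R :> R.
  have : ln ('C(N.*2, N))%:R <= ln (2 ^ N.*2)%:R :> R.
    by apply: ler_ln_nat; rewrite ?bin_le_exp2 // bin_gt0 -addnn leq_addr.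
  move/le_trans; apply; rewrite natrX lnXn ?ltr0n //.
  by rewrite -(mulr_natr (ln 2)) -mul2n natrM -[X in _ <= X]mul1r ler_wpM2r // mulr_ge0.
apply: le_trans U; rewrite E !ln_fact_Lam.
rewrite /psi (@big_cat_nat _ _ _ N.+1 1 N.*2.+1) //=; last by rewrite ltnS -addnn leq_addr.
rewrite addrAC subrr add0r.
rewrite [X in _ <= X - _](@big_cat_nat _ _ _ N.+1 1 N.*2.+1) //=; last by rewrite ltnS -addnn leq_addr.
rewrite addrAC mulr_sumr -sumrB.
apply: (@le_trans _ _ (0 + \sum_(N.+1 <= n < N.*2.+1) Lam n)); first by rewrite add0r.
apply: lerD; first apply: sumr_ge0 => d _.
  rewrite mulrCA -mulrBr mulr_ge0 ?Lam_ge0 // -natrM subr_ge0 ler_nat -mul2n.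
  by case: d => [|d]; [rewrite !divn0 | rewrite leq_divRL // -mulnA leq_mul // leq_divM].
apply: ler_sum_nat => d /andP[d1 d2].
rewrite -[X in X <= _]mulr1 ler_wpM2l ?Lam_ge0 // ler1n.
by rewrite divn_gt0 // (leq_trans _ d1).
Qed.

Lemma psi_le n : psi n <= 4 * n%:R.
Proof.
elim/ltn_ind: n => n IH.
have [n3|n3] := ltnP n 3.
  have h2 : psi 2 <= 4.
    rewrite !psiS psi0 Lam1 Lam_prime // !add0r.
    by apply: (le_trans (ln_le_subr1 _)); lra.
  case: n n3 {IH} => [|[|[|//]]] _; rewrite ?psi0 ?mulr0 //.
    by rewrite psiS psi0 Lam1; lra.
  by apply: le_trans h2 _; rewrite ler_peMr // ler1n.
(* With m = ceil(n / 2): psi n <= psi (2m) <= psi m + 2m <= 6m <= 3n + 3, and this is at most 4n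
   because n >= 3. *)
pose m := uphalf n.
have mn : (m < n)%N by rewrite /m; lia.
have m2 : (n <= m.*2)%N by rewrite /m; lia.
have m3 : (m.*2 <= n.+1)%N by rewrite /m; lia.
have := psi_mono m2; have := psi_double m; have := IH _ mn.
have : m%:R *+ 2 <= n%:R + 1 :> R by rewrite -mulrnA muln2 natr1 ler_nat.
have : 3 <= n%:R :> R by rewrite ler_nat.
by rewrite mulr2n; lra.
Qed.

Lemma ln_fact_ge N : N%:R * ln N%:R - N%:R <= ln (N`!%:R : R).
Proof.
elim: N => [|[|N] IH]; first by rewrite fact0 ln1 mul0r subr0.
  by rewrite ln1 mulr0; lra.
rewrite factS natrM lnM ?posrE ?ltr0n ?fact_gt0 //.
have h := @lnS_le R N.+1 isT.
have N0 : (0 : R) < N.+1%:R by rewrite ltr0n.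
have : N.+1%:R * (ln (N.+2%:R : R) - ln N.+1%:R) <= 1.
  by rewrite -ler_pdivlMl // mulr1.
move: IH; move: (ln (N.+1)`!%:R) (ln N.+2%:R) (ln N.+1%:R) => c a b.
by rewrite -[N.+2%:R]natr1; move: (N.+1%:R : R) => d; nra.
Qed.

Definition mert N : R := \sum_(1 <= n < N.+1) Lam n / n%:R.

Lemma mertens_ge N : (0 < N)%N -> ln N%:R - 1 <= mert N.
Proof.
move=> N0; have N0R : (0 : R) < N%:R by rewrite ltr0n.
rewrite -(ler_pM2l N0R) mulrBr mulr1; apply: (le_trans (ln_fact_ge N)).
rewrite ln_fact_Lam /mert mulr_sumr; apply: ler_sum_nat => d /andP[d0 _].
rewrite mulrCA ler_wpM2l ?Lam_ge0 // ler_pdivlMr ?ltr0n // -natrM ler_nat.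
exact: leq_divM.
Qed.

(** Rounding N / d down in [ln_fact_Lam] costs at most [psi N] in all, hence at most 4N by
    Chebyshev's bound. *)
Lemma mertens_le N : (0 < N)%N -> mert N <= ln N%:R + 4.
Proof.
move=> N0; have N0R : (0 : R) < N%:R by rewrite ltr0n.
rewrite -(ler_pM2l N0R) mulrDr.
have := psi_le N.
have : ln N`!%:R <= N%:R * ln N%:R :> R.
  rewrite ln_factE; apply: (@le_trans _ _ (\sum_(1 <= n < N.+1) ln (N%:R : R))).
    apply: ler_sum_nat => d /andP[d0 dN].
    exact: ler_ln_nat.
  by rewrite big_const_nat iter_addr subn1 /= addr0 mulr_natl.
have : N%:R * mert N <= ln N`!%:R + psi N.
  rewrite ln_fact_Lam /mert /psi mulr_sumr -big_split /=.
  apply: ler_sum_nat => d /andP[d0 _].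
  rewrite mulrCA -[X in _ + X]mulr1 -mulrDr ler_wpM2l ?Lam_ge0 // natr1.
  by rewrite ler_pdivrMr ?ltr0n // -natrM ler_nat ltnW // ltn_ceil.
lra.
Qed.

End vonMangoldt.

(** * A lower bound in Mertens' product theorem *)

(** Serves as a comparison principle: with w = v - u it turns v >= u into an inequality between the
    sums of the increments of v and of u against a decreasing weight t. *)
Lemma abel_nonneg (R : realType) (w t : nat -> R) (a N : nat) : (a <= N)%N ->
  (forall n, (a <= n <= N)%N -> 0 <= w n) ->
  (forall n, (a < n)%N -> 0 <= t n) ->
  (forall n, (a < n)%N -> t n.+1 <= t n) ->
  - (w a * t a.+1) <= \sum_(a.+1 <= n < N.+1) (w n - w n.-1) * t n.
Proof.
move=> aN w0 t0 tdec.
suff: w N * t N.+1 - w a * t a.+1 <= \sum_(a.+1 <= n < N.+1) (w n - w n.-1) * t n.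
  apply: le_trans; rewrite -[X in X <= _]add0r lerD2r mulr_ge0 ?t0 //.
  by rewrite w0 // aN leqnn.
elim: N aN w0 => [|N IH].
  by rewrite leqn0 => /eqP -> _; rewrite big_geq // subrr.
rewrite leq_eqVlt => /predU1P[<- _|]; first by rewrite big_geq // subrr.
rewrite ltnS => aN w0; rewrite big_nat_recr //=.
have /(IH aN) : forall n, (a <= n <= N)%N -> 0 <= w n.
  by move=> n /andP[an nN]; rewrite w0 // an leqW.
have wN : 0 <= w N.+1 by rewrite w0 // leqnn leqW.
have := @ler_wpM2l _ _ wN _ _ (tdec N.+1 (aN : (a < N.+1)%N)); nra.
Qed.

(** * Smooth numbers and finite Euler products *)

Lemma ler_sum_subset (R : realDomainType) (s1 s2 : seq nat) (F : nat -> R) :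
  uniq s1 -> {subset s1 <= s2} -> (forall n, n \in s2 -> 0 <= F n) ->
  \sum_(n <- s1) F n <= \sum_(n <- s2) F n.
Proof.
elim: s1 s2 => [|x s1 IH] s2.
  by move=> _ _ F0; rewrite big_nil big_seq sumr_ge0.
move=> /andP[xs1 us1] sub F0; have xs2 : x \in s2 by apply: sub; rewrite inE eqxx.
rewrite big_cons (perm_big _ (perm_to_rem xs2)) big_cons lerD2l; apply: IH => //.
  move=> y ys; have yx : y != x by apply: contraNneq xs1 => <-.
  by have := sub y; rewrite inE ys orbT (perm_mem (perm_to_rem xs2)) inE (negPf yx) /=; apply.
by move=> n /mem_rem; exact: F0.
Qed.

(** The cap [E] on the exponents keeps the list finite, so that the truncated Euler product is an
    exact identity ([sum_smooth]) and all members are bounded ([smooth_le]). *)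
Fixpoint smooth (E : nat) (ps : seq nat) : seq nat :=
  if ps is p :: ps' then [seq (p ^ j * m)%N | j <- iota 0 E.+1, m <- smooth E ps']
  else [:: 1%N].

Arguments smooth : simpl never.

Lemma smooth_cons E p ps :
  smooth E (p :: ps) = [seq (p ^ j * m)%N | j <- iota 0 E.+1, m <- smooth E ps].
Proof. by []. Qed.

Lemma smooth_consP E p ps n :
  reflect (exists j m, [/\ (j <= E)%N, m \in smooth E ps & n = (p ^ j * m)%N])
    (n \in smooth E (p :: ps)).
Proof.
apply: (iffP allpairsP) => [[[j m] []]|[j [m [jE ms nE]]]].
  by rewrite [(j, m).1]/= [(j, m).2]/= mem_iota /= => jE ms ->; exists j, m.
by exists (j, m); rewrite [(j, m).1]/= [(j, m).2]/= mem_iota.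
Qed.

Lemma smooth_gt0 E ps n : all prime ps -> n \in smooth E ps -> (0 < n)%N.
Proof.
elim: ps n => [|p ps IH] n; first by rewrite inE => _ /eqP ->.
move=> /andP[pp ap] /smooth_consP[j [m [_ /(IH _ ap) m0 ->]]].
by rewrite muln_gt0 expn_gt0 prime_gt0.
Qed.

Lemma smooth_prime_dvd E ps n r : all prime ps -> n \in smooth E ps -> prime r ->
  (r %| n)%N -> r \in ps.
Proof.
move=> ap ns pr; elim: ps n ap ns => [|p ps IH] n.
  by rewrite inE => _ /eqP ->; rewrite dvdn1 => /eqP r1; rewrite r1 in pr.
move=> /andP[pp ap] /smooth_consP[j [m [_ ms ->]]].
rewrite Euclid_dvdM // inE => /orP[|/(IH _ ap ms) ->]; last by rewrite orbT.
by rewrite Euclid_dvdX // => /andP[]; rewrite dvdn_prime2 // => ->.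
Qed.

Lemma smooth_le E ps n : all prime ps -> n \in smooth E ps ->
  (n <= \prod_(p <- ps) p ^ E)%N.
Proof.
elim: ps n => [|p ps IH] n; first by rewrite inE big_nil => _ /eqP ->.
move=> /andP[pp ap] /smooth_consP[j [m [jE ms ->]]]; rewrite big_cons leq_mul ?IH //.
by rewrite leq_exp2l // prime_gt1.
Qed.

Lemma smooth_uniq E ps : all prime ps -> uniq ps -> uniq (smooth E ps).
Proof.
elim: ps => // p ps IH /andP[pp ap] /andP[pps ups].
have lE j m : m \in smooth E ps -> logn p (p ^ j * m) = j.
  move=> ms; have m0 := smooth_gt0 ap ms; have p0 := prime_gt0 pp.
  rewrite lognM ?expn_gt0 ?p0 // pfactorK // lognE pp m0 /=.
  by rewrite ifN ?addn0 //; apply: contra pps => /(smooth_prime_dvd ap ms pp).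
have := @allpairs_uniq _ _ _ (fun j m => p ^ j * m)%N (iota 0 E.+1) (smooth E ps).
apply; [exact: iota_uniq|exact: IH|].
move=> x y /allpairsP hx /allpairsP hy.
case: hx hy => -[j1 e1] [/= h1 h2 ->] [[j2 e2] [/= h3 h4 ->]] /= eqjm.
have jj : j1 = j2 by rewrite -(lE j1 e1) // -(lE j2 e2) // eqjm.
move: eqjm; rewrite jj => /eqP; rewrite eqn_pmul2l ?expn_gt0 ?prime_gt0 //.
by move=> /eqP ->.
Qed.

Lemma mem_smooth E ps n : all prime ps -> uniq ps -> (0 < n)%N ->
  (forall r, prime r -> (r %| n)%N -> (r \in ps) && (logn r n <= E)%N) ->
  n \in smooth E ps.
Proof.
elim: ps n => [|p ps IH] n.
  move=> _ _ n0 h; rewrite inE; case: n n0 h => [|[|n]] // _ h; exfalso.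
  by have := h (pdiv n.+2) (@pdiv_prime n.+2 isT) (pdiv_dvd _).
move=> /andP[pp ap] /andP[pps ups] n0 h.
have [m cpm nE] := pfactor_coprime pp n0.
have m0 : (0 < m)%N by move: n0; rewrite nE muln_gt0 => /andP[].
apply/smooth_consP; exists (logn p n), m; split; last by rewrite mulnC.
  have [pn|pn] := boolP (p %| n)%N; first by case/andP: (h p pp pn).
  by rewrite lognE pp n0 (negPf pn).
apply: IH => // r pr rm.
have rn : (r %| n)%N by rewrite nE dvdn_mulr.
have rp : r != p.
  by apply/eqP => rp; move: cpm; rewrite prime_coprime // -rp rm.
have /andP[] := h r pr rn; rewrite inE (negPf rp) /= => -> rE.
by apply: leq_trans rE; rewrite dvdn_leq_log // nE dvdn_mulr.
Qed.

Lemma sum_smooth (K : comPzRingType) (w : nat -> K) E ps : all prime ps -> w 1%N = 1 ->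
  (forall m n, (0 < m)%N -> (0 < n)%N -> w (m * n)%N = w m * w n) ->
  \sum_(n <- smooth E ps) w n = \prod_(p <- ps) \sum_(0 <= j < E.+1) w p ^+ j.
Proof.
move=> ap w1 wM; elim: ps ap => [|p ps IH]; first by rewrite big_nil big_seq1.
move=> /andP[pp ap]; rewrite big_cons -IH // smooth_cons.
rewrite big_allpairs_dep mulr_suml /index_iota subn0; apply: eq_bigr => j _.
rewrite mulr_sumr big_seq_cond [RHS]big_seq_cond; apply: eq_bigr => m /andP[ms _].
have p0 := prime_gt0 pp.
rewrite wM ?expn_gt0 ?p0 ?(smooth_gt0 ap ms) //; congr (_ * _).
elim: j => [|j IHj]; first by rewrite w1.
by rewrite expnS wM ?expn_gt0 ?p0 // IHj exprS.
Qed.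

Definition primes_upto n := [seq p <- index_iota 1 n.+1 | prime p].

Lemma mem_primes_upto n p : (p \in primes_upto n) = prime p && (p <= n)%N.
Proof.
rewrite mem_filter mem_index_iota ltnS; case pp: (prime p) => //=.
by rewrite prime_gt0.
Qed.

Lemma primes_upto_prime n : all prime (primes_upto n).
Proof. exact: filter_all. Qed.

Lemma primes_upto_uniq n : uniq (primes_upto n).
Proof. by rewrite filter_uniq // iota_uniq. Qed.

Lemma euler_product_ge (R : realFieldType) (w : nat -> R) N : w 1%N = 1 ->
  (forall m n, (0 < m)%N -> (0 < n)%N -> w (m * n)%N = w m * w n) ->
  (forall n, 0 <= w n) -> (forall p, prime p -> w p < 1) ->
  \sum_(1 <= n < N.+1) w n <= \prod_(p <- primes_upto N) (1 - w p)^-1.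
Proof.
move=> w1 wM w0 wp.
apply: (@le_trans _ _ (\sum_(n <- smooth N (primes_upto N)) w n)).
  apply: ler_sum_subset => //; first exact: iota_uniq.
  move=> n; rewrite mem_index_iota ltnS => /andP[n0 nN].
  apply: mem_smooth => //; [exact: primes_upto_prime|exact: primes_upto_uniq|].
  move=> r pr rn; rewrite mem_primes_upto pr (leq_trans (dvdn_leq n0 rn) nN) /=.
  (* The exponent of r in n is below n <= N, so the cap N excludes no n in the range. *)
  by apply: leq_trans nN; apply: ltnW; exact: ltn_logl.
rewrite sum_smooth ?primes_upto_prime // big_seq [X in _ <= X]big_seq.
apply: ler_prod => p; rewrite mem_primes_upto => /andP[pp _].
rewrite sumr_ge0 => [|j _]; last exact: exprn_ge0.
have w1' : 0 < 1 - w p by rewrite subr_gt0 wp.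
rewrite -[(1 - w p)^-1]mul1r ler_pdivlMr //= mulrC big_mkord.
by rewrite -opprB mulNr -subrX1 opprB gerBl exprn_ge0.
Qed.

Section mertens3.
Variable R : realType.

Lemma ln_nat_gt0 n : (1 < n)%N -> 0 < ln (n%:R : R).
Proof. by move=> n1; rewrite ln_gt0 // ltr1n. Qed.

Lemma sum_Lam_ln_incr y x : (2 <= y)%N -> (y <= x)%N ->
  \sum_(y.+1 <= n < x.+1) Lam R n / n%:R / ln n%:R
    <= ln (ln x%:R) - ln (ln y%:R) + 5 / ln y%:R.
Proof.
move=> y2 yx; have y0 : (0 < y)%N by apply: ltnW.
(* Mertens' bounds give mert n - mert y <= (ln n + 4) - (ln y - 1); the constant 5 makes w
   nonnegative. *)
pose w n : R := ln n%:R - ln y%:R + 5 - (mert R n - mert R y).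
pose t n : R := (ln n%:R)^-1.
have tdec n : (y < n)%N -> t n.+1 <= t n.
  move=> yn; have n1 : (1 < n)%N by apply: leq_trans y2 (ltnW _).
  by rewrite lef_pV2 ?posrE ?ln_nat_gt0 ?ler_ln_nat // ltnW.
have w0 n : (y <= n <= x)%N -> 0 <= w n.
  move=> /andP[yn _]; rewrite /w; have := @mertens_ge R y y0.
  have := @mertens_le R n (leq_trans y0 yn); lra.
have t0 n : 0 <= t n by rewrite invr_ge0 ln_nat_ge0.
have := abel_nonneg yx w0 (fun n _ => t0 n) tdec.
have -> : w y = 5 by rewrite /w !subrr; lra.
have t1 : t y.+1 <= t y by rewrite lef_pV2 ?posrE ?ln_nat_gt0 ?ler_ln_nat // ltnW.
have -> : \sum_(y.+1 <= n < x.+1) (w n - w n.-1) * t n =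
  \sum_(y.+1 <= n < x.+1) (ln n%:R - ln n.-1%:R) * t n -
  \sum_(y.+1 <= n < x.+1) Lam R n / n%:R / ln n%:R.
  rewrite -sumrB; apply: eq_big_nat => -[//|n] _ /=.
  rewrite /w /t [mert R n.+1]/mert big_nat_recr //= -/(mert R n) -mulrBl; congr (_ * _).
  by move: (mert R n) (ln _) (ln _) (ln _) (Lam R n.+1 / _) (mert R y) => *; ring.
(* The bound 1 - 1/v <= ln v at v = ln n / ln (n - 1) compares each term with an increment of ln ln,
   which telescopes. *)
have : \sum_(y.+1 <= n < x.+1) (ln n%:R - ln n.-1%:R) * t n <= ln (ln x%:R) - ln (ln y%:R).
  rewrite -(telescope_sumr (fun n => ln (ln (n%:R : R)))) // big_add1 /=.
  apply: ler_sum_nat => n /andP[yn _]; have n1 : (1 < n)%N by apply: leq_trans yn.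
  have l0 := ln_nat_gt0 n1; have l1 := ln_nat_gt0 (ltnW n1 : (1 < n.+1)%N).
  rewrite -[X in _ <= X]ln_div ?posrE //; apply: (le_trans _ (ln_ge_1subV _)); last by rewrite divr_gt0.
  by rewrite /t invf_div mulrBl divff ?gt_eqF.
have : 5 * t y = 5 / ln y%:R by [].
lra.
Qed.

Definition lnprod n : R := \sum_(1 <= p < n.+1 | prime p) - ln (1 - p%:R^-1).

Lemma prime_inv_lt1 p : prime p -> 0 < 1 - p%:R^-1 :> R.
Proof. by move=> pp; rewrite subr_gt0 invf_lt1 ?ltr0n ?ltr1n ?prime_gt0 ?prime_gt1. Qed.

Lemma ln_euler_factor_ge0 p : prime p -> 0 <= - ln (1 - p%:R^-1) :> R.
Proof.
by move=> pp; rewrite oppr_ge0 ln_le0 // gerBl invr_ge0.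
Qed.

(** The logarithm is at most 1/(p - 1). Its excess over 1/p is written as a difference that
    telescopes when summed over all integers. *)
Lemma ln_euler_factor_le p : prime p ->
  - ln (1 - p%:R^-1) <= Lam R p / p%:R / ln p%:R + (p.-1%:R^-1 - p%:R^-1).
Proof.
move=> pp; have p1 := prime_gt1 pp; have p0 := prime_gt0 pp.
rewrite Lam_prime // mulrAC divff ?gt_eqF ?ln_nat_gt0 // mul1r addrCA subrr addr0.
rewrite -lnV ?posrE ?prime_inv_lt1 //.
apply: (le_trans (ln_le_subr1 _)); first by rewrite invr_gt0 prime_inv_lt1.
case: p p1 {pp p0} => // p p1.
have pR : (0 : R) < p%:R by rewrite ltr0n.
have pR1 : (0 : R) < p.+1%:R by rewrite ltr0n.
have -> : (1 - p.+1%:R^-1)^-1 = p.+1%:R / p%:R :> R.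
  by rewrite -natr1 in pR1 *; field; rewrite !gt_eqF //=; lra.
by rewrite -natr1 mulrDl divff ?gt_eqF //= mul1r addrAC subrr add0r.
Qed.

Lemma lnprod_incr y x : (2 <= y)%N -> (y <= x)%N ->
  lnprod x <= lnprod y + (ln (ln x%:R) - ln (ln y%:R) + 6 / ln y%:R).
Proof.
move=> y2 yx; rewrite /lnprod (@big_cat_nat _ _ _ y.+1 1 x.+1) //= lerD2l.
have h1 := sum_Lam_ln_incr y2 yx.
have y0 : (0 : R) < y%:R by rewrite ltr0n ltnW.
have h2 : y%:R^-1 <= (ln y%:R)^-1 :> R.
  rewrite lef_pV2 ?posrE ?ln_nat_gt0 //; apply: (le_trans (ln_le_subr1 _)) => //; lra.
(* The telescoping excess is at most 1/y <= 1/ln y, which raises the 5 of [sum_Lam_ln_incr] to 6. *)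
have h3 : \sum_(y.+1 <= n < x.+1) (n.-1%:R^-1 - n%:R^-1) <= y%:R^-1 :> R.
  rewrite big_add1 /=; under eq_bigr do rewrite -opprB.
  by rewrite sumrN telescope_sumr // opprB gerBl invr_ge0.
suff : \sum_(y.+1 <= p < x.+1 | prime p) - ln (1 - p%:R^-1) <=
  \sum_(y.+1 <= n < x.+1) Lam R n / n%:R / ln n%:R +
  \sum_(y.+1 <= n < x.+1) (n.-1%:R^-1 - n%:R^-1).
  have : 6 / ln y%:R = 5 / ln y%:R + (ln y%:R)^-1 :> R by lra.
  lra.
rewrite -big_split /= big_mkcond /=; apply: ler_sum_nat => n /andP[yn _].
case: ifP => [/ln_euler_factor_le //|_].
rewrite addr_ge0 ?divr_ge0 ?Lam_ge0 ?ln_nat_ge0 //.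
by rewrite subr_ge0 lef_pV2 ?posrE ?ltr0n ?ler_nat; move: yn y2; case: n => // -[|n] //; case: (y).
Qed.

Lemma lnprod_mono : {homo lnprod : m n / (m <= n)%N >-> m <= n}.
Proof.
apply: homo_leq => [//|x y z xy yz|i]; first exact: le_trans xy yz.
rewrite /lnprod [X in _ <= X]big_mkcond big_nat_recr //= -big_mkcond /= lerDl.
by case: ifP => // /ln_euler_factor_ge0.
Qed.

(** This is n^(-s) for n > 0; the default [ln 0 = 0] gives the value 1 at n = 0. *)
Definition npow (s : R) n : R := expR (- (s * ln n%:R)).

Lemma npow1 s : npow s 1 = 1.
Proof. by rewrite /npow ln1 mulr0 oppr0 expR0. Qed.

Lemma npowM s m n : (0 < m)%N -> (0 < n)%N -> npow s (m * n) = npow s m * npow s n.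
Proof.
by move=> m0 n0; rewrite /npow natrM lnM ?posrE ?ltr0n // mulrDr opprD expRD.
Qed.

Lemma npow_gt0 s n : 0 < npow s n. Proof. exact: expR_gt0. Qed.

Lemma npow1D d n : (0 < n)%N -> npow (1 + d) n = npow d n / n%:R.
Proof.
move=> n0; rewrite /npow.
have -> : - ((1 + d) * ln n%:R) = - (d * ln n%:R) + - ln (n%:R : R) by ring.
by rewrite expRD [expR (- ln _)]expRN lnK // posrE ltr0n.
Qed.

Lemma npow_le1 (d : R) n : 0 <= d -> npow d n <= 1.
Proof. by move=> d0; rewrite /npow -[X in _ <= X]expR0 ler_expR oppr_le0 mulr_ge0 // ln_nat_ge0. Qed.

(** Discrete comparison with the integral of x^(-1-d): exp(-u) >= 1 - u gives n^(-d) - (n+1)^(-d) <=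
    d n^(-1-d), and the left side telescopes. *)
Lemma zeta_ge (d : R) N : 0 < d ->
  (1 - npow d N.+1) / d <= \sum_(1 <= n < N.+1) npow (1 + d) n.
Proof.
move=> d0; rewrite ler_pdivrMr // mulr_suml.
have -> : 1 - npow d N.+1 = \sum_(1 <= n < N.+1) (npow d n - npow d n.+1).
  rewrite -(npow1 d) -opprB -(telescope_sumr (npow d)) // -sumrN.
  by apply: eq_bigr => n _; rewrite opprB.
apply: ler_sum_nat => n /andP[n0 _]; rewrite npow1D //.
have -> : npow d n.+1 = npow d n * expR (- (d * (ln n.+1%:R - ln n%:R))).
  by rewrite /npow -expRD; congr expR; ring.
rewrite -{1}(mulr1 (npow d n)) -mulrBr -!mulrA ler_wpM2l ?expR_ge0 //.
have := @expR_ge1Dx R (- (d * (ln n.+1%:R - ln n%:R))).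
have := ler_wpM2l (ltW d0) (@lnS_le R n n0); rewrite [n%:R^-1 * d]mulrC; lra.
Qed.

(** Convexity of exp between 0 and a, from the tangent line at c = t a: averaging the two tangent
    inequalities with weights 1 - t and t leaves exactly exp c. *)
Lemma expRM_le (t a : R) : 0 <= t -> t <= 1 -> expR (t * a) <= 1 - t + t * expR a.
Proof.
move=> t0 t1; set c := t * a.
have h0 : expR c * (1 - c) <= 1.
  rewrite -[X in _ <= X](expR0) -[in X in _ <= X](subrr c) expRD ler_wpM2l ?expR_ge0 //.
  exact: expR_ge1Dx.
have h1 : expR c * (1 + (a - c)) <= expR a.
  rewrite -[X in _ <= expR X](subrKC c a) expRD ler_wpM2l ?expR_ge0 //.
  exact: expR_ge1Dx.
have t1' : 0 <= 1 - t by rewrite subr_ge0.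
have := ler_wpM2l t1' h0; have := ler_wpM2l t0 h1.
have : (1 - t) * (expR c * (1 - c)) + t * (expR c * (1 + (a - c))) = expR c.
  by rewrite /c; ring.
lra.
Qed.

(** Convexity of exp with t = p^(-d) and a = ln (1 - 1/p). The exponent is an increment of [lnprod]
    times p^(-d), so the Euler product of zeta(1 + d) is controlled by the increments of
    [lnprod]. *)
Lemma euler_factor_le (d : R) p : 0 < d -> prime p ->
  (1 - npow (1 + d) p)^-1 <= expR (- ln (1 - p%:R^-1) * npow d p).
Proof.
move=> d0 pp; rewrite npow1D ?prime_gt0 // mulNr expRN.
have t1 := npow_le1 p (ltW d0); have t0 := npow_gt0 d p.
have p1 : p%:R^-1 < 1 :> R by rewrite invf_lt1 ?ltr0n ?ltr1n ?prime_gt0 ?prime_gt1.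
have p0 : 0 <= p%:R^-1 :> R by rewrite invr_ge0.
rewrite lef_pV2 ?posrE ?expR_gt0 //; last by nra.
rewrite mulrC; apply: (le_trans (expRM_le _ (ltW t0) t1)).
by rewrite lnK ?posrE ?prime_inv_lt1 //; lra.
Qed.

Lemma is_derive_sum_pow J (x : R) :
  is_derive x (1 : R) (fun y : R => \sum_(j < J) y ^+ j.+1 / j.+1%:R) (\sum_(j < J) x ^+ j).
Proof.
elim: J => [|J IH].
  rewrite big_ord0 (_ : (fun y : R => _) = cst 0); first exact: is_derive_cst.
  by apply/funext => y; rewrite big_ord0.
rewrite big_ord_recr /= (_ : (fun y : R => _) =
   (fun y : R => \sum_(j < J) y ^+ j.+1 / j.+1%:R) + (fun y => y ^+ J.+1 / J.+1%:R)).
  apply: is_deriveD.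
  have -> : (fun y : R => y ^+ J.+1 / J.+1%:R) = (J.+1%:R^-1 : R) *: (fun y : R => y ^+ J.+1).
    by apply/funext => y /=; rewrite mulrC.
  have h : is_derive x (1 : R) (fun y : R => y ^+ J.+1) (J.+1%:R * x ^+ J).
    rewrite (_ : (fun y : R => y ^+ J.+1) = id ^+ J.+1); last first.
      by apply/funext => y; rewrite fctE.
    apply: is_derive_eq (is_deriveX J.+1 (is_derive_id x 1)) _.
    by rewrite /= /GRing.scale /= mulr1.
  apply: is_derive_eq (is_deriveZ _ h) _.
  by rewrite /GRing.scale /= mulrA mulVf ?mul1r // pnatr_eq0.
by apply/funext => y; rewrite big_ord_recr.
Qed.

(** The difference of the two sides vanishes at 0 and has derivative 1/(1 - x) minus a partial
    geometric sum, which is nonnegative. *)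
Lemma sum_pow_le_ln J (x : R) : 0 <= x -> x < 1 ->
  \sum_(j < J) x ^+ j.+1 / j.+1%:R <= - ln (1 - x).
Proof.
move=> x0 x1.
pose f := (fun y : R => - ln (1 - y)) - (fun y : R => \sum_(j < J) y ^+ j.+1 / j.+1%:R).
have fd (y : R) : y < 1 -> is_derive y (1 : R) f ((1 - y)^-1 - \sum_(j < J) y ^+ j).
  move=> y1; apply: is_deriveB; last exact: is_derive_sum_pow.
  have y1' : 0 < 1 - y by rewrite subr_gt0.
  have h := is_derive1_ln y1'.
  have h2 : is_derive y (1 : R) (fun y : R => 1 - y) (- 1).
    rewrite (_ : (fun y : R => _) = cst 1 - id) //.
    apply: is_derive_eq (is_deriveB (is_derive_cst (1 : R) y 1) (is_derive_id y 1)) _.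
    by rewrite sub0r.
  have h3 := @is_derive1_comp R (@ln R) (fun y : R => 1 - y) y _ _ h h2.
  apply: is_derive_eq (is_deriveN h3) _.
  by rewrite mulrN1 opprK.
have : f 0 <= f x.
  apply: (@ger0_derive1_ndecr R f 0 x) => //.
  - move=> y; rewrite in_itv /= => /andP[_ yx].
    by have [] := fd y (lt_trans yx x1).
  - move=> y; rewrite in_itv /= => /andP[y0 yx].
    have y1 := lt_trans yx x1; have := fd y y1 => -[_ ]; rewrite -derive1E => ->.
    have y1' : 0 < 1 - y by rewrite subr_gt0.
    rewrite subr_ge0 -[(1 - y)^-1]mul1r ler_pdivlMr //= mulrC.
    by rewrite -opprB mulNr -subrX1 opprB gerBl exprn_ge0 // ltW.
  - apply: derivable_within_continuous => y; rewrite in_itv /= => /andP[_ yx].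
    by have [] := fd y (le_lt_trans yx x1).
rewrite /f !fctE subr0 ln1 oppr0 big1 ?subrr; last by move=> j _; rewrite exprS mul0r mul0r.
by rewrite subr_ge0.
Qed.

(* The functional w |-> sum_(1 <= n <= N) (w n - w n.-1) t n maps the indicator
   function of an up-set to the value of t at its first element. *)
Lemma sum_jump_le (t : nat -> R) (c : nat -> bool) T N : 0 <= T -> ~~ c 0%N ->
  (forall n, c n -> c n.+1) -> (forall n, c n -> t n <= T) ->
  \sum_(1 <= n < N.+1) ((c n)%:R - (c n.-1)%:R) * t n <= T.
Proof.
move=> T0 c0 cS ct.
suff : \sum_(1 <= n < N.+1) ((c n)%:R - (c n.-1)%:R) * t n <= if c N then T else 0.
  by move/le_trans; apply; case: ifP.
elim: N => [|N IH]; first by rewrite big_geq // (negPf c0).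
rewrite big_nat_recr //=; move: IH.
case cN : (c N); first by rewrite (cS _ cN) subrr mul0r addr0.
by case: ifP => [/ct|_]; rewrite ?subr0 ?mul1r ?subrr ?mul0r; lra.
Qed.

Lemma sum_jump (t : nat -> R) b N : (0 < b)%N -> (b <= N)%N ->
  \sum_(1 <= n < N.+1) ((b <= n)%N%:R - (b <= n.-1)%N%:R) * t n = t b.
Proof.
case: b => // b _ bN; rewrite (bigD1_seq b.+1) ?iota_uniq ?mem_index_iota ?ltnS //=.
rewrite leqnn ltnn subr0 mul1r big_nat_cond big1 ?addr0 // => -[//|n] /andP[_ nb] /=.
by rewrite ltnS leq_eqVlt eq_sym -eqSS (negPf nb) /= subrr mul0r.
Qed.

(** With m the integer part of ln n, the right side contains the harmonic sum up to m + 1, where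
    [euler_gamma_le] applies. The gain is that ln ln n is replaced by a combination of the
    indicators of n >= e^(j-1), which against n^(-d) yield the series of -log(1 - e^(-d)). *)
Lemma lnln_le_harmonic n J : (1 < n)%N -> (Num.truncn (ln (n%:R : R)) < J)%N ->
  ln (ln n%:R) + euler_gamma R <=
    \sum_(1 <= j < J.+1) j%:R^-1 * (j.-1%:R <= ln (n%:R : R))%R%:R.
Proof.
move=> n1 mJ; set u := ln (n%:R : R) in mJ *; set m := Num.truncn u in mJ.
have u0 : 0 < u by exact: ln_nat_gt0.
have /andP[mu um] := truncn_itv (ltW u0).
have hm := @euler_gamma_le R m.+1 isT.
have : ln u <= ln m.+1%:R by rewrite ler_ln ?posrE ?ltr0n // ltW.
suff : harmonic_sum R m.+1 <= \sum_(1 <= j < J.+1) j%:R^-1 * (j.-1%:R <= u)%R%:R by lra.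
rewrite /harmonic_sum [X in _ <= X](@big_cat_nat _ _ _ m.+2) //=.
rewrite -[X in X <= _]addr0 lerD //; last by rewrite sumr_ge0 // => j _; rewrite mulr_ge0.
apply: ler_sum_nat => j /andP[j0 jm].
rewrite (le_trans _ mu) ?mulr1 // ler_nat; case: j j0 jm => // j _.
Qed.

Lemma lnprod_sum_npow (d : R) N : 0 < d ->
  (1 - npow d N.+1) / d <=
  expR (\sum_(1 <= n < N.+1) (lnprod n - lnprod n.-1) * npow d n).
Proof.
move=> d0; apply: (le_trans (zeta_ge N d0)).
apply: (le_trans (euler_product_ge _ _ _ _ _)).
- exact: npow1.
- exact: npowM.
- by move=> n; rewrite ltW ?npow_gt0.
- move=> p pp; rewrite npow1D ?prime_gt0 //.
  apply: (@le_lt_trans _ _ p%:R^-1); last by rewrite invf_lt1 ?ltr0n ?ltr1n ?prime_gt0 ?prime_gt1.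
  by rewrite -[X in _ <= X]mul1r ler_wpM2r ?invr_ge0 // npow_le1 // ltW.
rewrite /primes_upto big_filter.
have -> : \sum_(1 <= n < N.+1) (lnprod n - lnprod n.-1) * npow d n =
  \sum_(1 <= p < N.+1 | prime p) - ln (1 - p%:R^-1) * npow d p.
  rewrite [RHS]big_mkcond /=; apply: eq_big_nat => -[//|n] _ /=.
  rewrite {1}/lnprod big_mkcond big_nat_recr //= -big_mkcond -/(lnprod n) addrAC subrr add0r.
  by case: ifP => // _; rewrite mul0r.
rewrite expR_sum; apply: ler_prod => p pp.
rewrite euler_factor_le // invr_ge0 subr_ge0 npow1D ?prime_gt0 // andbT.
apply: mulr_ile1; rewrite ?invr_ge0 ?expR_ge0 //; first exact: npow_le1 (ltW d0).
by rewrite invf_le1 ?ltr0n ?ler1n prime_gt0.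
Qed.

Lemma exists_npow_le (d e : R) N0 : 0 < d -> 0 < e -> exists N, (N0 <= N)%N /\ npow d N <= e.
Proof.
move=> d0 e0; set M := `|ln e| / d.
exists (N0 + (Num.truncn (expR M)).+1)%N; split; first exact: leq_addr.
rewrite /npow -[X in _ <= X](@lnK R) ?posrE // ler_expR.
set n := (N0 + _)%N.
have : M <= ln n%:R.
  rewrite -[X in X <= _]expRK ler_ln ?posrE ?expR_gt0 ?ltr0n ?/n ?addnS //.
  have /andP[_ /ltW/le_trans] := truncn_itv (expR_ge0 M); apply.
  by rewrite ler_nat ltnS leq_addl.
rewrite /M ler_pdivrMr // mulrC => h; have := ler_norm (- ln e); rewrite normrN; lra.
Qed.

(* For n >= y the function [lnprod] is at most log log n + D.  Summing its
   increments against n^(-d) and comparing with zeta(1 + d) >= 1 / d up to a tail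
   gives - log d <= - log (1 - e^(-d)) + D - gamma + O(d), and d -> 0 yields
   gamma <= D. *)
Lemma lnprod_ge y : (1 < y)%N ->
  ln (ln y%:R) + euler_gamma R - 6 / ln y%:R <= lnprod y.
Proof.
move=> y1; set L := ln (y%:R : R); set g := euler_gamma R.
have y0 : (0 < y)%N by apply: ltnW.
pose D := lnprod y - ln L + 6 / L.
suff : g <= D by rewrite /D; lra.
have L0 : 0 < L by exact: ln_nat_gt0.
have hD n : (y <= n)%N -> lnprod n <= ln (ln n%:R) + D.
  by move=> yn; have := lnprod_incr y1 yn; rewrite /D -/L; lra.
have lp0 : lnprod 0 = 0 by rewrite /lnprod big_geq.
have lpy0 : 0 <= lnprod y by rewrite -lp0; exact: lnprod_mono.
(* K pays for n < y, where [hD] says nothing: there lnprod n <= (D - g) + K. Its total contribution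
   K (1 - y^(-d)) <= K d L disappears as d -> 0. *)
pose K := lnprod y + `|D - g|.
have K0 : 0 <= K by rewrite addr_ge0.
have KD : lnprod y - (D - g) <= K.
  by rewrite /K lerD2l -normrN ler_norm.
clearbody D K.
have main (d : R) : 0 < d -> - ln d <= expR d * - ln (1 - expR (- d)) + (D - g) + K * (d * L).
  move=> d0.
  have e1 : expR (- d) < 1 by rewrite -[X in _ < X]expR0 ltr_expR oppr_lt0.
  set B := (X in _ <= X).
  have bound N : (y <= N)%N -> (1 - npow d N.+1) / d <= expR B.
    move=> yN; apply: (le_trans (lnprod_sum_npow N d0)); rewrite ler_expR.
    pose J := (Num.truncn (ln (N%:R : R))).+1.
    (* Without the guard 0 < n, the value [ln 0 = 0] would put 0 into the up-set of j = 1. *)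
    pose c j n := (0 < n)%N && (j.-1%:R <= ln (n%:R : R)).
    (* A majorant of [lnprod] on 0..N that vanishes at 0 and is a combination of indicators of
       up-sets, so that its increments can be summed against n^(-d) term by term. *)
    pose v n : R := \sum_(1 <= j < J.+1) j%:R^-1 * (c j n)%:R +
      (D - g) * (1 <= n)%N%:R + K * ((1 <= n)%N%:R - (y <= n)%N%:R).
    have v0 : v 0%N = 0.
      rewrite /v /c /= leqNgt y0 /= big1 => [|j _]; last by rewrite mulr0.
      by rewrite subrr !mulr0 !addr0.
    have vlp n : (0 <= n <= N)%N -> 0 <= v n - lnprod n.
      move=> /andP[_ nN]; have [->|n0] := posnP n; first by rewrite v0 lp0 subrr.
      rewrite /v /c n0 /= mulr1; have [yn|yn] := leqP y n.
        have n1 : (1 < n)%N by apply: leq_trans yn.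
        have := hD n yn; have := @lnln_le_harmonic n J n1.
        rewrite ltnS => /(_ _); rewrite -/g => H.
        have := H (le_truncn (ler_ln_nat R n0 nN)); rewrite subrr mulr0; lra.
      have : 0 <= \sum_(1 <= j < J.+1) j%:R^-1 * (j.-1%:R <= ln (n%:R : R))%R%:R :> R.
        by rewrite sumr_ge0 // => j _; rewrite mulr_ge0.
      by have := lnprod_mono (ltnW yn); rewrite subr0 mulr1; lra.
    have tdec n : (0 < n)%N -> npow d n.+1 <= npow d n.
      by move=> n0; rewrite /npow ler_expR lerN2 ler_pM2l // ler_ln_nat.
    have := @abel_nonneg R (fun n => v n - lnprod n) (npow d) 0 N (leq0n _) vlp
      (fun n _ => ltW (npow_gt0 d n)) tdec.
    rewrite v0 lp0 subrr mul0r oppr0.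
    have -> : \sum_(1 <= n < N.+1) (v n - lnprod n - (v n.-1 - lnprod n.-1)) * npow d n =
      \sum_(1 <= n < N.+1) (v n - v n.-1) * npow d n -
      \sum_(1 <= n < N.+1) (lnprod n - lnprod n.-1) * npow d n.
      by rewrite -sumrB; apply: eq_bigr => n _; ring.
    rewrite subr_ge0 => /le_trans; apply.
    have -> : \sum_(1 <= n < N.+1) (v n - v n.-1) * npow d n =
      \sum_(1 <= j < J.+1) j%:R^-1 *
         (\sum_(1 <= n < N.+1) ((c j n)%:R - (c j n.-1)%:R) * npow d n) +
      (D - g) * (\sum_(1 <= n < N.+1) ((1 <= n)%N%:R - (1 <= n.-1)%N%:R) * npow d n) +
      K * (\sum_(1 <= n < N.+1) ((1 <= n)%N%:R - (1 <= n.-1)%N%:R) * npow d n -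
           \sum_(1 <= n < N.+1) ((y <= n)%N%:R - (y <= n.-1)%N%:R) * npow d n).
      under [in RHS]eq_bigr do rewrite mulr_sumr.
      rewrite exchange_big /= -sumrB !mulr_sumr -!big_split /=; apply: eq_bigr => n _.
      rewrite -[X in _ = X + _ + _](_ : (\sum_(1 <= j < J.+1) j%:R^-1 * (c j n)%:R -
         \sum_(1 <= j < J.+1) j%:R^-1 * (c j n.-1)%:R) * npow d n = _); last first.
        by rewrite -sumrB mulr_suml; apply: eq_bigr => j _; ring.
      by rewrite /v; ring.
    rewrite !sum_jump // ?npow1 ?(leq_trans y0 yN) //.
    rewrite /B mulr1; apply: lerD; first apply: lerD => //.
      apply: (@le_trans _ _ (expR d * \sum_(j < J) expR (- d) ^+ j.+1 / j.+1%:R)).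
        rewrite mulr_sumr big_add1 /= big_mkord; apply: ler_sum => j _.
        rewrite mulrA mulrC ler_wpM2r ?invr_ge0 // exprS mulrA -expRD subrr expR0 mul1r.
        apply: sum_jump_le; rewrite ?exprn_ge0 ?expR_ge0 //.
          move=> n /andP[n0 jn]; rewrite /c /=; apply: le_trans jn _.
          exact: ler_ln_nat.
        move=> n /andP[_ jn]; rewrite -expRM_natl /npow ler_expR mulrN lerN2 mulrC.
        by rewrite ler_wpM2l // ltW.
      by rewrite ler_wpM2l ?expR_ge0 // sum_pow_le_ln // expR_ge0.
    rewrite ler_wpM2l // /npow; have := @expR_ge1Dx R (- (d * L)); rewrite -/L; lra.
  have : 1 <= d * expR B.
    apply/ler_addgt0Pr => e e0; have [N [yN Ne]] := @exists_npow_le d e y.+1 d0 e0.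
    case: N yN Ne => // N yN Ne.
    by have := bound N yN; rewrite ler_pdivrMr // mulrC; lra.
  rewrite -ler_pdivrMl // mulr1 => h.
  by rewrite -lnV ?posrE // -(expRK B) ler_ln ?posrE ?invr_gt0 ?expR_gt0.
apply/ler_addgt0Pr => e e0.
have K6 : 0 < K * L + 6 by rewrite ltr_wpDl // mulr_ge0 // ltW.
(* Taking d = h^2 makes d log(1/d) at most 2h; all error terms in [main] then add up to at most (K L
   + 6) h. *)
pose h := Num.min (1 / 2) (e / (K * L + 6)).
have h0 : 0 < h.
  have q0 : 0 < e / (K * L + 6) by rewrite divr_gt0.
  by rewrite lt_min q0 andbT; lra.
have h2 : h <= 1 / 2 by rewrite ge_min lexx.
have he : h * (K * L + 6) <= e by rewrite -ler_pdivlMr // ge_min lexx orbT.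
have d0 : 0 < h ^+ 2 by rewrite exprn_gt0.
have := main _ d0; set d := h ^+ 2 in d0 *.
have d2 : d <= h / 2 by rewrite /d expr2; nra.
have lnd : - ln d <= 2 / h.
  rewrite /d lnXn // mulr2n; have := ln_ge_1subV h0; lra.
have lnd0 : 0 <= - ln d by rewrite oppr_ge0 ln_le0 //; lra.
have expd : expR d <= 1 + 2 * d.
  have : expR d * (1 - d) <= 1.
    rewrite -[X in _ <= X]expR0 -[in X in _ <= X](subrr d) expRD ler_wpM2l ?expR_ge0 //.
    exact: expR_ge1Dx.
  have := expR_ge0 d; nra.
have ln1d : - ln (1 - expR (- d)) <= - ln d + d.
  have e1 : d * expR (- d) <= 1 - expR (- d).
    have := ler_wpM2r (expR_ge0 (- d)) (@expR_ge1Dx R d).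
    by rewrite -expRD subrr expR0; lra.
  have : ln (d * expR (- d)) <= ln (1 - expR (- d)).
    by rewrite ler_ln ?posrE ?mulr_gt0 ?expR_gt0 // (lt_le_trans _ e1) // mulr_gt0 ?expR_gt0.
  by rewrite lnM ?posrE ?expR_gt0 // expRK; lra.
have dl : d * - ln d <= 2 * h.
  rewrite (le_trans (ler_wpM2l (ltW d0) lnd)) // /d expr2 -mulrA mulrCA [h * (2 / h)]mulrCA.
  by rewrite divff ?gt_eqF // mulr1 mulrC.
have E1 : expR d * - ln (1 - expR (- d)) <= (1 + 2 * d) * (- ln d + d).
  apply: ler_pM => //.
  by rewrite oppr_ge0 ln_le0 // gerBl expR_ge0.
have KL : 0 <= K * L by rewrite mulr_ge0 // ltW.
have dKL : d * (K * L) <= h * (K * L) by rewrite ler_wpM2r //; lra.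
have dd : d * d <= d / 2 by rewrite ler_wpM2l // ?ltW //; lra.
have E2 : (1 + 2 * d) * (- ln d + d) = - ln d + d + 2 * (d * - ln d) + 2 * (d * d) by ring.
have E3 : K * (d * L) = d * (K * L) by ring.
have E4 : h * (K * L + 6) = h * (K * L) + h * 6 by ring.
by move: E1 dl he dKL; rewrite E2 E3 E4; lra.
Qed.

End mertens3.

(** * Dirichlet characters and their sums at 1 *)

Section cabs.
Variable R : realType.
Implicit Types (x y z : R[i]) (r : R).

Lemma cabs_normE z : `|z| = (cabs z)%:C. Proof. by []. Qed.

Lemma cabs_real r : cabs r%:C = `|r|.
Proof. by rewrite /= expr0n /= addr0 sqrtr_sqr. Qed.

Lemma cabs_ge0 z : 0 <= cabs z. Proof. by case: z => a b; exact: sqrtr_ge0. Qed.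

Lemma cabsD x y : cabs (x + y) <= cabs x + cabs y.
Proof. exact: le_normcD. Qed.

Lemma cabsB x y : cabs (x - y) <= cabs x + cabs y.
Proof. by rewrite -[cabs y](normcN y); exact: le_normcD. Qed.

Lemma cabs_sum (I : Type) (s : seq I) (P : pred I) (F : I -> R[i]) :
  cabs (\sum_(i <- s | P i) F i) <= \sum_(i <- s | P i) cabs (F i).
Proof.
elim/big_rec2: _ => [|i x y _ h]; first by rewrite Normc.normc0.
by apply: le_trans (cabsD _ _) _; rewrite lerD2l.
Qed.

Lemma cabsX z n : cabs (z ^+ n) = cabs z ^+ n.
Proof.
elim: n => [|n IH]; first by rewrite !expr0 Normc.normc1.
by rewrite !exprS Normc.normcM IH.
Qed.

Lemma Re_le_cabs z : `|complex.Re z| <= cabs z.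
Proof. by have := normc_ge_Re z; rewrite cabs_normE lecR. Qed.

Lemma Im_le_cabs z : `|complex.Im z| <= cabs z.
Proof. by case: z => a b /=; rewrite -sqrtr_sqr ler_sqrt ?addr_ge0 ?sqr_ge0 // lerDr sqr_ge0. Qed.

Lemma cabs_le_ReIm z : cabs z <= `|complex.Re z| + `|complex.Im z|.
Proof.
rewrite {1}(complexE z); apply: (le_trans (cabsD _ _)).
rewrite Normc.normcM !cabs_real.
have -> : cabs ('i%C : R[i]) = 1 by rewrite /= expr0n expr1n add0r sqrtr1.
by rewrite mul1r.
Qed.

Lemma complexRe_is_additive : {morph (@complex.Re R) : x y / x + y}.
Proof. by move=> [a b] [c d]. Qed.

Lemma Re_sum (I : Type) (s : seq I) (P : pred I) (F : I -> R[i]) :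
  complex.Re (\sum_(i <- s | P i) F i) = \sum_(i <- s | P i) complex.Re (F i).
Proof. by apply: (big_morph _ complexRe_is_additive). Qed.

Lemma ReM_real r z : complex.Re (r%:C * z) = r * complex.Re z.
Proof. by case: z => a b /=; rewrite mul0r subr0. Qed.

(** The form with total variation is meant for the sawtooth weights below, which are not
    monotone. *)
Lemma abel_variation (c : nat -> R[i]) (t : nat -> R) a b B : (a <= b)%N ->
  (forall n, (a <= n <= b)%N -> cabs (\sum_(a <= i < n) c i) <= B) ->
  cabs (\sum_(a <= n < b) (t n)%:C * c n) <=
    B * (`|t b| + \sum_(a <= n < b) `|t n - t n.+1|).
Proof.
move=> ab hB; pose S n := \sum_(a <= i < n) c i.
have -> : \sum_(a <= n < b) (t n)%:C * c n =
  (t b)%:C * S b + \sum_(a <= n < b) (t n - t n.+1)%:C * S n.+1.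
  elim: b ab {hB} => [|b IH].
    by rewrite leqn0 => /eqP ->; rewrite /S !big_geq // mulr0 addr0.
  rewrite leq_eqVlt => /predU1P[<-|]; first by rewrite /S !big_geq // mulr0 addr0.
  rewrite ltnS => ab; rewrite !big_nat_recr //= IH // /S big_nat_recr //=.
  by rewrite rmorphB /=; ring.
apply: (le_trans (cabsD _ _)); rewrite mulrDr; apply: lerD.
  by rewrite Normc.normcM cabs_real mulrC ler_wpM2r // hB // ab leqnn.
apply: (le_trans (cabs_sum _ _ _)); rewrite mulr_sumr.
apply: ler_sum_nat => n /andP[an nb]; rewrite Normc.normcM cabs_real mulrC.
by rewrite ler_wpM2r // hB // nb andbT leqW.
Qed.

Lemma abel_bound (c : nat -> R[i]) (t : nat -> R) a b B : (a <= b)%N ->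
  (forall n, (a <= n <= b)%N -> cabs (\sum_(a <= i < n) c i) <= B) ->
  (forall n, (a <= n)%N -> 0 <= t n) -> (forall n, (a <= n)%N -> t n.+1 <= t n) ->
  cabs (\sum_(a <= n < b) (t n)%:C * c n) <= B * t a.
Proof.
move=> ab hB t0 tdec; apply: (le_trans (abel_variation t ab hB)).
rewrite ger0_norm ?t0 //.
have -> : \sum_(a <= n < b) `|t n - t n.+1| = t a - t b.
  rewrite -(opprB (t b)) -(telescope_sumr t) // -sumrN; apply: eq_big_nat => n /andP[an _].
  by rewrite opprB ger0_norm // subr_ge0 tdec.
by rewrite addrC subrK.
Qed.

(** The limit is the supremum of the lower bounds r n - e n, which yields the rate [e n] at once. *)
Lemma real_cauchy_limit (r e : nat -> R) :
  (forall m n, (n <= m)%N -> `|r m - r n| <= e n) ->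
  exists l, forall n, `|r n - l| <= e n.
Proof.
move=> h; pose A := [set r n - e n | n in [set: nat]]%classic.
have key m n : r n - e n <= r m + e m.
  have [mn|/ltnW nm] := leqP n m.
    have := h _ _ mn; have := h _ _ (leqnn m); rewrite subrr normr0 => e0.
    by rewrite ler_norml => /andP[]; lra.
  have := h _ _ nm; have := h _ _ (leqnn n); rewrite subrr normr0 => e0.
  by rewrite ler_norml => /andP[]; lra.
have A0 : (A !=set0)%classic by exists (r 0%N - e 0%N), 0%N.
exists (sup A) => n; rewrite ler_norml; apply/andP; split.
  have : sup A <= r n + e n by apply: ge_sup => // _ [m _ <-].
  lra.
have : r n - e n <= sup A.
  by apply: ub_le_sup; [exists (r 0%N + e 0%N) => _ [m _ <-]|exists n].
lra.
Qed.

Lemma complex_cauchy_limit (s : nat -> R[i]) (e : nat -> R) :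
  (forall m n, (n <= m)%N -> cabs (s m - s n) <= e n) ->
  exists l, forall n, cabs (s n - l) <= 2 * e n.
Proof.
move=> h.
have [a ha] : exists l, forall n, `|complex.Re (s n) - l| <= e n.
  apply: real_cauchy_limit => m n nm; apply: le_trans (h m n nm).
  by apply: le_trans (Re_le_cabs _); case: (s m) (s n) => ? ? [].
have [b hb] : exists l, forall n, `|complex.Im (s n) - l| <= e n.
  apply: real_cauchy_limit => m n nm; apply: le_trans (h m n nm).
  by apply: le_trans (Im_le_cabs _); case: (s m) (s n) => ? ? [].
exists (a +i* b) => n; apply: (le_trans (cabs_le_ReIm _)).
have := ha n; have := hb n; case: (s n) => c d /=; lra.
Qed.

End cabs.

Section character.
Variables (R : realType) (q : nat) (chi : nat -> R[i]).
Hypothesis hchi : dirichlet_character q chi.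

Lemma dchar_gt0 : (0 < q)%N. Proof. by case: hchi. Qed.
Lemma dcharM m n : chi (m * n) = chi m * chi n. Proof. by case: hchi. Qed.
Lemma dcharDq n : chi (n + q) = chi n. Proof. by case: hchi. Qed.
Lemma dchar_neq0 n : (chi n != 0) = coprime n q. Proof. by case: hchi. Qed.

Lemma dchar_mod n : chi (n %% q) = chi n.
Proof.
rewrite {2}(divn_eq n q) addnC; elim: (n %/ q)%N => [|k IH]; first by rewrite addn0.
by rewrite mulSn addnCA addnC dcharDq.
Qed.

Lemma dchar_eqmod m n : m = n %[mod q] -> chi m = chi n.
Proof. by move=> E; rewrite -dchar_mod E dchar_mod. Qed.

Lemma dchar_noncoprime n : ~~ coprime n q -> chi n = 0.
Proof. by rewrite -dchar_neq0 negbK => /eqP. Qed.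

Lemma dchar1 : chi 1 = 1.
Proof.
have h : chi 1 != 0 by rewrite dchar_neq0 coprime1n.
by apply: (mulfI h); rewrite -dcharM muln1 mulr1.
Qed.

Lemma dcharX n j : chi (n ^ j) = chi n ^+ j.
Proof. by elim: j => [|j IH]; rewrite ?dchar1 // expnS dcharM IH exprS. Qed.

Lemma dchar_totient n : coprime n q -> chi n ^+ totient q = 1.
Proof.
move=> cn; rewrite -dcharX -dchar1; apply: dchar_eqmod.
exact: Euler_exp_totient.
Qed.

Lemma cabs_dchar n : coprime n q -> cabs (chi n) = 1.
Proof.
move=> cn; have := congr1 (@Normc.normc R) (dchar_totient cn).
rewrite cabsX Normc.normc1 => /eqP; rewrite pexpr_eq1 ?totient_gt0 ?dchar_gt0 ?cabs_ge0 //.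
by move/eqP.
Qed.

Lemma cabs_dchar_le n : cabs (chi n) <= 1.
Proof.
have [/cabs_dchar ->//|/dchar_noncoprime ->] := boolP (coprime n q).
by rewrite Normc.normc0.
Qed.

Lemma dchar_sum_shift a : \sum_(a <= n < a + q) chi n = \sum_(0 <= n < q) chi n.
Proof.
elim: a => // a IH; rewrite -IH.
case: q dchar_gt0 dcharDq => // p _ hD; rewrite addSn addnS.
by rewrite [RHS]big_ltn ?ltnS ?leq_addr // [LHS]big_nat_recr ?ltnS ?leq_addr //= addrC -addnS hD.
Qed.

Hypothesis nonprincipal : exists2 a, coprime a q & chi a != 1.

Lemma dchar_sum_period : \sum_(0 <= n < q) chi n = 0.
Proof.
have [a ca ha] := nonprincipal.
have q0 := dchar_gt0.
suff E : chi a * \sum_(0 <= n < q) chi n = \sum_(0 <= n < q) chi n.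
  have : (chi a - 1) * \sum_(0 <= n < q) chi n = 0 by rewrite mulrBl mul1r E subrr.
  by move/eqP; rewrite mulf_eq0 subr_eq0 (negPf ha) => /eqP.
rewrite mulr_sumr big_mkord; under eq_bigr do rewrite -dcharM.
rewrite big_mkord.
pose h (i : 'I_q) : 'I_q := Ordinal (ltn_pmod (a * i) q0).
have hinj : injective h.
  move=> i j /(congr1 val) /= /eqP; rewrite -/(_ == _ %[mod _]).
  wlog ij : i j / (i <= j)%N.
    move=> H; case: (leqP i j) => [|/ltnW] ij; first exact: H.
    by rewrite eq_sym => /(H _ _ ij) ->.
  rewrite eq_sym eqn_mod_dvd ?leq_mul2l ?ij ?orbT // -mulnBr Gauss_dvdr; last by rewrite coprime_sym.
  move=> d; apply/val_inj/eqP; rewrite eqn_leq ij /= -subn_eq0.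
  have [//|s0] := posnP (j - i)%N; have := dvdn_leq s0 d.
  by rewrite leqNgt (leq_ltn_trans (leq_subr _ _)).
rewrite [RHS](reindex_inj hinj) /=; apply: eq_bigr => i _.
by rewrite dchar_mod.
Qed.

Lemma dchar_sum_bound a b : cabs (\sum_(a <= n < b) chi n) <= q%:R.
Proof.
have [ba|ab] := leqP b a; first by rewrite big_geq // Normc.normc0.
rewrite -(subnKC (ltnW ab)); move: (b - a)%N => {ab b} d.
elim/ltn_ind: d a => d IH a.
have [qd|dq] := leqP q d.
  rewrite (@big_cat_nat _ _ _ (a + q)) ?leq_addr ?leq_add2l //= dchar_sum_shift.
  rewrite dchar_sum_period add0r -{1}(subnKC qd) addnA; apply: IH.
  by rewrite -subn_gt0 subKn // dchar_gt0.
apply: (le_trans (cabs_sum _ _ _)).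
apply: (@le_trans _ _ (\sum_(a <= n < a + d) 1)).
  by apply: ler_sum_nat => n _; exact: cabs_dchar_le.
by rewrite sumr_const_nat addKn ler_nat ltnW.
Qed.

Definition Lpartial N : R[i] := \sum_(1 <= n < N.+1) (n%:R^-1)%:C * chi n.

(** Sums of chi over a period vanish, so Abel summation bounds the tails by q / (N + 1); treating
    real and imaginary parts separately doubles this. Later information on L(1, chi) comes through
    this rate. *)
Lemma Lpartial_limit :
  exists L, forall N, cabs (Lpartial N - L) <= 2 * q%:R / N.+1%:R.
Proof.
suff [L hL] : exists L, forall N, cabs (Lpartial N - L) <= 2 * (q%:R / N.+1%:R).
  by exists L => N; rewrite -mulrA.
apply: complex_cauchy_limit => M N NM.
rewrite /Lpartial (@big_cat_nat _ _ _ N.+1 1 M.+1) //= addrAC subrr add0r.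
apply: (abel_bound (t := fun n => n%:R^-1)) => // n; first by move=> _; exact: dchar_sum_bound.
move=> Nn; have n0 : (0 < n)%N by apply: leq_trans Nn.
by rewrite lef_pV2 ?posrE ?ltr0n // ler_nat.
Qed.

End character.

(** * The Moebius function and its sums over divisors *)

Section moebius.
Variable R : realType.

Definition moeb (n : nat) : R :=
  if all (fun p => logn p n == 1%N) (primes n) then (-1) ^+ size (primes n) else 0.

Lemma moeb1 : moeb 1 = 1. Proof. by []. Qed.

Lemma moeb_le1 n : `|moeb n| <= 1.
Proof. by rewrite /moeb; case: ifP => _; rewrite ?normr0 // normrX normrN1 expr1n. Qed.

Lemma moeb_prime_mul p e : prime p -> (0 < e)%N -> ~~ (p %| e)%N ->
  moeb (p * e) = - moeb e.
Proof.
move=> pp e0 pe; have p0 := prime_gt0 pp.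
have perm : perm_eq (primes (p * e)) (p :: primes e).
  apply: uniq_perm; rewrite ?primes_uniq //= ?primes_uniq ?andbT.
    by rewrite mem_primes pp e0.
  by move=> r; rewrite primesM // inE primes_prime // inE.
rewrite /moeb (perm_all _ perm) (perm_size perm) /=.
rewrite lognM // (logn_prime p pp) eqxx lognE pp e0 (negPf pe) /=.
have -> : all (fun r => logn r (p * e) == 1%N) (primes e) =
          all (fun r => logn r e == 1%N) (primes e).
  apply: eq_in_all => r; rewrite mem_primes => /and3P[pr _ re].
  rewrite lognM // logn_prime //.
  by have [rp|//] := eqVneq r p; move: re; rewrite rp (negPf pe).
by case: ifP => _; rewrite ?oppr0 // exprS mulN1r.
Qed.

Lemma moeb_ppow_mul p j e : prime p -> (0 < e)%N -> ~~ (p %| e)%N -> (1 < j)%N ->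
  moeb (p ^ j * e) = 0.
Proof.
move=> pp e0 pe j1; have p0 := prime_gt0 pp; rewrite /moeb ifN //.
have pj : (0 < p ^ j)%N by rewrite expn_gt0 p0.
apply/negP => /allP /(_ p); rewrite mem_primes pp muln_gt0 pj e0 /=.
rewrite dvdn_mulr ?dvdn_exp ?(ltnW j1) // => /(_ isT).
by rewrite lognM // pfactorK // lognE pp e0 (negPf pe) /= addn0 => /eqP j1'; rewrite j1' in j1.
Qed.

(** Only j = 0 and j = 1 survive, so mu acts as a difference operator in the direction p. A constant
    F then cancels, and F = ln leaves -ln p times the sum of mu over the divisors of m. *)
Lemma moeb_sum_ppart (F : nat -> R) p a m : prime p -> (0 < a)%N -> (0 < m)%N ->
  ~~ (p %| m)%N ->
  \sum_(d <- divisors (p ^ a * m)) moeb d * F d =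
  \sum_(e <- divisors m) moeb e * (F e - F (p * e)%N).
Proof.
move=> pp; case: a => // a _ m0 pm; rewrite sum_divisors_ppart // big_nat_recl // big_nat_recl //=.
have pe e : e \in divisors m -> (0 < e)%N /\ ~~ (p %| e)%N.
  rewrite -dvdn_divisors // => em; split; first exact: dvdn_gt0 em.
  by apply: contra pm => /dvdn_trans; apply.
rewrite [X in _ + (_ + X)]big1 ?addr0; last first.
  move=> j _; rewrite big_seq big1 // => e /pe[e0 hp].
  by rewrite moeb_ppow_mul // mul0r.
rewrite -big_split /= big_seq [RHS]big_seq; apply: eq_bigr => e /pe[e0 hp].
by rewrite expn0 mul1n expn1 moeb_prime_mul //; ring.
Qed.

Lemma sum_moeb n : (1 < n)%N -> \sum_(d <- divisors n) moeb d = 0.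
Proof.
suff : forall n, (0 < n)%N -> (1 < n)%N -> \sum_(d <- divisors n) moeb d = 0.
  by move=> h n1; apply: h => //; apply: ltnW.
apply: ppart_ind => // p a m pp a0 m0 pm _ _.
under eq_bigr do rewrite -[moeb _]mulr1.
rewrite (moeb_sum_ppart (fun=> 1)) // big1 // => e _.
by rewrite subrr mulr0.
Qed.

Lemma sum_moeb_ln n : (0 < n)%N ->
  \sum_(d <- divisors n) moeb d * ln d%:R = - Lam R n.
Proof.
move: n; apply: ppart_ind; first by rewrite big_seq1 ln1 mulr0 Lam1 oppr0.
move=> p a m pp a0 m0 pm _; rewrite (moeb_sum_ppart (fun d => ln d%:R)) //.
have -> : \sum_(e <- divisors m) moeb e * (ln e%:R - ln (p * e)%:R) =
    - ln p%:R * \sum_(e <- divisors m) moeb e.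
  rewrite mulr_sumr big_seq [RHS]big_seq; apply: eq_bigr => e.
  rewrite -dvdn_divisors // => /(dvdn_gt0 m0) e0.
  by rewrite natrM lnM ?posrE ?ltr0n // ?prime_gt0 //; ring.
have [m1|m1] := leqP m 1.
  have -> : m = 1%N by apply/eqP; rewrite eqn_leq m1 m0.
  by rewrite big_seq1 moeb1 mulr1 muln1 Lam_ppow.
by rewrite sum_moeb // mulr0 Lam_mul_eq0 // oppr0.
Qed.

End moebius.

(** * Lambda-sums twisted by a nonprincipal character *)

Section nonprincipal.
Variables (R : realType) (q : nat) (chi : nat -> R[i]).
Hypothesis hchi : dirichlet_character q chi.
Hypothesis nonprincipal : exists2 a, coprime a q & chi a != 1.
Variable L : R[i].
Hypothesis hL : forall N, cabs (Lpartial chi N - L) <= 2 * q%:R / N.+1%:R.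

Definition Lamsum N : R[i] := \sum_(1 <= n < N.+1) (Lam R n / n%:R)%:C * chi n.

Let q0 : (0 : R) <= q%:R. Proof. by []. Qed.

Lemma log_twist_bound : exists C, forall N,
  cabs (\sum_(1 <= n < N.+1) (ln n%:R / n%:R)%:C * chi n) <= C.
Proof.
(* Since n (ln (n+1) - ln n) <= 1 <= ln n from n = 4 on, ln n / n decreases there; the terms before
   4 are bounded trivially. *)
have ln4 : 1 <= ln (4 : R).
  have -> : 4 = 2 ^+ 2 :> R by ring.
  by rewrite lnXn // mulr2n; have := @ln_ge_1subV R 2 (ltr0Sn _ _); lra.
pose t n : R := ln n%:R / n%:R.
have t0 n : 0 <= t n by rewrite divr_ge0 ?ln_nat_ge0.
have tdec n : (4 <= n)%N -> t n.+1 <= t n.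
  move=> n4; have n0 : (0 < n)%N by apply: leq_trans n4.
  have n0R : (0 : R) < n%:R by rewrite ltr0n.
  have n1R : (0 : R) < n.+1%:R by rewrite ltr0n.
  rewrite /t ler_pdivrMr // mulrAC ler_pdivlMr //.
  have h1 := @lnS_le R n n0; have h2 : 1 <= ln (n%:R : R) by apply: le_trans ln4 (ler_ln_nat _ _ n4).
  have := ler_wpM2l (ltW n0R) h1; rewrite divff ?gt_eqF //.
  move: h2; move: (ln n.+1%:R) (ln n%:R) => u v; rewrite -natr1; nra.
exists (\sum_(1 <= n < 4) t n + q%:R * t 4%N) => N.
have c1 n : cabs ((t n)%:C * chi n) <= t n.
  rewrite Normc.normcM cabs_real ger0_norm // -[X in _ <= X]mulr1 ler_wpM2l //.
  exact: cabs_dchar_le hchi _.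
have [N4|N4] := leqP N.+1 4.
  apply: (le_trans (cabs_sum _ _ _)).
  apply: (@le_trans _ _ (\sum_(1 <= n < N.+1) t n)); first by apply: ler_sum => n _; exact: c1.
  rewrite (@big_cat_nat _ _ _ N.+1 1 4) //= -addrA lerDl.
  by rewrite addr_ge0 ?sumr_ge0 // mulr_ge0.
rewrite (@big_cat_nat _ _ _ 4 1 N.+1) //=; last exact: ltnW.
apply: (le_trans (cabsD _ _)); apply: lerD.
  by apply: (le_trans (cabs_sum _ _ _)); apply: ler_sum => n _; exact: c1.
by apply: (abel_bound (t := t)) => //; [exact: ltnW|move=> n _; exact: dchar_sum_bound].
Qed.

Lemma succ_div_inv_le N d : (0 < N)%N -> (0 < d)%N -> ((N %/ d).+1%:R)^-1 <= d%:R / N%:R :> R.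
Proof.
move=> N0 d0; rewrite ler_pdivlMr ?ltr0n // mulrC ler_pdivrMr ?ltr0n // -natrM ler_nat.
by rewrite mulnC ltnW // ltn_ceil.
Qed.

Lemma Lpartial_div_bound N d : (0 < N)%N -> (0 < d)%N ->
  cabs (Lpartial chi (N %/ d) - L) <= 2 * q%:R * (d%:R / N%:R).
Proof.
move=> N0 d0; apply: (le_trans (hL _)); rewrite ler_wpM2l ?mulr_ge0 //.
exact: succ_div_inv_le.
Qed.

Lemma sum_twist_divisors (F G : nat -> R) N :
  \sum_(1 <= n < N.+1) ((\sum_(d <- divisors n) F d * G (n %/ d)%N) / n%:R)%:C * chi n =
  \sum_(1 <= d < N.+1) (F d / d%:R)%:C * chi d *
    \sum_(1 <= m < (N %/ d).+1) (G m / m%:R)%:C * chi m.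
Proof.
under [RHS]eq_bigr do rewrite mulr_sumr.
rewrite -(sum_divisors_swap (fun d m => (F d / d%:R)%:C * chi d * ((G m / m%:R)%:C * chi m))).
apply: eq_big_nat => n /andP[n0 _]; rewrite mulr_suml rmorph_sum mulr_suml.
rewrite big_seq [RHS]big_seq; apply: eq_bigr => d.
rewrite -dvdn_divisors // => dn; have d0 := dvdn_gt0 n0 dn.
rewrite -[in chi n](divnK dn) (dcharM hchi) -[in n%:R](divnK dn) natrM invfM !rmorphM /=.
ring.
Qed.

(** As ln is the convolution of Lambda with 1, the bounded sum of ln(n) chi(n) / n is the Lambda-sum
    with each term multiplied by a partial sum of L(1, chi). Replacing these by L costs at most 2q
    psi(N) / N <= 8q, and L can be divided out. *)
Lemma Lamsum_bound : L != 0 -> exists C, forall N, (0 < N)%N -> cabs (Lamsum N) <= C.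
Proof.
move=> L0; have cL : 0 < cabs L.
  by rewrite lt_neqAle eq_sym cabs_ge0 andbT; apply: contra L0 => /eqP/Normc.eq0_normc ->.
have [C hC] := log_twist_bound; exists ((C + 8 * q%:R) / cabs L) => N N0.
rewrite ler_pdivlMr // -Normc.normcM.
have N0R : (0 : R) < N%:R by rewrite ltr0n.
have E : \sum_(1 <= n < N.+1) (ln n%:R / n%:R)%:C * chi n =
  \sum_(1 <= d < N.+1) (Lam R d / d%:R)%:C * chi d * Lpartial chi (N %/ d).
  have := sum_twist_divisors (Lam R) (fun=> 1) N.
  under [X in _ = X -> _]eq_bigr => d _.
    under eq_bigr do rewrite mul1r.
    over.
  move=> <-; apply: eq_big_nat => n /andP[n0 _]; congr ((_ / _)%:C * _).
  by rewrite -sum_Lam_divisors //; apply: eq_bigr => d _; rewrite mulr1.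
have -> : Lamsum N * L = \sum_(1 <= n < N.+1) (ln n%:R / n%:R)%:C * chi n -
   \sum_(1 <= d < N.+1) (Lam R d / d%:R)%:C * chi d * (Lpartial chi (N %/ d) - L).
  rewrite E -sumrB /Lamsum mulr_suml; apply: eq_bigr => d _; ring.
apply: (le_trans (cabsB _ _)); apply: lerD; first exact: hC.
apply: (le_trans (cabs_sum _ _ _)).
apply: (@le_trans _ _ (\sum_(1 <= d < N.+1) Lam R d * (2 * q%:R / N%:R))).
  apply: ler_sum_nat => d /andP[d0 _]; have d0R : (0 : R) < d%:R by rewrite ltr0n.
  have lam0 : 0 <= Lam R d / d%:R by rewrite divr_ge0 ?Lam_ge0.
  rewrite !Normc.normcM cabs_real ger0_norm // -mulrA.
  have -> : Lam R d * (2 * q%:R / N%:R) = Lam R d / d%:R * (2 * q%:R * (d%:R / N%:R)).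
    by field; rewrite !gt_eqF.
  rewrite ler_wpM2l // -[X in _ <= X]mul1r ler_pM ?cabs_ge0 //.
    exact: cabs_dchar_le hchi _.
  exact: Lpartial_div_bound.
rewrite -mulr_suml -/(psi R N); have := psi_le R N => /(ler_wpM2r (_ : 0 <= 2 * q%:R / N%:R)).
move=> /(_ _)/le_trans; apply; first by rewrite divr_ge0 ?mulr_ge0.
by rewrite le_eqVlt; apply/orP; left; apply/eqP; field; rewrite gt_eqF.
Qed.

(* The divisor sums of mu(d) (log N - log d) are log N at 1 and Lambda(n) at
   n > 1, so the sum below is a combination of the partial sums of L(1, chi). *)
Lemma Lamsum_zero : L = 0 -> forall N, (0 < N)%N -> cabs (Lamsum N + (ln N%:R)%:C) <= 2 * q%:R.
Proof.
move=> L0 N N0; have N0R : (0 : R) < N%:R by rewrite ltr0n.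
have := sum_twist_divisors (fun d => moeb R d * (ln N%:R - ln d%:R)) (fun=> 1) N.
under [X in _ = X -> _]eq_bigr => d _.
  under eq_bigr do rewrite mul1r.
  over.
have -> : \sum_(1 <= n < N.+1) ((\sum_(d <- divisors n)
    moeb R d * (ln N%:R - ln d%:R) * 1) / n%:R)%:C * chi n = Lamsum N + (ln N%:R)%:C.
  have H n : (0 < n)%N -> \sum_(d <- divisors n) moeb R d * (ln N%:R - ln d%:R) * 1 =
      ln N%:R * (n == 1%N)%:R + Lam R n.
    move=> n0; under eq_bigr do rewrite mulr1 mulrBr.
    rewrite sumrB sum_moeb_ln // opprK -mulr_suml mulrC; congr (_ * _ + _).
    have [->|n1] := eqVneq n 1%N; first by rewrite big_seq1.
    by rewrite sum_moeb // ltn_neqAle eq_sym n1.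
  rewrite /Lamsum addrC big_ltn ?ltnS // H // [in RHS]big_ltn ?ltnS //=.
  rewrite Lam1 (dchar1 hchi) !mulr1 !addr0 mul0r divr1 rmorph0 add0r; congr (_ + _).
  apply: eq_big_nat => n /andP[n1 _]; rewrite H ?(ltnW n1) //.
  by rewrite gtn_eqF // mulr0 add0r.
move=> ->; apply: (le_trans (cabs_sum _ _ _)).
apply: (@le_trans _ _ (\sum_(1 <= d < N.+1) (2 * q%:R / N%:R) * (ln N%:R - ln d%:R))).
  apply: ler_sum_nat => d /andP[d0 dN]; have d0R : (0 : R) < d%:R by rewrite ltr0n.
  have lnd : 0 <= ln N%:R - ln d%:R :> R by rewrite subr_ge0 ler_ln_nat.
  rewrite !Normc.normcM cabs_real normrM normrM (ger0_norm lnd) normfV normr_nat.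
  have := Lpartial_div_bound N0 d0; rewrite L0 subr0 -/(Lpartial chi (N %/ d)) => hd.
  apply: (@le_trans _ _ ((1 * (ln N%:R - ln d%:R) / d%:R) * 1 * (2 * q%:R * (d%:R / N%:R)))).
    apply: ler_pM => //; rewrite ?mulr_ge0 ?cabs_ge0 ?invr_ge0 //.
    apply: ler_pM => //; rewrite ?mulr_ge0 ?cabs_ge0 ?invr_ge0 //.
      by rewrite ler_wpM2r ?invr_ge0 // ler_wpM2r // moeb_le1.
    exact: cabs_dchar_le hchi _.
  by rewrite le_eqVlt; apply/orP; left; apply/eqP; field; rewrite !gt_eqF.
rewrite -mulr_sumr sumrB -ln_factE sumr_const_nat subn1 /= -(mulr_natr (ln _)).
have h := @ln_fact_ge R N.
apply: (@le_trans _ _ (2 * q%:R / N%:R * N%:R)); last by rewrite divfK ?gt_eqF.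
rewrite ler_wpM2l ?divr_ge0 ?mulr_ge0 //; move: h; rewrite mulrC; lra.
Qed.

End nonprincipal.

(** * Nonvanishing of L(1, chi) for real chi *)

Section one_star_real.
Variables (R : realType) (r : nat -> R).
Hypothesis r1 : r 1%N = 1.
Hypothesis rM : forall m n, r (m * n)%N = r m * r n.
Hypothesis r3 : forall n, [\/ r n = 0, r n = 1 | r n = -1].

Definition onestar n : R := \sum_(d <- divisors n) r d.

Lemma onestar_ppart p a m : prime p -> (0 < m)%N -> ~~ (p %| m)%N ->
  onestar (p ^ a * m) = (\sum_(0 <= j < a.+1) r p ^+ j) * onestar m.
Proof.
move=> pp m0 pm; rewrite /onestar sum_divisors_ppart // mulr_suml.
apply: eq_bigr => j _; rewrite mulr_sumr; apply: eq_bigr => e _; rewrite rM.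
by congr (_ * _); elim: j => [|j IH]; rewrite ?expn0 ?r1 // expnS rM IH exprS.
Qed.

Lemma sum_pow_pm p a :
  0 <= \sum_(0 <= j < a.+1) r p ^+ j /\ (~~ odd a -> 1 <= \sum_(0 <= j < a.+1) r p ^+ j).
Proof.
case: (r3 p) => ->.
- rewrite big_nat_recl //= big1 ?addr0 // => j _; by rewrite exprS mul0r.
- under eq_bigr do rewrite expr1n.
  by rewrite sumr_const_nat subn0 ler1n.
- suff -> : \sum_(0 <= j < a.+1) (-1) ^+ j = (~~ odd a)%:R :> R by case: (odd a); split.
  elim: a => [|a IH]; first by rewrite big_nat1.
  rewrite big_nat_recr //= IH -signr_odd /=; case: (odd a) => /=; rewrite ?expr1 ?expr0; lra.
Qed.

Lemma onestar_ge0 n : 0 <= onestar n.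
Proof.
have [->|] := posnP n; first by rewrite /onestar big_seq1 r1.
move: n; apply: ppart_ind; first by rewrite /onestar big_seq1 r1.
move=> p a m pp a0 m0 pm IH; rewrite onestar_ppart // mulr_ge0 //.
by case: (sum_pow_pm p a).
Qed.

Lemma onestar_sqr_ge1 n : (0 < n)%N -> 1 <= onestar (n ^ 2).
Proof.
move: n; apply: ppart_ind; first by rewrite /onestar big_seq1 r1.
move=> p a m pp a0 m0 pm IH; rewrite expnMn -expnM onestar_ppart ?expn_gt0 ?m0 //; last first.
  by rewrite Euclid_dvdX // negb_and pm.
have [_ h] := sum_pow_pm p (a * 2); rewrite -[X in X <= _]mul1r; apply: ler_pM => //.
by apply: h; rewrite muln2 odd_double.
Qed.

(** The weight N - n vanishes at the cutoff, which makes the remainder [sawtooth] continuous in N /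
    d; its variation in d is then small enough for Abel summation. *)
Definition weighted_onestar N := \sum_(1 <= n < N.+1) onestar n * (N%:R - n%:R).

(** Each of the M squares i^2 <= M^2 carries weight at least N - M^2 = M^2. *)
Lemma weighted_onestar_ge M : (M%:R) ^+ 3 <= weighted_onestar (2 * M ^ 2).
Proof.
rewrite /weighted_onestar; set N := (2 * M ^ 2)%N.
apply: (@le_trans _ _ (\sum_(m <- [seq (i ^ 2)%N | i <- index_iota 1 M.+1])
    onestar m * (N%:R - m%:R))).
  rewrite big_map; apply: (@le_trans _ _ (\sum_(1 <= i < M.+1) (M ^ 2)%:R)).
    by rewrite sumr_const_nat subn1 /= -(mulr_natr (M ^ 2)%:R) natrX exprSr.
  apply: ler_sum_nat => i /andP[i0 iM].
  rewrite -[X in X <= _]mul1r; apply: ler_pM => //; first exact: onestar_sqr_ge1.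
  rewrite lerBrDr -natrD ler_nat /N mul2n -addnn leq_add2l leq_sqr //.
apply: ler_sum_subset.
- rewrite map_inj_uniq ?iota_uniq // => i j /eqP; rewrite eqn_sqr //.
  by move/eqP.
- move=> n /(@seq.mapP _ _ _ _ _)[i + ->]; rewrite !mem_index_iota => /andP[i0 iM].
  rewrite expn_gt0 i0 /= ltnS /N; rewrite (@leq_trans (M ^ 2)) ?leq_sqr //.
  by rewrite leq_pmull.
- move=> n; rewrite mem_index_iota => /andP[_ nN].
  by rewrite mulr_ge0 ?onestar_ge0 // subr_ge0 ler_nat.
Qed.

(* theta (1 - theta) / 2 * d for theta the fractional part of N / d *)
Definition sawtooth N d : R := (N %% d)%:R * (d%:R - (N %% d)%:R) / (2 * d%:R).

Lemma weighted_onestarE N : weighted_onestar N =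
  \sum_(1 <= d < N.+1) r d * (N%:R ^+ 2 / (2 * d%:R) - N%:R / 2 + sawtooth N d).
Proof.
rewrite /weighted_onestar.
transitivity (\sum_(1 <= n < N.+1) \sum_(d <- divisors n) r d * (N%:R - (d * (n %/ d))%:R)).
  apply: eq_big_nat => n /andP[n0 _]; rewrite /onestar mulr_suml big_seq [RHS]big_seq.
  by apply: eq_bigr => d; rewrite -dvdn_divisors // => dn; rewrite mulnC divnK.
rewrite (sum_divisors_swap (fun d m => r d * (N%:R - (d * m)%:R))).
apply: eq_big_nat => d /andP[d0 _]; rewrite -mulr_sumr; congr (_ * _).
have d0R : d%:R != 0 :> R by rewrite pnatr_eq0 -lt0n.
have -> : forall n, \sum_(1 <= m < n.+1) (N%:R - (d * m)%:R) =
    n%:R * N%:R - d%:R * n%:R * (n%:R + 1) / 2 :> R.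
  elim => [|n IH]; first by rewrite big_geq // !(mul0r, mulr0) subrr.
  by rewrite big_nat_recr //= IH natrM -natr1; field.
rewrite /sawtooth; have : N%:R = (N %/ d)%:R * d%:R + (N %% d)%:R :> R.
  by rewrite -natrM -natrD -divn_eq.
move: (N %/ d)%:R (N %% d)%:R => n rho ->; field; exact: d0R.
Qed.

(** As a function of N / d, u (1 - u) for the fractional part u is 1-Lipschitz, also across
    integers; this gives the first term after multiplication by d / 2. The 1/8 bounds the effect of
    changing the factor d, as u (1 - u) <= 1/4. *)
Lemma sawtooth_variation N d : (0 < d)%N ->
  `|sawtooth N d - sawtooth N d.+1| <= N%:R / 2 / d.+1%:R + 1 / 8.
Proof.
move=> d0.
have d0R : (0 : R) < d%:R by rewrite ltr0n.
have d1R : (0 : R) < d.+1%:R by rewrite ltr0n.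
pose a : R := (N %% d)%:R / d%:R; pose b : R := (N %% d.+1)%:R / d.+1%:R.
have a0 : 0 <= a by rewrite divr_ge0.
have b0 : 0 <= b by rewrite divr_ge0.
have a1 : a <= 1 by rewrite ler_pdivrMr // mul1r ler_nat ltnW // ltn_pmod.
have b1 : b <= 1 by rewrite ler_pdivrMr // mul1r ler_nat ltnW // ltn_pmod.
have sa : sawtooth N d = d%:R * (a * (1 - a)) / 2.
  by rewrite /sawtooth /a; field; rewrite gt_eqF.
have sb : sawtooth N d.+1 = d.+1%:R * (b * (1 - b)) / 2.
  rewrite /sawtooth /b; move: (d.+1%:R : R) d1R ((N %% d.+1)%:R : R) => x x0 y.
  by field; rewrite gt_eqF.
have ua : N%:R / d%:R = (N %/ d)%:R + a.
  by rewrite {1}(divn_eq N d) natrD natrM mulrDl mulfK ?gt_eqF.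
have ub : N%:R / d.+1%:R = (N %/ d.+1)%:R + b.
  by rewrite {1}(divn_eq N d.+1) natrD natrM mulrDl mulfK ?gt_eqF.
have key : `|a * (1 - a) - b * (1 - b)| <= N%:R / d%:R - N%:R / d.+1%:R.
  rewrite ua ub.
  have nn : (N %/ d.+1 <= N %/ d)%N by apply: leq_div2l.
  have uv : 0 <= N%:R / d%:R - N%:R / d.+1%:R :> R.
    by rewrite subr_ge0 ler_wpM2l // lef_pV2 ?posrE // ler_nat.
  move: uv; rewrite ua ub; move: nn; rewrite leq_eqVlt => /predU1P[->|nn] uv.
    have ab : 0 <= a - b by lra.
    rewrite ler_norml; apply/andP; split; nra.
  have : (N %/ d.+1)%:R + 1 <= (N %/ d)%:R :> R by rewrite natr1 ler_nat.
  move=> nn'; rewrite ler_norml; apply/andP; split; nra.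
have dN : d%:R * (N%:R / d%:R - N%:R / d.+1%:R) = N%:R / d.+1%:R :> R.
  by field; rewrite -natr1 in d1R *; rewrite !gt_eqF.
have bb : b * (1 - b) <= 1 / 4 by have := sqr_ge0 (b - 1 / 2); rewrite expr2; lra.
have bb0 : 0 <= b * (1 - b) by rewrite mulr_ge0 // subr_ge0.
rewrite sa sb; have -> : d%:R * (a * (1 - a)) / 2 - d.+1%:R * (b * (1 - b)) / 2 =
   d%:R * (a * (1 - a) - b * (1 - b)) / 2 - b * (1 - b) / 2.
  by rewrite -natr1; field.
apply: (le_trans (ler_normB _ _)); apply: lerD; last by rewrite ger0_norm; lra.
rewrite !normrM normr_nat normfV normr_nat [N%:R / 2 / _]mulrAC.
by rewrite ler_wpM2r ?invr_ge0 // (le_trans (ler_wpM2l (ltW d0R) key)) // dN.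
Qed.

End one_star_real.

Section real_nonprincipal.
Variables (R : realType) (q : nat) (chi : nat -> R[i]).
Hypothesis hchi : dirichlet_character q chi.
Hypothesis nonprincipal : exists2 a, coprime a q & chi a != 1.
Hypothesis chi_real : forall n, complex.Im (chi n) = 0.
Hypothesis hL0 : forall N, cabs (Lpartial chi N) <= 2 * q%:R / N.+1%:R.

Let r n : R := complex.Re (chi n).

Let chiE n : chi n = (r n)%:C.
Proof. by rewrite /r; have := chi_real n; case: (chi n) => a b /= ->. Qed.

Let rM m n : r (m * n) = r m * r n.
Proof. by rewrite /r (dcharM hchi) !chiE /= mulr0 subr0. Qed.

Let r1 : r 1 = 1. Proof. by rewrite /r (dchar1 hchi). Qed.

Let r3 n : [\/ r n = 0, r n = 1 | r n = -1].
Proof.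
have [cn|cn] := boolP (coprime n q); last by rewrite /r (dchar_noncoprime hchi cn); constructor 1.
have := cabs_dchar hchi cn; rewrite chiE cabs_real => /eqP.
by rewrite eqr_norml ler01 andbT => /orP[/eqP ->|/eqP ->]; [constructor 2|constructor 3].
Qed.

Let sum_r_cabs (t : nat -> R) a b :
  `|\sum_(a <= n < b) r n * t n| = cabs (\sum_(a <= n < b) (t n)%:C * chi n).
Proof.
rewrite -cabs_real rmorph_sum; congr (cabs _); apply: eq_bigr => n _.
by rewrite chiE rmorphM mulrC.
Qed.

Lemma weighted_onestar_le N : (0 < N)%N ->
  weighted_onestar r N <= q%:R * N%:R * (4 + ln N%:R).
Proof.
move=> N0; have N0R : (0 : R) < N%:R by rewrite ltr0n.
have q0 : (0 : R) <= q%:R by [].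
have N1 : 1 <= N%:R :> R by rewrite ler1n.
have B a b n : (a <= n <= b)%N -> cabs (\sum_(a <= i < n) chi i) <= q%:R.
  by move=> _; exact: dchar_sum_bound.
rewrite (weighted_onestarE r).
have -> : \sum_(1 <= d < N.+1) r d * (N%:R ^+ 2 / (2 * d%:R) - N%:R / 2 + sawtooth R N d) =
  N%:R ^+ 2 / 2 * (\sum_(1 <= d < N.+1) r d * d%:R^-1)
  - N%:R / 2 * (\sum_(1 <= d < N.+1) r d * 1)
  + \sum_(1 <= d < N.+1) r d * sawtooth R N d.
  rewrite !mulr_sumr -sumrB -big_split /=; apply: eq_bigr => d _.
  by rewrite invfM; ring.
(* Here L(1, chi) = 0 enters: the coefficient of the main term N^2 / 2 is only O(q / N). *)
have h1 : \sum_(1 <= d < N.+1) r d * d%:R^-1 <= 2 * q%:R / N%:R.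
  apply: (le_trans (ler_norm _)); rewrite sum_r_cabs; apply: (le_trans (hL0 N)).
  by rewrite ler_wpM2l ?mulr_ge0 // lef_pV2 ?posrE ?ltr0n // ler_nat.
have h2 : - (\sum_(1 <= d < N.+1) r d * 1) <= q%:R.
  apply: (le_trans (ler_norm _)); rewrite normrN (sum_r_cabs (fun=> 1)).
  by under eq_bigr do rewrite rmorph1 mul1r; exact: dchar_sum_bound.
have h3 : \sum_(1 <= d < N.+1) r d * sawtooth R N d <= q%:R * (N%:R / 2 * (2 + ln N%:R) + 1).
  apply: (le_trans (ler_norm _)); rewrite sum_r_cabs.
  apply: (le_trans (abel_variation _ _ (B 1 N.+1))) => //.
  rewrite ler_wpM2l //.
  have e1 : `|sawtooth R N N.+1| <= 1 / 2.
    rewrite /sawtooth modn_small // -natr1.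
    have -> : N%:R + 1 - N%:R = 1 :> R by ring.
    rewrite mulr1 ger0_norm; last by rewrite divr_ge0 //; lra.
    by rewrite ler_pdivrMr; lra.
  have e2 : \sum_(1 <= n < N.+1) `|sawtooth R N n - sawtooth R N n.+1| <=
     \sum_(1 <= n < N.+1) (N%:R / 2 / n%:R + 1 / 8).
    apply: ler_sum_nat => n /andP[n0 _]; apply: (le_trans (sawtooth_variation _ _ n0)).
    rewrite lerD2r ler_wpM2l ?divr_ge0 // lef_pV2 ?posrE ?ltr0n // ler_nat //.
  have e3 := harmonic_sum_le R N0.
  move: e2; rewrite big_split /= -mulr_sumr -/(harmonic_sum R N) sumr_const_nat subn1 /=.
  rewrite -(mulr_natr (1 / 8)) => e2.
  have := ler_wpM2l (_ : 0 <= N%:R / 2) e3; rewrite divr_ge0 // => /(_ isT); lra.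
have q1 : 1 <= q%:R :> R by rewrite ler1n (dchar_gt0 hchi).
have h1' : N%:R ^+ 2 / 2 * (\sum_(1 <= d < N.+1) r d * d%:R^-1) <= q%:R * N%:R.
  apply: (@le_trans _ _ (N%:R ^+ 2 / 2 * (2 * q%:R / N%:R))).
    by rewrite ler_wpM2l // divr_ge0 // exprn_ge0.
  by rewrite le_eqVlt; apply/orP; left; apply/eqP; field; rewrite gt_eqF.
have h2' : N%:R / 2 * - (\sum_(1 <= d < N.+1) r d * 1) <= N%:R / 2 * q%:R.
  by rewrite ler_wpM2l // divr_ge0.
have l0 := @ln_nat_ge0 R N; have h4 : 0 <= q%:R * N%:R * ln N%:R :> R by rewrite !mulr_ge0.
have h5 : q%:R <= q%:R * N%:R :> R by rewrite ler_peMr.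
by nra.
Qed.

(* At N = 2 m^4 the sum of (1 * chi)(n) (N - n) is at least m^6, because of the
   squares, but the vanishing of L(1, chi) makes it O(N log N). *)
Lemma real_nonprincipal_contra : False.
Proof.
have q1 : 1 <= q%:R :> R by rewrite ler1n (dchar_gt0 hchi).
(* After division by m^4 the two estimates leave m^2 <= q (10 + 8 (m - 1)) <= 10 q m, which fails at
   m = 10 q + 1. *)
suff H m : (1 <= m)%N -> (m%:R : R) <= 10 * q%:R.
  have := H (10 * q + 1)%N; rewrite natrD natrM addn1 => /(_ isT); lra.
move=> m1; have m1R : 1 <= m%:R :> R by rewrite ler1n.
have m0R : (0 : R) < m%:R by lra.
have N0 : (0 < 2 * (m ^ 2) ^ 2)%N by rewrite muln_gt0 !expn_gt0 m1.
have := le_trans (weighted_onestar_ge r1 rM r3 (m ^ 2)) (weighted_onestar_le N0).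
rewrite -expnM natrM !natrX.
have m4 : (0 : R) < m%:R ^+ 4 by rewrite exprn_gt0.
rewrite lnM ?posrE ?exprn_gt0 // lnXn //.
have l2 : ln 2 <= (1 : R) by apply: (le_trans (ln_le_subr1 _)); lra.
have lm : ln m%:R <= m%:R - 1 :> R by exact: ln_le_subr1.
have -> : m%:R ^+ 2 ^+ 3 = m%:R ^+ 4 * (m%:R * m%:R) :> R by ring.
have -> : q%:R * (2 * m%:R ^+ (2 * 2)) * (4 + (ln 2 + ln m%:R *+ (2 * 2))) =
   m%:R ^+ 4 * (q%:R * (8 + 2 * ln 2 + 8 * ln m%:R)) :> R.
  by rewrite -(mulr_natr (ln m%:R)) natrM; ring.
rewrite ler_pM2l // => h.
have : q%:R * (8 + 2 * ln 2 + 8 * ln m%:R) <= q%:R * (10 * m%:R) :> R.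
  by rewrite ler_wpM2l //; lra.
move=> /(le_trans h); rewrite mulrA [q%:R * 10]mulrC ler_pM2r //.
Qed.

End real_nonprincipal.

(** * Primes congruent to 1 modulo k *)

Lemma exists_prim_root (F : numClosedFieldType) n : (0 < n)%N ->
  exists z : F, n.-primitive_root z.
Proof.
move=> n0; pose p : {poly F} := 'X^n - 1; have [r Dp] := closed_field_poly_normal p.
rewrite (monicP _) ?monicXnsubC // scale1r in Dp.
have rn1 : all n.-unity_root r by apply/allP => z; rewrite -root_prod_XsubC -Dp.
have szr : (n < (size r).+1)%N by rewrite -(size_prod_XsubC r id) -Dp size_XnsubC.
have [|z] := hasP (has_prim_root n0 rn1 _ szr); last by exists z.
by rewrite -separable_prod_XsubC -Dp separable_Xn_sub_1 // pnatr_eq0 -lt0n.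
Qed.

Lemma prim_root_neq0 (F : fieldType) n (z : F) : n.-primitive_root z -> z != 0.
Proof.
move=> hz; have n0 := prim_order_gt0 hz; apply/eqP => z0.
by have := prim_expr_order hz; rewrite z0 expr0n gtn_eqF //= => /esym/eqP; rewrite oner_eq0.
Qed.

(** The irreducible characters of the abelian group of units separate its elements. Their values lie
    in [algC] and are carried to R[i] by matching a primitive root of unity z of order |G| in [algC]
    with such a root w in R[i]. *)
Lemma dchar_separation (R : realType) k a : (1 < k)%N -> coprime a k -> a <> 1 %[mod k] ->
  exists chi : nat -> R[i], dirichlet_character k chi /\ chi a != 1.
Proof.
move=> k1 ca ha; have k0 : (0 < k)%N by apply: ltnW.
pose G := units_Zp k.
pose u n : {unit 'Z_k} := insubd (1%g : {unit 'Z_k}) (n%:R : 'Z_k).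
have uE n : coprime n k -> val (u n) = n%:R.
  by move=> cn; rewrite /u insubdK // unfold_in unitZpE // coprime_sym.
have uM m n : coprime m k -> coprime n k -> u (m * n)%N = (u m * u n)%g.
  move=> cm cn; apply/val_inj; rewrite FinRing.val_unitM !uE ?natrM //.
  by rewrite coprimeMl cm cn.
have ua1 : u a != 1%g.
  apply/eqP => /(congr1 val); rewrite uE // => /(congr1 (@nat_of_ord _)).
  rewrite val_Zp_nat //= => h; apply: ha; rewrite h modn_small //.
  by have := @val_Zp_nat _ k1 1; rewrite modn_small // => <-.
have [i hi] : exists i : Iirr G, u a \notin cfker 'chi_i.
  apply/existsP; rewrite -negb_forall; apply: contra ua1 => /forallP h.
  have : u a \in \bigcap_(i : Iirr G) cfker 'chi_i by apply/bigcapP.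
  by rewrite TI_cfker_irr inE.
have lin : 'chi_i \is a linear_char by apply/char_abelianP/units_Zp_abelian.
have inG x : x \in G by rewrite inE.
have m0 : (0 < #|G|)%N by apply/card_gt0P; exists 1%g.
have rootG x : ('chi_i x : algC) ^+ #|G| = 1.
  have /dvdnP[d ->] : (fingroup.order x %| #|G|)%N by apply: order_dvdG.
  by rewrite mulnC exprM (lin_char_unity_root lin) // expr1n.
have [z hz] := exists_prim_root algC m0.
have [w hw] := exists_prim_root (R[i] : numClosedFieldType) m0.
pose e (x : algC) : nat := if [pick j : 'I_#|G| | x == z ^+ j] is Some j then j else 0%N.
have eE x : x ^+ #|G| = 1 -> z ^+ e x = x.
  move=> hx; have [j xj] := prim_rootP hz hx; rewrite /e.
  by case: pickP => [l /eqP ->//|/(_ j)]; rewrite xj eqxx.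
pose chi n : R[i] := if coprime n k then w ^+ e ('chi_i (u n)) else 0.
exists chi; split.
  split => // [m n|n|n].
  - rewrite /chi coprimeMl; case cm : (coprime m k); last by rewrite mul0r.
    case cn : (coprime n k); last by rewrite mulr0.
    rewrite -exprD; apply/eqP; rewrite (eq_prim_root_expr hw) -(eq_prim_root_expr hz).
    by rewrite exprD !eE ?rootG // uM // lin_charM.
  - rewrite /chi -[coprime (n + k) k]coprime_modl modnDr coprime_modl /u; congr (if _ then w ^+ e ('chi_i (insubd _ _)) else _).
    by apply/val_inj; rewrite /= !val_Zp_nat // modnDr.
  - by rewrite /chi; case: ifP => _; rewrite ?eqxx // expf_neq0 // (prim_root_neq0 hw).
rewrite /chi ca -[X in _ != X](expr0 w) (eq_prim_root_expr hw) -(eq_prim_root_expr hz).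
rewrite eE ?rootG // expr0.
move: hi; rewrite cfkerEchar ?irr_char // inE inG /= (lin_char1 lin).
by [].
Qed.

(** * Orthogonality of the characters modulo k *)

Section characters.
Variables (R : realType) (k : nat).
Hypothesis k1 : (1 < k)%N.

(** [fset_set] in [dchars] is meaningful only for a finite set. A character is determined by writing
    its nonzero values as powers of one primitive root of order [totient k]. *)
Lemma finite_dchars : finite_set [set chi : nat -> R[i] | dirichlet_character k chi]%classic.
Proof.
have k0 : (0 < k)%N by apply: ltnW.
have m0 : (0 < totient k)%N by rewrite totient_gt0.
have [w hw] := exists_prim_root (R[i] : numClosedFieldType) m0.
pose g (f : {ffun 'I_k -> 'I_(totient k)}) (n : nat) : R[i] :=
  if coprime n k then w ^+ f (Ordinal (ltn_pmod n k0)) else 0.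
apply: (@sub_finite_set _ _ (range g)); last exact/finite_image/finite_finset.
move=> chi /= hchi.
have ex (i : 'I_k) : {j : 'I_(totient k) | coprime i k -> chi i = w ^+ j}.
  case ci : (coprime i k); last by exists (Ordinal m0).
  by have [j hj] := prim_rootP hw (dchar_totient hchi ci); exists j.
exists [ffun i => sval (ex i)] => //; apply/funext => n; rewrite /g.
case: ifPn => cn; last by rewrite (dchar_noncoprime hchi).
rewrite ffunE; case: (ex _) => j /= hj.
by rewrite -hj ?coprime_modl // (dchar_mod hchi).
Qed.

Definition dchars : {fset (nat -> R[i])} :=
  fset_set [set chi : nat -> R[i] | dirichlet_character k chi]%classic.

Lemma mem_dchars chi : (chi \in dchars) <-> dirichlet_character k chi.
Proof.
rewrite in_fset_set; last exact: finite_dchars.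
by split => [/set_mem|h]; [|apply: mem_set].
Qed.

Lemma dchar_principal : dirichlet_character k (principal_character R k).
Proof.
split => [|m n|n|n]; rewrite /principal_character.
- exact: ltnW.
- by rewrite coprimeMl -natrM mulnb.
- by rewrite -[coprime (n + k) k]coprime_modl modnDr coprime_modl.
- by case: (coprime n k); rewrite ?eqxx ?oner_eq0.
Qed.

Lemma dchar_mul (chi psi : nat -> R[i]) : dirichlet_character k chi ->
  dirichlet_character k psi -> dirichlet_character k (fun n => chi n * psi n).
Proof.
move=> hc hp; split => [|m n|n|n].
- exact: dchar_gt0 hc.
- by rewrite (dcharM hc) (dcharM hp) mulrACA.
- by rewrite (dcharDq hc) (dcharDq hp).
- by rewrite mulf_eq0 negb_or (dchar_neq0 hc) (dchar_neq0 hp) andbb.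
Qed.

Lemma dchar_conj (chi : nat -> R[i]) : dirichlet_character k chi ->
  dirichlet_character k (fun n => (chi n)^*%C).
Proof.
move=> hc; split => [|m n|n|n].
- exact: dchar_gt0 hc.
- by rewrite (dcharM hc) rmorphM.
- by rewrite (dcharDq hc).
- by rewrite conjc_eq0 (dchar_neq0 hc).
Qed.

Lemma dchar_nonprincipal (chi : nat -> R[i]) : dirichlet_character k chi ->
  chi <> principal_character R k -> exists2 a, coprime a k & chi a != 1.
Proof.
move=> hc hn; apply: contrapT => H; apply: hn; apply/funext => n.
rewrite /principal_character; case cn : (coprime n k); last first.
  by rewrite (dchar_noncoprime hc) // cn.
by apply/eqP; apply/negPn/negP => h; apply: H; exists n.
Qed.

Lemma sum_dchars_neq1 a : coprime a k -> a <> 1 %[mod k] -> \sum_(chi <- dchars) chi a = 0.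
Proof.
move=> ca ha; have [psi [hpsi psia]] := dchar_separation R k1 ca ha.
pose h (chi : nat -> R[i]) : nat -> R[i] := fun n => psi n * chi n.
have hD chi : chi \in dchars -> h chi \in dchars.
  by move=> /mem_dchars hc; apply/mem_dchars; exact: dchar_mul.
have hinj : {in dchars &, injective h}.
  move=> x y /mem_dchars hx /mem_dchars hy E; apply/funext => n.
  have [cn|cn] := boolP (coprime n k); last first.
    by rewrite (dchar_noncoprime hx) // (dchar_noncoprime hy).
  have pn : psi n != 0 by rewrite (dchar_neq0 hpsi).
  by apply: (mulfI pn); exact: (congr1 (fun f => f n) E).
have perm : perm_eq (map h dchars) dchars.
  have umap : uniq (map h dchars) by rewrite map_inj_in_uniq ?fset_uniq.
  apply: uniq_perm => //; first exact: fset_uniq.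
  have sub : {subset map h dchars <= dchars}.
    by move=> x /(@seq.mapP _ _ _ _ _)[y hy ->]; exact: hD.
  by have [//|] := uniq_min_size umap sub; rewrite size_map.
have E : psi a * \sum_(chi <- dchars) chi a = \sum_(chi <- dchars) chi a.
  by rewrite -[RHS](perm_big _ perm) big_map mulr_sumr.
have : (psi a - 1) * \sum_(chi <- dchars) chi a = 0 by rewrite mulrBl mul1r E subrr.
by move/eqP; rewrite mulf_eq0 subr_eq0 (negPf psia) => /eqP.
Qed.

Lemma sum_dchars n :
  \sum_(chi <- dchars) chi n = (#|` dchars| * (n == 1 %[mod k]))%N%:R.
Proof.
have [E|nE] := eqVneq (n %% k)%N (1 %% k)%N.
  rewrite muln1 (eq_big_seq (fun=> 1)); last first.
    by move=> chi /mem_dchars hc; rewrite (dchar_eqmod hc E) (dchar1 hc).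
  by rewrite big_const_seq count_predT iter_addr addr0.
rewrite muln0; have [cn|cn] := boolP (coprime n k); first by apply: sum_dchars_neq1 => //; apply/eqP.
by apply: big1_seq => chi /mem_dchars hc; rewrite (dchar_noncoprime hc).
Qed.

End characters.

(** * Prime powers in Lambda-sums *)

Section prime_powers.
Variable R : realType.

Lemma sum_geometric_le (x : R) a b : 0 <= x -> x <= 1 / 2 ->
  \sum_(a <= j < b) x ^+ j <= 2 * x ^+ a.
Proof.
move=> x0 x2; have [ba|/ltnW ab] := leqP b a.
  by rewrite big_geq // mulr_ge0 // exprn_ge0.
suff : \sum_(a <= j < b) x ^+ j <= 2 * x ^+ a - 2 * x ^+ b.
  by have := exprn_ge0 b x0; lra.
elim: b ab => [|b IH].
  by rewrite leqn0 => /eqP ->; rewrite big_geq // subrr.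
rewrite leq_eqVlt => /predU1P[<-|]; first by rewrite big_geq // subrr.
rewrite ltnS => ab; rewrite big_nat_recr //= exprS.
have := IH ab; have := ler_wpM2r (exprn_ge0 b x0) x2; lra.
Qed.

(** Only prime powers carry Lambda, so it is enough to list the primes and exponents that P admits:
    primes up to k for the n not coprime to k, exponents j >= 2 for the nonprimes. *)
Lemma sum_Lam_ppow_le (P : pred nat) (ps js : seq nat) N : all prime ps ->
  (forall j, j \in js -> (0 < j)%N) ->
  (forall p j, prime p -> (0 < j)%N -> (p ^ j <= N)%N -> P (p ^ j)%N -> p \in ps /\ j \in js) ->
  \sum_(1 <= n < N.+1 | P n) Lam R n / n%:R <=
  \sum_(p <- ps) ln p%:R * \sum_(j <- js) (p%:R^-1) ^+ j.
Proof.
move=> ap js0 H.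
have -> : \sum_(1 <= n < N.+1 | P n) Lam R n / n%:R =
   \sum_(n <- [seq n <- index_iota 1 N.+1 | P n && (Lam R n != 0)]) Lam R n / n%:R.
  rewrite big_filter big_mkcond [RHS]big_mkcond; apply: eq_bigr => n _.
  by case: (P n) => //=; case: eqP => //= ->; rewrite mul0r.
have -> : \sum_(p <- ps) ln p%:R * \sum_(j <- js) (p%:R^-1) ^+ j =
   \sum_(n <- [seq (p ^ j)%N | p <- ps, j <- js]) Lam R n / n%:R.
  rewrite big_allpairs_dep big_seq [RHS]big_seq; apply: eq_bigr => p hp.
  rewrite mulr_sumr big_seq [RHS]big_seq; apply: eq_bigr => j hj.
  by rewrite Lam_ppow ?js0 // ?(allP ap) // natrX exprVn.
apply: ler_sum_subset; first by rewrite filter_uniq // iota_uniq.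
  move=> n; rewrite mem_filter mem_index_iota ltnS => /andP[/andP[Pn Ln] /andP[_ nN]].
  have [p [j [pp j0 nE]]] := Lam_neq0 Ln.
  have [hp hj] : p \in ps /\ j \in js by apply: H; rewrite -?nE.
  by apply/allpairsP; exists (p, j).
by move=> n _; rewrite divr_ge0 ?Lam_ge0.
Qed.

Lemma prime_inv_le_half p : prime p -> p%:R^-1 <= 1 / 2 :> R.
Proof.
move=> pp; have p2 := prime_gt1 pp.
by rewrite mul1r lef_pV2 ?posrE ?ltr0n ?(ltnW p2) // ler_nat.
Qed.

Lemma exponent_le p j N : prime p -> (p ^ j <= N)%N -> (j <= N)%N.
Proof. by move=> pp; apply: leq_trans; rewrite ltnW // ltn_expl // prime_gt1. Qed.

Lemma sum_Lam_noncoprime k : (0 < k)%N -> exists C : R, forall N,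
  \sum_(1 <= n < N.+1 | ~~ coprime n k) Lam R n / n%:R <= C.
Proof.
move=> k0; exists (\sum_(p <- primes_upto k) ln p%:R) => N.
apply: (le_trans (@sum_Lam_ppow_le _ (primes_upto k) (index_iota 1 N.+1) N _ _ _)).
- exact: primes_upto_prime.
- by move=> j; rewrite mem_index_iota => /andP[].
- move=> p j pp j0 pN; rewrite coprime_pexpl // prime_coprime // negbK => pk.
  rewrite mem_primes_upto pp dvdn_leq //= mem_index_iota j0 ltnS.
  by rewrite (exponent_le pp pN).
- rewrite big_seq [X in _ <= X]big_seq; apply: ler_sum => p; rewrite mem_primes_upto => /andP[pp _].
  rewrite -[X in _ <= X]mulr1 ler_wpM2l ?ln_nat_ge0 //.
  have h := prime_inv_le_half pp.
  by apply: (le_trans (sum_geometric_le _ _ _ h)); rewrite ?invr_ge0 // expr1; lra.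
Qed.

(** Origin of (ln x + 2) / x: minus its derivative is (ln x + 1) / x^2, which dominates ln x / x^2
    and, unlike the latter, decreases on all of x >= 1. *)
Lemma ln_div_sqr_telescope n : (0 < n)%N ->
  ln n.+1%:R / n.+1%:R ^+ 2 <= (ln n%:R + 2) / n%:R - (ln n.+1%:R + 2) / n.+1%:R :> R.
Proof.
move=> n0; have x0 : (1 : R) <= n%:R by rewrite ler1n.
have := @lnS_le R n n0; have := ln_nat_ge0 R n.+1.
move: (ln n.+1%:R) (ln n%:R) => l l'; rewrite -[n.+1%:R]natr1.
move: (n%:R : R) x0 => x x1 l0 h; have x0 : 0 < x by lra.
have y0 : 0 < x + 1 by lra.
have xV : x * x^-1 = 1 by rewrite divff // gt_eqF.
rewrite ler_pdivrMr ?exprn_gt0 // -(ler_pM2l x0).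
have -> : x * (((l' + 2) / x - (l + 2) / (x + 1)) * (x + 1) ^+ 2) =
   (l' + 2) * (x + 1) ^+ 2 - (l + 2) * x * (x + 1).
  by field; rewrite !gt_eqF.
have h2 : x * l - x * l' <= 1.
  by have := ler_wpM2l (ltW x0) h; rewrite xV mulrBr.
have h3 : (l - l') * (x + 1) ^+ 2 * x <= (x + 1) ^+ 2.
  rewrite mulrAC -[X in _ <= X]mul1r ler_wpM2r ?exprn_ge0 ?(ltW y0) //.
  by rewrite mulrBl ![_ * x]mulrC.
have h4 : (x + 1) ^+ 2 <= x * (2 * (x + 1)) by nra.
rewrite -(ler_pM2l x0); nra.
Qed.

Lemma sum_Lam_nonprime N : \sum_(1 <= n < N.+1 | ~~ prime n) Lam R n / n%:R <= 4.
Proof.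
apply: (le_trans (@sum_Lam_ppow_le _ (primes_upto N) (index_iota 2 N.+1) N _ _ _)).
- exact: primes_upto_prime.
- by move=> j; rewrite mem_index_iota => /andP[/ltnW].
- move=> p j pp j0 pN npp; rewrite mem_primes_upto pp mem_index_iota ltnS (exponent_le pp pN).
  have -> : (p <= N)%N.
    by apply: leq_trans pN; rewrite -{1}(expn1 p); apply: leq_pexp2l => //; exact: prime_gt0.
  by split=> //; case: j j0 {pN} npp => [|[|]] //; rewrite expn1 pp.
- apply: (@le_trans _ _ (\sum_(1 <= n < N.+1) 2 * (ln n%:R / n%:R ^+ 2))).
    rewrite /primes_upto big_filter big_mkcond; apply: ler_sum_nat => p /andP[p0 _].
    case: ifP => [pp|_]; last by rewrite mulr_ge0 // divr_ge0 ?ln_nat_ge0 // exprn_ge0.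
    rewrite mulrCA ler_wpM2l ?ln_nat_ge0 // -exprVn.
    by apply: sum_geometric_le; rewrite ?invr_ge0 // prime_inv_le_half.
  rewrite -mulr_sumr; have [->|N0] := posnP N; first by rewrite big_geq // mulr0.
  rewrite big_ltn ?ltnS // ln1 mul0r add0r big_add1 /=.
  have : \sum_(1 <= n < N) ln n.+1%:R / n.+1%:R ^+ 2 <=
     \sum_(1 <= n < N) ((ln n%:R + 2) / n%:R - (ln n.+1%:R + 2) / n.+1%:R) :> R.
    by apply: ler_sum_nat => n /andP[n0 _]; exact: ln_div_sqr_telescope.
  under [X in _ <= X -> _]eq_bigr do rewrite -opprB.
  rewrite sumrN (telescope_sumr (fun n => (ln n%:R + 2) / n%:R)) // opprB ln1 add0r divr1.
  have : 0 <= (ln N%:R + 2) / N%:R :> R by rewrite divr_ge0 // addr_ge0 ?ln_nat_ge0.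
  lra.
Qed.

End prime_powers.

(** * Nonvanishing for complex characters and the count of primes congruent to 1 *)

Section primes_one_mod.
Variables (R : realType) (k : nat).
Hypothesis k1 : (1 < k)%N.

Definition sum_Lam_one_mod N : R := \sum_(1 <= n < N.+1 | n == 1 %[mod k]) Lam R n / n%:R.

Lemma sum_Lamsum N :
  \sum_(chi <- dchars R k) Lamsum chi N = (#|` dchars R k|%:R * sum_Lam_one_mod N)%:C.
Proof.
rewrite /Lamsum exchange_big /= /sum_Lam_one_mod mulr_sumr [in RHS]big_mkcond rmorph_sum.
apply: eq_bigr => n _; rewrite -mulr_sumr (sum_dchars R k1) natrM.
case: (n == 1 %[mod k])%N; last by rewrite !mulr0.
by rewrite mulr1 -(rmorph_nat (real_complex R)) -rmorphM mulrC.
Qed.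

Lemma Lamsum_principal_Re N : complex.Re (Lamsum (principal_character R k) N) =
  mert R N - \sum_(1 <= n < N.+1 | ~~ coprime n k) Lam R n / n%:R.
Proof.
rewrite /Lamsum Re_sum /mert [X in _ = _ - X]big_mkcond -sumrB.
apply: eq_bigr => n _; rewrite ReM_real /principal_character.
by case: (coprime n k); rewrite /= ?mulr1 ?subr0 // mulr0 subrr.
Qed.

Lemma Lamsum_principal_bound : exists C, forall N, (0 < N)%N ->
  `|complex.Re (Lamsum (principal_character R k) N) - ln N%:R| <= C.
Proof.
have [C hC] := sum_Lam_noncoprime R (ltnW k1); exists (4 + C) => N N0.
rewrite Lamsum_principal_Re; have := hC N; have := mertens_ge R N0; have := mertens_le R N0.
have : 0 <= \sum_(1 <= n < N.+1 | ~~ coprime n k) Lam R n / n%:R :> R.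
  by apply: sumr_ge0 => n _; rewrite divr_ge0 ?Lam_ge0.
by rewrite ler_norml => *; apply/andP; split; lra.
Qed.

Lemma exists_sum_bound (I : eqType) (s : seq I) (F : I -> nat -> R) :
  (forall i, i \in s -> exists C, forall N, (0 < N)%N -> F i N <= C) ->
  exists C, forall N, (0 < N)%N -> \sum_(i <- s) F i N <= C.
Proof.
elim: s => [|i s IH] h; first by exists 0 => N _; rewrite big_nil.
have [|C hC] := IH; first by move=> j js; apply: h; rewrite inE js orbT.
have [D hD] := h i (mem_head _ _); exists (D + C) => N N0.
by rewrite big_cons lerD ?hD ?hC.
Qed.

Lemma sum_indicator (chi : nat -> R[i]) (r : R) : dirichlet_character k chi ->
  \sum_(psi <- dchars R k) (if psi == chi then r else 0) = r.
Proof.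
move=> /(mem_dchars k1) hc; rewrite (bigD1_seq chi) ?fset_uniq //= eqxx.
by rewrite big1 ?addr0 // => psi /negPf ->.
Qed.

(** One-sided so that it holds whether or not L(1, chi) vanishes: if it does, the sum is -ln N +
    O(1), still bounded above. *)
Lemma Lamsum_upper (chi : nat -> R[i]) : dirichlet_character k chi ->
  chi <> principal_character R k ->
  exists C, forall N, (0 < N)%N -> complex.Re (Lamsum chi N) <= C.
Proof.
move=> hc hn; have np := dchar_nonprincipal hc hn.
have [L hL] := Lpartial_limit hc np.
have [L0|L0] := eqVneq L 0.
  exists (2 * k%:R) => N N0; have := Lamsum_zero hc hL L0 N0.
  move=> /(le_trans (Re_le_cabs _)) /(le_trans (ler_norm _)).
  rewrite complexRe_is_additive /=; have := ln_nat_ge0 R N; lra.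
have [C hC] := Lamsum_bound hc np hL L0; exists C => N N0.
by have := le_trans (Re_le_cabs _) (hC N N0); move=> /(le_trans (ler_norm _)).
Qed.

Lemma Lamsum_conj (chi : nat -> R[i]) N :
  Lamsum (fun n => (chi n)^*%C) N = (Lamsum chi N)^*%C.
Proof.
rewrite /Lamsum rmorph_sum; apply: eq_bigr => n _.
by rewrite [RHS]rmorphM; congr (_ * _); exact/esym/conjc_real.
Qed.

Lemma Re_conj (z : R[i]) : complex.Re z^*%C = complex.Re z.
Proof. by case: z. Qed.

Lemma dchars_card_gt0 : (0 < #|` dchars R k|)%N.
Proof.
rewrite cardfs_gt0; apply/fset0Pn; exists (principal_character R k).
exact/(mem_dchars k1)/dchar_principal.
Qed.

Lemma sum_Lam_one_mod_ge0 N : 0 <= sum_Lam_one_mod N.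
Proof. by apply: sumr_ge0 => n _; rewrite divr_ge0 ?Lam_ge0. Qed.

(* If L(1, chi) = 0 for a complex chi, then the conjugate vanishes too, and the
   sum over all characters of their Lambda-sums, which is nonnegative, would be
   at most log N - 2 log N + O(1). *)
Lemma L1_neq0 (chi : nat -> R[i]) L : dirichlet_character k chi ->
  chi <> principal_character R k ->
  (forall N, cabs (Lpartial chi N - L) <= 2 * k%:R / N.+1%:R) -> L != 0.
Proof.
move=> hc hn hL; have np := dchar_nonprincipal hc hn.
apply/eqP => L0.
have [chi_real|] := pselect (forall n, complex.Im (chi n) = 0).
  apply: (real_nonprincipal_contra hc np chi_real) => N.
  by have := hL N; rewrite L0 subr0.
move=> /existsNP[n0 hn0]; pose psi n := (chi n)^*%C.
have hp : dirichlet_character k psi := dchar_conj hc.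
have pc : psi <> chi.
  move=> E; apply: hn0; have := congr1 (fun f => complex.Im (f n0)) E.
  by rewrite /psi; case: (chi n0) => a b /=; lra.
have pn : psi <> principal_character R k.
  move=> E; apply: hn; apply/funext => n; have := congr1 (fun f => (f n)^*%C) E.
  by rewrite /psi conjcK => ->; rewrite /principal_character conjc_nat.
(* G removes the growth ln N of the principal character and compensates the -ln N of [chi] and of
   its conjugate, so each G is bounded above; over all characters these corrections leave one + ln
   N. *)
pose G (phi : nat -> R[i]) N := complex.Re (Lamsum phi N)
  - (if phi == principal_character R k then ln N%:R else 0)
  + (if phi == chi then ln N%:R else 0) + (if phi == psi then ln N%:R else 0).
have [|C hC] := @exists_sum_bound _ (dchars R k) G.
  have zero N : (0 < N)%N -> complex.Re (Lamsum chi N) + ln N%:R <= 2 * k%:R.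
    move=> N0; have := Lamsum_zero hc hL L0 N0.
    move=> /(le_trans (Re_le_cabs _)) /(le_trans (ler_norm _)).
    by rewrite complexRe_is_additive.
  move=> phi /(mem_dchars k1) hphi; rewrite /G.
  have [->|/eqP phi_n] := eqVneq phi (principal_character R k).
    have [C hC] := Lamsum_principal_bound; exists C => N N0.
    rewrite (introF eqP (nesym hn)) (introF eqP (nesym pn)) !addr0.
    exact: le_trans (ler_norm _) (hC N N0).
  have [->|phi_c] := eqVneq phi chi.
    exists (2 * k%:R) => N N0; rewrite (introF eqP (nesym pc)) subr0 addr0.
    exact: zero.
  have [->|phi_p] := eqVneq phi psi.
    exists (2 * k%:R) => N N0; rewrite subr0 addr0 /psi Lamsum_conj Re_conj.
    exact: zero.
  have [C hC] := Lamsum_upper hphi phi_n; exists C => N N0.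
  by rewrite subr0 !addr0 hC.
have bound N : (0 < N)%N -> ln N%:R <= C.
  move=> N0; have := hC N N0; rewrite /G !big_split /= sumrN.
  rewrite !sum_indicator //; last exact: dchar_principal.
  rewrite -Re_sum sum_Lamsum /= addrNK => h.
  by apply: le_trans h; rewrite lerDr mulr_ge0 // sum_Lam_one_mod_ge0.
have [N [N0 hN]] := @exists_npow_le R 1 (expR (- (C + 1))) 1 ltr01 (expR_gt0 _).
have := bound N N0; move: hN; rewrite /npow ler_expR mul1r; lra.
Qed.

Lemma sum_Lam_one_mod_bound : exists C, forall N, (0 < N)%N ->
  `|#|` dchars R k|%:R * sum_Lam_one_mod N - ln N%:R| <= C.
Proof.
pose H (phi : nat -> R[i]) N := `|complex.Re (Lamsum phi N)
  - (if phi == principal_character R k then ln N%:R else 0)|.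
have [|C hC] := @exists_sum_bound _ (dchars R k) H.
  move=> phi /(mem_dchars k1) hphi; rewrite /H.
  have [->|/eqP phi_n] := eqVneq phi (principal_character R k).
    exact: Lamsum_principal_bound.
  have np := dchar_nonprincipal hphi phi_n.
  have [L hL] := Lpartial_limit hphi np.
  have [C hC] := Lamsum_bound hphi np hL (L1_neq0 hphi phi_n hL); exists C => N N0.
  by rewrite subr0; exact: le_trans (Re_le_cabs _) (hC N N0).
exists C => N N0; apply: le_trans (hC N N0); rewrite /H.
have -> : #|` dchars R k|%:R * sum_Lam_one_mod N - ln N%:R =
   \sum_(phi <- dchars R k) (complex.Re (Lamsum phi N)
     - (if phi == principal_character R k then ln N%:R else 0)).
  rewrite big_split /= sumrN sum_indicator; last exact: dchar_principal.
  by rewrite -Re_sum sum_Lamsum.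
exact: ler_norm_sum.
Qed.

Definition primes_one_mod N := [seq p <- index_iota 1 N.+1 | prime p && (p == 1 %[mod k])%N].

(** For T = N / A with ln A >= 2C + 5h, the Lambda-sum over T < n <= N in the class of 1 is at least
    5, of which higher prime powers take at most 4. Each prime there contributes at most A ln N /
    N. *)
Lemma primes_one_mod_ge : exists A : nat, (0 < A)%N /\ forall N, (A <= N)%N ->
  N%:R <= A%:R * ln (N%:R : R) * (size (primes_one_mod N))%:R.
Proof.
have [C hC] := sum_Lam_one_mod_bound.
set h : R := #|` dchars R k|%:R in hC.
have h0 : 0 < h by rewrite ltr0n dchars_card_gt0.
(* For exponent 1 the condition A^(-1) <= exp(-x) reads ln A >= x, so [exists_npow_le] supplies an
   integer with large logarithm. *)
have [A [A0 hA]] := @exists_npow_le R 1 (expR (- (2 * C + 5 * h))) 1 ltr01 (expR_gt0 _).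
have {}hA : 2 * C + 5 * h <= ln A%:R.
  by move: hA; rewrite /npow ler_expR mul1r; lra.
exists A; split => // N AN; pose T := (N %/ A)%N.
have N0 : (0 < N)%N by apply: leq_trans AN.
have T0 : (0 < T)%N by rewrite divn_gt0.
have TN : (T <= N)%N by rewrite leq_div.
have N0R : (0 : R) < N%:R by rewrite ltr0n.
have lnT : ln T%:R + ln A%:R <= ln N%:R :> R.
  rewrite -lnM ?posrE ?ltr0n // -natrM; apply: ler_ln_nat; rewrite ?muln_gt0 ?T0 //.
  exact: leq_divM.
have S5 : 5 <= sum_Lam_one_mod N - sum_Lam_one_mod T.
  rewrite -(ler_pM2l h0) mulrBr; have := hC N N0; have := hC T T0.
  by rewrite !ler_norml => /andP[_ h1] /andP[h2 _]; lra.
have E : sum_Lam_one_mod N - sum_Lam_one_mod T =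
    \sum_(T.+1 <= n < N.+1 | n == 1 %[mod k]) Lam R n / n%:R.
  by rewrite /sum_Lam_one_mod (@big_cat_nat _ _ _ T.+1 1 N.+1) //= addrAC subrr add0r.
have nonprime : \sum_(T.+1 <= n < N.+1 | (n == 1 %[mod k])%N && ~~ prime n) Lam R n / n%:R <= 4.
  apply: le_trans (sum_Lam_nonprime R N).
  rewrite [X in _ <= X](@big_cat_nat _ _ _ T.+1 1 N.+1) //=.
  rewrite -[X in X <= _]add0r lerD //; first by apply: sumr_ge0 => n _; rewrite divr_ge0 ?Lam_ge0.
  rewrite big_mkcond [X in _ <= X]big_mkcond; apply: ler_sum => n _.
  case: (n == 1 %[mod k])%N => //=; case: ifP => _ //.
  by rewrite divr_ge0 ?Lam_ge0.
have : \sum_(T.+1 <= n < N.+1 | (n == 1 %[mod k])%N && prime n) Lam R n / n%:R <=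
    \sum_(p <- primes_one_mod N) (A%:R * ln (N%:R : R) / N%:R).
  rewrite /primes_one_mod big_filter [X in _ <= X](@big_cat_nat _ _ _ T.+1 1 N.+1) //=.
  have l0 : 0 <= A%:R * ln (N%:R : R) / N%:R by rewrite divr_ge0 // mulr_ge0 ?ln_nat_ge0.
  rewrite -[X in X <= _]add0r lerD ?sumr_ge0 //.
  rewrite big_mkcond [X in _ <= X]big_mkcond; apply: ler_sum_nat => n /andP[Tn nN].
  rewrite andbC; case: ifP => // /andP[pn _].
  have n0R : (0 : R) < n%:R by rewrite ltr0n prime_gt0.
  rewrite Lam_prime // mulrAC mulrC ler_pM ?ln_nat_ge0 ?invr_ge0 //.
    rewrite ler_pdivlMr // ler_pdivrMl // -natrM ler_nat ltnW // -ltn_divLR //.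
  by apply: ler_ln_nat; rewrite ?prime_gt0.
move: S5; rewrite E (bigID (fun n => prime n)) /= => S5 h1.
have : 1 <= \sum_(p <- primes_one_mod N) (A%:R * ln (N%:R : R) / N%:R) by lra.
by rewrite big_const_seq count_predT iter_addr addr0 -[X in _ <= X]mulr_natr mulrAC ler_pdivlMr // mul1r.
Qed.

End primes_one_mod.

(** * Characters of order k *)

Section kth_order.
Variables (R : realType) (k : nat).
Hypothesis k2 : (2 <= k)%N.

(* For a character of prime modulus this says that its order is k. *)
Definition has_order (q : nat) (chi : nat -> R[i]) : Prop :=
  [/\ dirichlet_character q chi, forall n, coprime n q -> chi n ^+ k = 1 &
      exists2 g, coprime g q & forall j, (0 < j < k)%N -> chi g ^+ j != 1].

(** The character sends z^j to w^j for a generator z of the units mod q and a primitive k-th root of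
    unity w. This is well defined because k divides q - 1, and its value w at z has order exactly
    k. *)
Lemma exists_has_order q : prime q -> q = 1 %[mod k] -> exists chi, has_order q chi.
Proof.
move=> pq qk; have q1 := prime_gt1 pq; have k0 : (0 < k)%N by apply: ltnW.
have kq : (k %| q.-1)%N by rewrite -subn1 -eqn_mod_dvd ?(ltnW q1) //; apply/eqP.
have qm0 : (0 < q.-1)%N by rewrite -ltnS prednK // ltnW.
have [z hz] : exists z : 'F_q, (q.-1).-primitive_root z.
  pose rs := [seq x <- enum 'F_q | x != 0].
  have h1 : all (q.-1).-unity_root rs.
    apply/allP => x; rewrite mem_filter => /andP[x0 _]; rewrite unity_rootE.
    apply/eqP/(mulfI x0); rewrite -exprS prednK ?(ltnW q1) // mulr1.
    by rewrite -[X in _ ^+ X](card_Fp pq) expf_card.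
  have h2 : uniq rs by rewrite filter_uniq // enum_uniq.
  have h3 : (q.-1 <= size rs)%N.
    apply: (@leq_trans #|predC1 (0 : 'F_q)|); first by rewrite cardC1 card_Fp.
    rewrite cardE; apply: uniq_leq_size; first exact: enum_uniq.
    by move=> x; rewrite mem_enum mem_filter mem_enum inE andbT.
  by have /hasP[z _ hz] := has_prim_root qm0 h1 h2 h3; exists z.
have [w hw] := exists_prim_root (R[i] : numClosedFieldType) k0.
pose e (n : nat) : nat := if [pick j : 'I_(q.-1) | n%:R == z ^+ j] is Some j then j else 0%N.
have nz n : coprime n q -> (n%:R : 'F_q) != 0.
  move=> cn; rewrite -(dvdn_pcharf (pchar_Fp pq)) -prime_coprime // coprime_sym //.
have eE n : coprime n q -> z ^+ e n = n%:R.
  move=> cn; have h : (n%:R : 'F_q) ^+ q.-1 = 1.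
    apply/(mulfI (nz _ cn)); rewrite -exprS prednK ?(ltnW q1) // mulr1.
    by rewrite -[X in _ ^+ X](card_Fp pq) expf_card.
  have [j nj] := prim_rootP hz h; rewrite /e.
  by case: pickP => [l /eqP ->//|/(_ j)]; rewrite nj eqxx.
have wz i j : z ^+ i = z ^+ j -> w ^+ i = w ^+ j.
  move/eqP; rewrite (eq_prim_root_expr hz) => /eqP h.
  by apply/eqP; rewrite (eq_prim_root_expr hw) -(modn_dvdm i kq) h modn_dvdm.
pose chi n : R[i] := if coprime n q then w ^+ e n else 0.
exists chi; split.
- split => [|m n|n|n].
  + exact: ltnW.
  + rewrite /chi coprimeMl; case cm : (coprime m q); last by rewrite mul0r.
    case cn : (coprime n q); last by rewrite mulr0.
    by rewrite -exprD; apply: wz; rewrite exprD !eE // ?natrM // coprimeMl cm.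
  + rewrite /chi -[coprime (n + q) q]coprime_modl modnDr coprime_modl.
    by rewrite /e natrD pchar_Fp_0 // addr0.
  + by rewrite /chi; case: ifP => _; rewrite ?eqxx // expf_neq0 // (prim_root_neq0 hw).
- by move=> n cn; rewrite /chi cn -exprM mulnC exprM (prim_expr_order hw) expr1n.
- have zz : ((z : nat)%:R : 'F_q) = z by rewrite natr_Zp.
  have cz : coprime z q.
    rewrite coprime_sym prime_coprime // (dvdn_pcharf (pchar_Fp pq)) zz.
    exact: prim_root_neq0 hz.
  exists z => // j /andP[j0 jk]; rewrite /chi cz.
  have -> : w ^+ e z = w ^+ 1 by apply: wz; rewrite eE.
  rewrite expr1 -[X in _ != X](expr0 w) (eq_prim_root_expr hw) mod0n modn_small //.
  by rewrite -lt0n.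
Qed.

Lemma has_order_conj q chi : has_order q chi -> has_order q (fun n => (chi n)^*%C).
Proof.
move=> [hc h1 [g cg hg]]; split; first exact: dchar_conj.
  by move=> n cn; rewrite -rmorphXn h1 // rmorph1.
exists g => // j jk; rewrite -rmorphXn; apply: contra (hg j jk) => /eqP E.
by rewrite -[chi g ^+ j]conjcK E conjc1.
Qed.

Section product.
Variables (q1 q2 : nat) (chi1 chi2 : nat -> R[i]).
Hypotheses (pq1 : prime q1) (pq2 : prime q2) (q12 : q1 != q2).
Hypotheses (h1 : has_order q1 chi1) (h2 : has_order q2 chi2).

Let chi n := chi1 n * chi2 n.

Let cop12 : coprime q1 q2.
Proof. by rewrite prime_coprime // dvdn_prime2. Qed.

Lemma dchar_product : dirichlet_character (q1 * q2) chi.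
Proof.
have [hc1 _ _] := h1; have [hc2 _ _] := h2; split.
- by rewrite muln_gt0 !prime_gt0.
- by move=> m n; rewrite /chi (dcharM hc1) (dcharM hc2) mulrACA.
- move=> n; rewrite /chi; congr (_ * _).
    by apply: (dchar_eqmod hc1); rewrite -modnDmr modnMr addn0.
  by apply: (dchar_eqmod hc2); rewrite -modnDmr modnMl addn0.
- by move=> n; rewrite mulf_eq0 negb_or (dchar_neq0 hc1) (dchar_neq0 hc2) coprimeMr.
Qed.

(** Isolates the first factor: the second character is 1 at n. The order, the conductor and the
    nonprincipality of the product are read off from such n. *)
Lemma product_crt g : coprime g q1 -> exists n,
  [/\ coprime n (q1 * q2), n = 1 %[mod q2] & chi n = chi1 g].
Proof.
move=> cg; have [hc1 _ _] := h1; have [hc2 _ _] := h2.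
pose n := chinese q1 q2 g 1; exists n.
have n1 : n = g %[mod q1] by apply: chinese_modl.
have n2 : n = 1 %[mod q2] by apply: chinese_modr.
split => //; last by rewrite /chi (dchar_eqmod hc1 n1) (dchar_eqmod hc2 n2) (dchar1 hc2) mulr1.
by rewrite coprimeMr -coprime_modl n1 coprime_modl cg -coprime_modl n2 coprime_modl coprime1n.
Qed.

Lemma is_order_product : is_order (q1 * q2) chi k.
Proof.
have [hc1 r1 [g cg hg]] := h1; have [hc2 r2 _] := h2; split.
- exact: ltnW.
- apply/funext => n; rewrite /principal_character coprimeMr /chi exprMn.
  case c1 : (coprime n q1); last first.
    by rewrite (dchar_noncoprime hc1) ?c1 // expr0n gtn_eqF ?mul0r // ltnW.
  case c2 : (coprime n q2); last first.
    by rewrite (dchar_noncoprime hc2) ?c2 // expr0n gtn_eqF ?mulr0 // ltnW.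
  by rewrite r1 // r2 // mulr1.
- move=> j jk E; have [n [cn _ hn]] := product_crt cg.
  have := hg j jk; rewrite -hn; have := congr1 (fun f => f n) E => /= ->.
  by rewrite /principal_character cn eqxx.
Qed.

(** If q1 did not divide e, then e would divide q2, and an n congruent to 1 mod q2 with chi n = chi1
    g different from 1 would contradict periodicity mod e. *)
Lemma induced_dvdl e : induced_from e (q1 * q2) chi -> (q1 %| e)%N.
Proof.
move=> [eq [psi [hpsi E]]]; have [hc1 r1 [g cg hg]] := h1.
apply/negPn/negP => q1e.
have {}eq : (e %| q2)%N.
  by move: eq; rewrite Gauss_dvdr // coprime_sym prime_coprime.
have [n [cn n1 hn]] := product_crt cg.
have := hg 1%N k2; rewrite expr1 -hn E // (dchar_eqmod hpsi (_ : n = 1 %[mod e])).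
  by rewrite (dchar1 hpsi) eqxx.
by rewrite -(modn_dvdm n eq) n1 modn_dvdm.
Qed.

End product.

Lemma primitive_product q1 q2 chi1 chi2 : prime q1 -> prime q2 -> q1 != q2 ->
  has_order q1 chi1 -> has_order q2 chi2 ->
  primitive_character (q1 * q2) (fun n => chi1 n * chi2 n).
Proof.
move=> pq1 pq2 q12 h1 h2; have hc := dchar_product pq1 pq2 h1 h2; split => //; split.
  by split; [exact: dvdnn|exists (fun n => chi1 n * chi2 n)].
move=> e ie; have d1 := induced_dvdl pq1 pq2 q12 h1 h2 ie.
have d2 : (q2 %| e)%N.
  apply: (induced_dvdl pq2 pq1 _ h2 h1); first by rewrite eq_sym.
  by move: ie; rewrite mulnC (_ : (fun n => _) = fun n => chi2 n * chi1 n) //; apply/funext => n; rewrite mulrC.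
have [eq _] := ie; have e0 : (0 < e)%N by apply: dvdn_gt0 eq; rewrite muln_gt0 !prime_gt0.
apply: dvdn_leq => //; rewrite Gauss_dvd ?d1 // prime_coprime // dvdn_prime2 //.
Qed.

End kth_order.

Section Lvalue.
Variables (R : realType) (q : nat) (chi : nat -> R[i]).
Variable L : R[i].
Hypothesis hL : forall N, cabs (Lpartial chi N - L) <= 2 * q%:R / N.+1%:R.

Lemma dirichlet_term1 n : (0 < n)%N -> dirichlet_term n 1 = (n%:R^-1)%:C :> R[i].
Proof.
move=> n0; rewrite /dirichlet_term /cexp mulN1r /= oppr0 cos0 sin0.
by rewrite expRN lnK ?posrE ?ltr0n // mulr1.
Qed.

Lemma dirichlet_L1 : dirichlet_L chi 1 = L.
Proof.
rewrite /dirichlet_L.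
apply: (@cvg_lim (R[i])^o (@norm_hausdorff _ (R[i])^o) nat _ _ _ (L : (R[i])^o)).
apply/cvgrPdist_le => /= e e0.
have [Ne Ne0] : exists Ne : nat, forall N, (Ne <= N)%N -> ((2 * q%:R / N.+1%:R : R))%:C <= e.
  (* A positive element in the order of R[i] is real. *)
  have re : e = (complex.Re e)%:C by rewrite RRe_real // ger0_real // ltW.
  have e0' : 0 < complex.Re e by move: e0; rewrite re ltcR.
  exists (Num.truncn (2 * q%:R / complex.Re e)) => N hN.
  rewrite re lecR ler_pdivrMr ?ltr0n // [X in _ <= X]mulrC -ler_pdivrMr //.
  have h0 : 0 <= 2 * q%:R / complex.Re e by rewrite divr_ge0 ?mulr_ge0 ?(ltW e0').
  have /andP[_ /ltW h] := truncn_itv h0.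
  by apply: (le_trans h); rewrite ler_nat.
exists Ne => // N /= hN; apply: le_trans (Ne0 N hN).
have -> : \sum_(1 <= n < N.+1) chi n * dirichlet_term n 1 = Lpartial chi N.
  by apply: eq_big_nat => n /andP[n0 _]; rewrite dirichlet_term1 // mulrC.
by rewrite distrC; have := hL N; rewrite -lecR.
Qed.

End Lvalue.

(** * Large values at products of two primes *)

Lemma smooth_eq_mult (K : pzRingType) (f g : nat -> K) E ps m : all prime ps ->
  f 1%N = g 1%N -> (forall a b, f (a * b)%N = f a * f b) ->
  (forall a b, g (a * b)%N = g a * g b) -> {in ps, f =1 g} ->
  m \in smooth E ps -> f m = g m.
Proof.
move=> ap fg1 fM gM; elim: ps m ap => [|p ps IH] m; first by rewrite inE => _ _ /eqP ->.
move=> /andP[pp ap] fg /smooth_consP[j [e [_ es ->]]].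
rewrite fM gM (IH e) //; last by move=> r rs; apply: fg; rewrite inE rs orbT.
congr (_ * _); elim: j => [|j IHj]; first by [].
by rewrite expnS fM gM IHj fg // inE eqxx.
Qed.

Section pairs.
Variables (R : realType) (k : nat).
Hypothesis k2 : (2 <= k)%N.
Variables (y E H X : nat) (c : seq nat) (chi : nat -> nat -> R[i]).
Hypothesis uc : uniq c.
Hypothesis c_prime : forall q, q \in c -> prime q.
Hypothesis c_gt : forall q, q \in c -> (y < q)%N.
Hypothesis c_le : forall q, q \in c -> (q <= X)%N.
Hypothesis chi_order : forall q, q \in c -> has_order k q (chi q).
Hypothesis chi_same : forall q q' p, q \in c -> q' \in c -> prime p -> (p <= y)%N ->
  chi q p = chi q' p.

Definition pair_char q1 q2 : nat -> R[i] := fun n => chi q1 n * (chi q2 n)^*%C.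

Let ps := primes_upto y.

Lemma chi_smooth q q' m : q \in c -> q' \in c -> m \in smooth E ps -> chi q m = chi q' m.
Proof.
move=> hq hq'; have [hc _ _] := chi_order hq; have [hc' _ _] := chi_order hq'.
apply: smooth_eq_mult; first exact: primes_upto_prime.
- by rewrite (dchar1 hc) (dchar1 hc').
- exact: dcharM hc.
- exact: dcharM hc'.
- by move=> p; rewrite mem_primes_upto => /andP[pp py]; exact: chi_same.
Qed.

Lemma cabs_chi_smooth q m : q \in c -> m \in smooth E ps -> cabs (chi q m) = 1.
Proof.
move=> hq ms; have [hc _ _] := chi_order hq; apply: (cabs_dchar hc).
rewrite coprime_sym prime_coprime ?c_prime //; apply/negP => qm.
have := smooth_prime_dvd (primes_upto_prime y) ms (c_prime hq) qm.
by rewrite mem_primes_upto leqNgt c_gt // andbF.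
Qed.

Lemma sum_pairs_Re (z : nat -> R[i]) :
  \sum_(q1 <- c) \sum_(q2 <- c) complex.Re (z q1 * (z q2)^*%C) = cabs (\sum_(q <- c) z q) ^+ 2.
Proof.
set S := \sum_(q <- c) z q.
transitivity (complex.Re (S * S^*%C)); last by rewrite -sqr_normc cabs_normE -rmorphXn.
rewrite /S rmorph_sum mulr_suml Re_sum.
by apply: eq_bigr => q1 _; rewrite mulr_sumr Re_sum.
Qed.

(* For every m the sum over pairs is a square of an absolute value, and for
   y-smooth m all the terms of the inner sum coincide. *)
Lemma sum_pairs_ge : (\prod_(p <- ps) p ^ E <= H)%N ->
  (size c)%:R ^+ 2 * (\sum_(m <- smooth E ps) m%:R^-1) <=
  \sum_(q1 <- c) \sum_(q2 <- c) complex.Re (Lpartial (pair_char q1 q2) H).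
Proof.
move=> hH.
have -> : \sum_(q1 <- c) \sum_(q2 <- c) complex.Re (Lpartial (pair_char q1 q2) H) =
    \sum_(1 <= m < H.+1) m%:R^-1 * cabs (\sum_(q <- c) chi q m) ^+ 2.
  under eq_bigr => q1 _.
    under eq_bigr => q2 _ do rewrite /Lpartial Re_sum.
    rewrite exchange_big /=.
    over.
  rewrite exchange_big /=; apply: eq_bigr => m _; rewrite -sum_pairs_Re mulr_sumr.
  apply: eq_bigr => q1 _; rewrite mulr_sumr; apply: eq_bigr => q2 _.
  by rewrite ReM_real.
apply: (@le_trans _ _ (\sum_(m <- smooth E ps) m%:R^-1 * cabs (\sum_(q <- c) chi q m) ^+ 2)).
  rewrite mulr_sumr big_seq [X in _ <= X]big_seq; apply: ler_sum => m ms.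
  rewrite mulrC ler_wpM2l ?invr_ge0 //.
  case E0 : c => [|q0 c0]; first by rewrite expr0n /= exprn_ge0 // cabs_ge0.
  have hq0 : q0 \in c by rewrite E0 mem_head.
  have -> : \sum_(q <- q0 :: c0) chi q m = (size c)%:R * chi q0 m.
    rewrite -E0 (eq_big_seq (fun=> chi q0 m)) => [|q hq]; last exact: chi_smooth.
    by rewrite big_const_seq count_predT iter_addr addr0 mulr_natl.
  have -> : (size c)%:R = ((size c)%:R)%:C :> R[i] by rewrite rmorph_nat.
  by rewrite Normc.normcM cabs_real cabs_chi_smooth // mulr1 normr_nat E0.
apply: ler_sum_subset.
- by apply: smooth_uniq; [exact: primes_upto_prime|exact: primes_upto_uniq].
- move=> m ms; rewrite mem_index_iota ltnS (smooth_gt0 (primes_upto_prime y) ms) /=.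
  exact: leq_trans (smooth_le (primes_upto_prime y) ms) hH.
- by move=> m _; rewrite mulr_ge0 ?invr_ge0 // exprn_ge0 // cabs_ge0.
Qed.

Section pair.
Variables q1 q2 : nat.
Hypotheses (hq1 : q1 \in c) (hq2 : q2 \in c) (q12 : q1 != q2).

Let h1 := chi_order hq1.
Let h2 := has_order_conj (chi_order hq2).

Lemma pair_char_L : forall N,
  cabs (Lpartial (pair_char q1 q2) N - dirichlet_L (pair_char q1 q2) 1) <=
  2 * (q1 * q2)%:R / N.+1%:R.
Proof.
have hc := dchar_product (c_prime hq1) (c_prime hq2) h1 h2.
have np : exists2 a, coprime a (q1 * q2) & pair_char q1 q2 a != 1.
  have [_ _ [g cg hg]] := h1.
  have [n [cn _ hn]] := product_crt (c_prime hq1) (c_prime hq2) q12 h1 h2 cg.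
  by exists n => //; rewrite /pair_char hn; have := hg 1%N; rewrite expr1; apply.
have [L hL] := Lpartial_limit hc np.
by rewrite (dirichlet_L1 hL).
Qed.

Lemma pair_mul_le : (q1 * q2 <= X ^ 2)%N.
Proof. by rewrite -mulnn leq_mul // c_le. Qed.

Lemma cabs_Lpartial_le (psi : nat -> R[i]) N : (forall n, cabs (psi n) <= 1) -> (0 < N)%N ->
  cabs (Lpartial psi N) <= 1 + ln N%:R.
Proof.
move=> hpsi N0; apply: le_trans (harmonic_sum_le R N0).
apply: (le_trans (cabs_sum _ _ _)); apply: ler_sum => n _.
rewrite Normc.normcM cabs_real ger0_norm ?invr_ge0 // -[X in _ <= X]mulr1.
by rewrite ler_wpM2l ?invr_ge0.
Qed.

(** The partial sum up to X^2, which is at least the conductor, is within 2 of the limit and is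
    trivially at most 1 + ln X^2. *)
Lemma pair_L_le (X0 : (0 < X)%N) :
  cabs (dirichlet_L (pair_char q1 q2) 1) <= 3 + ln (X ^ 2)%:R.
Proof.
have hc := dchar_product (c_prime hq1) (c_prime hq2) h1 h2.
have X20 : (0 < X ^ 2)%N by rewrite expn_gt0 X0.
have := pair_char_L (X ^ 2).
have := cabs_Lpartial_le (cabs_dchar_le hc) X20.
have : 2 * (q1 * q2)%:R / (X ^ 2).+1%:R <= 2 :> R.
  rewrite ler_pdivrMr ?ltr0n // ler_pM2l // ler_nat.
  exact: leq_trans pair_mul_le (leqnSn _).
have := cabsB (Lpartial (pair_char q1 q2) (X ^ 2))
  (Lpartial (pair_char q1 q2) (X ^ 2) - dirichlet_L (pair_char q1 q2) 1).
rewrite subKr => a b d e; apply: (le_trans a); have {b e} e := le_trans e b.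
by apply: (le_trans (lerD d e)); rewrite addrAC lerD2r; lra.
Qed.

Lemma pair_Re_le : (2 * X ^ 2 <= H)%N ->
  complex.Re (Lpartial (pair_char q1 q2) H) <= cabs (dirichlet_L (pair_char q1 q2) 1) + 1.
Proof.
move=> hH; have := pair_char_L H.
have : 2 * (q1 * q2)%:R / H.+1%:R <= 1 :> R.
  rewrite ler_pdivrMr ?ltr0n // mul1r -natrM ler_nat.
  by apply: leq_trans (leq_trans hH (leqnSn _)); rewrite leq_mul2l pair_mul_le.
have := cabsD (Lpartial (pair_char q1 q2) H - dirichlet_L (pair_char q1 q2) 1)
  (dirichlet_L (pair_char q1 q2) 1).
rewrite subrK => a b d; have {b}d := le_trans d b.
apply: (le_trans (ler_norm _)); apply: (le_trans (Re_le_cabs _)); apply: (le_trans a).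
by rewrite addrC lerD2l.
Qed.

End pair.

Lemma diagonal_Re_le q : q \in c -> (0 < H)%N ->
  complex.Re (Lpartial (pair_char q q) H) <= 1 + ln H%:R.
Proof.
move=> hq H0; apply: (le_trans (ler_norm _)); apply: (le_trans (Re_le_cabs _)).
apply: cabs_Lpartial_le => // n.
have [hc _ _] := chi_order hq; have [hc' _ _] := has_order_conj (chi_order hq).
by rewrite /pair_char Normc.normcM mulr_ile1 ?cabs_ge0 ?(cabs_dchar_le hc) ?(cabs_dchar_le hc').
Qed.

Let B : R := \sum_(m <- smooth E ps) m%:R^-1.

Definition good_pairs := [seq x <- [seq (q1, q2) | q1 <- c, q2 <- c] |
  (x.1 != x.2) && (B - 3 <= cabs (dirichlet_L (pair_char x.1 x.2) 1))].

(** Write M for the size of [c] and V for the bound of [pair_L_le]. All pairs together give at least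
    M^2 B. An off-diagonal pair that is not good gives at most B - 2, a good one at most V more
    since B >= 3, and the M diagonal ones at most M more each. Hence M^2 B <= M^2 (B - 2) + V G +
    M^2, with G the number of good pairs. *)
Lemma good_pairs_ge : (0 < X)%N -> (\prod_(p <- ps) p ^ E <= H)%N -> (2 * X ^ 2 <= H)%N ->
  3 <= B -> 1 + ln H%:R <= (size c)%:R :> R ->
  (size c)%:R ^+ 2 <= (size good_pairs)%:R * (3 + ln (X ^ 2)%:R) :> R.
Proof.
move=> X0 hH hX B3 hM.
have H0 : (0 < H)%N by apply: leq_trans hX; rewrite muln_gt0 expn_gt0 X0.
set M : R := (size c)%:R in hM *.
have M0 : 0 <= M by [].
pose V : R := 3 + ln (X ^ 2)%:R.
have V0 : 0 <= V by rewrite addr_ge0 ?ln_nat_ge0.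
have hsum := sum_pairs_ge hH.
pose F (x : nat * nat) := complex.Re (Lpartial (pair_char x.1 x.2) H).
pose g (x : nat * nat) := (x.1 != x.2) && (B - 3 <= cabs (dirichlet_L (pair_char x.1 x.2) 1)).
have sizeP : (size [seq (q1, q2) | q1 <- c, q2 <- c])%:R = M ^+ 2.
  by rewrite size_allpairs natrM -expr2.
have bound x : x \in [seq (q1, q2) | q1 <- c, q2 <- c] ->
    F x <= (B - 2) + (if g x then V else 0) + (if x.1 == x.2 then M else 0).
  case: x => q1 q2 /allpairsP[[a b] [/= ha hb [-> ->]]]; rewrite /F /g /=.
  have [ab|ab] := eqVneq a b => /=.
    rewrite -ab addr0; have := diagonal_Re_le ha H0; lra.
  rewrite addr0; have h1 := pair_Re_le ha hb ab hX.
  have h2 := pair_L_le ha hb ab X0.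
  case: ifPn => [hg|]; first by rewrite -/V in h2; lra.
  by rewrite -ltNge => h3; lra.
have diag : \sum_(x <- [seq (q1, q2) | q1 <- c, q2 <- c]) (if x.1 == x.2 then M else 0) = M ^+ 2.
  rewrite big_allpairs (eq_big_seq (fun=> M)).
    by rewrite big_const_seq count_predT iter_addr addr0 -[LHS]mulr_natr -expr2.
  move=> q1 hq1; rewrite (bigD1_seq q1) //= eqxx big1 ?addr0 // => q2 /negPf h.
  by rewrite eq_sym h.
have : \sum_(x <- [seq (q1, q2) | q1 <- c, q2 <- c]) F x <=
   M ^+ 2 * (B - 2) + (size good_pairs)%:R * V + M ^+ 2.
  rewrite -[X in _ + X]diag -sizeP.
  have -> : (size good_pairs)%:R * V =
      \sum_(x <- [seq (q1, q2) | q1 <- c, q2 <- c]) (if g x then V else 0).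
    rewrite -big_mkcond -big_filter big_const_seq count_predT iter_addr addr0.
    by rewrite mulr_natl.
  have -> : (size [seq (q1, q2) | q1 <- c, q2 <- c])%:R * (B - 2) =
      \sum_(x <- [seq (q1, q2) | q1 <- c, q2 <- c]) (B - 2).
    by rewrite big_const_seq count_predT iter_addr addr0 mulr_natl.
  rewrite -!big_split /= big_seq [X in _ <= X]big_seq; apply: ler_sum => x; exact: bound.
rewrite big_allpairs /= => h.
have := le_trans hsum h; rewrite -/B -/M -/V; lra.
Qed.

End pairs.

(** * Bounds for the number of primes and for the smooth sum *)

Section estimates.
Variable R : realType.

(** The primes with p^2 <= y number at most sqrt y and contribute at most sqrt y ln y <= 2y; for the
    others ln y <= 2 ln p, so they contribute at most 2 psi y <= 8y. *)
Lemma size_primes_upto_le y : (0 < y)%N ->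
  (size (primes_upto y))%:R * ln y%:R <= 10 * y%:R :> R.
Proof.
move=> y0; have y0R : (0 : R) < y%:R by rewrite ltr0n.
pose s := Num.sqrt (y%:R : R); have s0 : 0 < s by rewrite sqrtr_gt0.
have s2 : s ^+ 2 = y%:R by rewrite sqr_sqrtr // ltW.
have lnys : ln y%:R <= 2 * s :> R.
  by rewrite -s2 lnXn // mulr2n; have := ln_le_subr1 s0; lra.
have ly0 := ln_nat_ge0 R y.
rewrite -(count_predC (fun p => p ^ 2 <= y)%N) natrD mulrDl.
have h1 : (count (fun p => p ^ 2 <= y)%N (primes_upto y))%:R <= s.
  rewrite -size_filter.
  have /andP[ts _] := truncn_itv (ltW s0).
  apply: le_trans ts; rewrite ler_nat.
  rewrite -[X in (_ <= X)%N](size_iota 1); apply: uniq_leq_size.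
    by rewrite filter_uniq // primes_upto_uniq.
  move=> p; rewrite mem_filter mem_primes_upto mem_iota add1n ltnS => /and3P[py pp _].
  rewrite prime_gt0 //= truncn_ge_nat ?(ltW s0) //.
  by rewrite -(@ler_pXn2r _ 2) ?nnegrE ?(ltW s0) // s2 -natrX ler_nat.
have h2 : (count (predC (fun p => p ^ 2 <= y)%N) (primes_upto y))%:R * ln y%:R <= 8 * y%:R :> R.
  apply: (@le_trans _ _ (2 * psi R y)); last by have := psi_le R y; lra.
  rewrite -size_filter; set fl := [seq _ <- _ | _].
  have -> : (size fl)%:R * ln y%:R = \sum_(p <- fl) ln (y%:R : R).
    by rewrite big_const_seq count_predT iter_addr addr0 mulr_natl.
  rewrite /psi mulr_sumr; apply: (@le_trans _ _ (\sum_(p <- fl) 2 * Lam R p)).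
    rewrite big_seq [X in _ <= X]big_seq; apply: ler_sum => p.
    rewrite mem_filter mem_primes_upto /= -ltnNge => /and3P[py pp _].
    rewrite Lam_prime // mulr_natl -lnXn ?ltr0n ?prime_gt0 // -natrX.
    by apply: ler_ln_nat => //; apply: ltnW.
  apply: ler_sum_subset.
  - by rewrite filter_uniq // primes_upto_uniq.
  - move=> p; rewrite mem_filter mem_primes_upto mem_index_iota ltnS => /and3P[_ pp ->].
    by rewrite prime_gt0.
  - by move=> p _; rewrite mulr_ge0 ?Lam_ge0.
have h3 : s * s = y%:R by rewrite -expr2.
have := ler_wpM2r ly0 h1; have := ler_wpM2l (ltW s0) lnys; lra.
Qed.

Lemma prod_1B_ge (I : eqType) (r : seq I) (a : I -> R) : (forall i, i \in r -> 0 <= a i <= 1) ->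
  1 - \sum_(i <- r) a i <= \prod_(i <- r) (1 - a i).
Proof.
suff h : (forall i, i \in r -> 0 <= a i <= 1) ->
   1 - \sum_(i <- r) a i <= \prod_(i <- r) (1 - a i) <= 1 by move=> /h /andP[].
elim: r => [_|i r IH h]; first by rewrite !big_nil subr0 lexx.
have /andP[a0 a1] := h i (mem_head _ _).
have /IH/andP[h1 h2] : forall j, j \in r -> 0 <= a j <= 1.
  by move=> j jr; apply: h; rewrite inE jr orbT.
have p0 : 0 <= \prod_(j <- r) (1 - a j).
  rewrite big_seq prodr_ge0 // => j jr; rewrite subr_ge0.
  by have /andP[] := h j (mem_behead (s := i :: r) jr).
by rewrite !big_cons; apply/andP; split; nra.
Qed.

Lemma sqr_le_exp2 y : (y * y <= 2 ^ y.+1)%N.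
Proof.
have [|y3] := leqP y 3; first by case: y => [|[|[|[|]]]].
rewrite -(subnK y3); elim: (y - 4)%N => // n IH.
by rewrite addSn expnS; apply: leq_trans (leq_mul (leqnn 2) IH); nia.
Qed.

(** Capping exponents at y multiplies the Euler product by at least 1 - y / 2^(y+1) >= 1 - 1/y.
    [lnprod_ge] gives e^gamma (ln y - 6), and the lost factor costs one more unit because ln y <=
    y. *)
Lemma smooth_sum_ge y : (1 < y)%N ->
  expR (euler_gamma R) * (ln y%:R - 7) <= \sum_(m <- smooth y (primes_upto y)) (m%:R : R)^-1.
Proof.
move=> y1; set ps := primes_upto y; have y0 : (0 < y)%N by apply: ltnW.
have y0R : (0 : R) < y%:R by rewrite ltr0n.
have pprime p : p \in ps -> prime p by rewrite mem_primes_upto => /andP[].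
rewrite (sum_smooth (w := fun m => (m%:R : R)^-1)); first last.
- by move=> m n _ _; rewrite natrM invfM.
- by rewrite invr1.
- exact: primes_upto_prime.
have -> : \prod_(p <- ps) \sum_(0 <= j < y.+1) (p%:R : R)^-1 ^+ j =
   (\prod_(p <- ps) (1 - (p%:R : R)^-1 ^+ y.+1)) * expR (lnprod R y).
  have -> : lnprod R y = \sum_(p <- ps) - ln (1 - (p%:R : R)^-1).
    by rewrite /ps /primes_upto big_filter.
  rewrite expR_sum -big_split /= big_seq [RHS]big_seq.
  apply: eq_bigr => p /pprime pp; have h := prime_inv_lt1 R pp.
  rewrite expRN lnK ?posrE // big_mkord.
  apply: (mulIf (lt0r_neq0 h)); rewrite divfK ?lt0r_neq0 //.
  by rewrite -[RHS]opprB subrX1 -mulNr opprB mulrC.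
have P1 : 1 - y%:R^-1 <= \prod_(p <- ps) (1 - (p%:R : R)^-1 ^+ y.+1).
  apply: le_trans (prod_1B_ge _); last first.
    move=> p /pprime pp; rewrite exprn_ge0 ?invr_ge0 //= exprn_ile1 ?invr_ge0 //.
    by have := prime_inv_le_half R pp; lra.
  rewrite lerD2l lerN2.
  apply: (@le_trans _ _ (\sum_(1 <= p < y.+1) (2 ^+ y.+1)^-1)).
    rewrite /ps /primes_upto big_filter big_mkcond; apply: ler_sum_nat => p /andP[p0 _].
    case: ifP => [pp|_]; last by rewrite invr_ge0 exprn_ge0.
    rewrite -exprVn lerXn2r ?nnegrE ?invr_ge0 //.
    by have := prime_inv_le_half R pp; lra.
  rewrite sumr_const_nat subn1 /= -[X in X <= _]mulr_natl ler_pdivrMr ?exprn_gt0 //.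
  by rewrite mulrC ler_pdivlMr // -natrM -natrX ler_nat sqr_le_exp2.
have P2 : expR (euler_gamma R) * (ln y%:R - 6) <= expR (lnprod R y).
  have L0 : 0 < ln (y%:R : R) by exact: ln_nat_gt0.
  apply: (@le_trans _ _ (expR (ln (ln y%:R) + euler_gamma R - 6 / ln y%:R))); last first.
    by rewrite ler_expR lnprod_ge.
  rewrite -addrA addrCA expRD ler_wpM2l ?expR_ge0 //.
  rewrite expRD lnK ?posrE //.
  have := @expR_ge1Dx R (- (6 / ln y%:R)) => /(ler_wpM2l (ltW L0)); apply: le_trans.
  by rewrite mulrBr mulr1 mulrCA divff ?gt_eqF // mulr1.
have Pp : 0 <= 1 - y%:R^-1 :> R by rewrite subr_ge0 invf_le1 // ler1n.
have eg := expR_gt0 (euler_gamma R).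
apply: (@le_trans _ _ ((1 - y%:R^-1) * expR (lnprod R y))); last by rewrite ler_wpM2r // expR_ge0.
apply: (@le_trans _ _ ((1 - y%:R^-1) * (expR (euler_gamma R) * (ln y%:R - 6)))); last first.
  by rewrite ler_wpM2l.
rewrite mulrCA ler_wpM2l ?(ltW eg) //.
have ly : ln y%:R <= y%:R :> R by have := ln_le_subr1 y0R; lra.
have : y%:R^-1 * ln y%:R <= 1 :> R by rewrite mulrC ler_pdivrMr // mul1r.
have : 0 <= y%:R^-1 :> R by rewrite invr_ge0.
by rewrite mulrBl mul1r mulrBr; lra.
Qed.

Lemma prod_primes_upto_le y E : (\prod_(p <- primes_upto y) p ^ E <= y ^ (E * y))%N.
Proof.
case: (posnP y) => [->|y0]; first by rewrite /primes_upto /index_iota /= big_nil expn_gt0 muln0.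
have sz : (size (primes_upto y) <= y)%N.
  by rewrite /primes_upto size_filter (leq_trans (count_size _ _)) // size_iota subn1.
apply: (@leq_trans (\prod_(p <- primes_upto y) y ^ E)).
  rewrite big_seq [X in (_ <= X)%N]big_seq; apply: leq_prod => p.
  by rewrite mem_primes_upto => /andP[_]; case: (E) => // e; rewrite leq_exp2r.
by rewrite big_const_seq count_predT iter_muln_1 -expnM leq_pexp2l // leq_mul2l sz orbT.
Qed.

End estimates.

(** * Pigeonhole classes and distinctness of the characters *)

Lemma pigeonhole (T : Type) (F : finType) (f : T -> F) (s : seq T) : (0 < #|F|)%N ->
  exists v, (size s <= #|F| * count (fun x => f x == v) s)%N.
Proof.
move=> F0; apply: contrapT => /forallNP h.
have E : \sum_(v : F) count (fun x => f x == v) s = size s.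
  elim: s {h} => [|x s IH]; first by rewrite big1.
  rewrite big_split /= IH (bigD1 (f x)) //= eqxx big1 ?addn0 // => v /negPf.
  by rewrite eq_sym => ->.
have : (\sum_(v : F) #|F| * count (fun x => f x == v) s < \sum_(v : F) size s)%N.
  have /card_gt0P[v0 _] := F0.
  rewrite (bigD1 v0) //= [X in (_ < X)%N](bigD1 v0) //= -addSn leq_add //.
    by rewrite ltnNge; apply/negP; exact: h.
  by apply: leq_sum => v _; rewrite ltnW // ltnNge; apply/negP; exact: h.
by rewrite -big_distrr /= E sum_nat_const ltnn.
Qed.

Section classes.
Variables (R : realType) (k : nat).
Hypothesis k2 : (2 <= k)%N.
Variables (y : nat) (s : seq nat) (chi : nat -> nat -> R[i]).
Hypothesis s_prime : forall q, q \in s -> prime q.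
Hypothesis s_gt : forall q, q \in s -> (y < q)%N.
Hypothesis chi_order : forall q, q \in s -> has_order k q (chi q).

(** A prime p <= y is coprime to each q in s since q > y, so chi q p is a k-th root of unity, and
    the vector of exponents has k^pi(y) possible values. *)
Lemma exists_class : exists P : pred nat,
  (size s <= k ^ size (primes_upto y) * size [seq q <- s | P q])%N /\
  forall q q' p, q \in s -> q' \in s -> P q -> P q' -> prime p -> (p <= y)%N ->
    chi q p = chi q' p.
Proof.
have k0 : (0 < k)%N by apply: ltnW.
have [w hw] := exists_prim_root (R[i] : numClosedFieldType) k0.
set ps := primes_upto y.
pose f (q : nat) : {ffun 'I_(size ps) -> 'I_k} := [ffun i : 'I_(size ps) =>
  if [pick j : 'I_k | chi q (nth 0%N ps i) == w ^+ j] is Some j then j else Ordinal k0].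
have cF : #|{ffun 'I_(size ps) -> 'I_k}| = (k ^ size ps)%N by rewrite card_ffun !card_ord.
have [|v hv] := @pigeonhole _ {ffun 'I_(size ps) -> 'I_k} f s.
  by rewrite cF expn_gt0 k0.
exists (fun q => f q == v); split; first by rewrite size_filter -cF.
have fE q p : q \in s -> prime p -> (p <= y)%N ->
    exists2 i : 'I_(size ps), nth 0%N ps i = p & chi q p = w ^+ f q i.
  move=> hq pp py; have pps : p \in ps by rewrite mem_primes_upto pp.
  have ip : (index p ps < size ps)%N by rewrite index_mem.
  exists (Ordinal ip); rewrite /= ?nth_index // ffunE /= nth_index //.
  have [_ h1 _] := chi_order hq.
  have cp : coprime p q.
    rewrite prime_coprime // dvdn_prime2 ?(s_prime hq) //; apply/eqP => pq.
    by have := s_gt hq; rewrite -pq ltnNge py.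
  have [j hj] := prim_rootP hw (h1 p cp).
  by case: pickP => [l /eqP //|/(_ j)]; rewrite hj eqxx.
move=> q q' p hq hq' /eqP fq /eqP fq' pp py.
have [i ip ->] := fE q p hq pp py; have [i' ip' ->] := fE q' p hq' pp py.
have -> : i = i'; last by rewrite fq fq'.
apply/val_inj/eqP; rewrite -(nth_uniq 0%N (ltn_ord i) (ltn_ord i') (primes_upto_uniq y)).
by rewrite -/ps ip ip'.
Qed.

End classes.

Section distinct.
Variables (R : realType) (k : nat) (c : seq nat) (chi : nat -> nat -> R[i]).
Hypothesis c_prime : forall q, q \in c -> prime q.
Hypothesis chi_order : forall q, q \in c -> has_order k q (chi q).

Lemma pair_char_eq0 q1 q2 r : q1 \in c -> q2 \in c -> prime r ->
  (pair_char chi q1 q2 r == 0) = (r == q1) || (r == q2).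
Proof.
move=> h1 h2 pr; have [hc1 _ _] := chi_order h1; have [hc2 _ _] := has_order_conj (chi_order h2).
apply: negb_inj; rewrite mulf_eq0 negb_or (dchar_neq0 hc1) (dchar_neq0 hc2) negb_or.
by rewrite !prime_coprime // !dvdn_prime2 // c_prime.
Qed.

(** The primes at which the character vanishes determine the unordered pair; the last hypothesis
    fixes the order. *)
Lemma pair_char_inj q1 q2 r1 r2 : q1 \in c -> q2 \in c -> r1 \in c -> r2 \in c ->
  pair_char chi q1 q2 = pair_char chi r1 r2 ->
  ((q1 < q2)%N && (r1 < r2)%N) || ((q2 < q1)%N && (r2 < r1)%N) -> q1 = r1 /\ q2 = r2.
Proof.
move=> hq1 hq2 hr1 hr2 E.
have e r : prime r -> (r == q1) || (r == q2) = (r == r1) || (r == r2).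
  by move=> pr; rewrite -(pair_char_eq0 hq1 hq2 pr) E pair_char_eq0.
have := e q1 (c_prime hq1); have := e q2 (c_prime hq2).
rewrite !eqxx orbT /= => /esym /orP[/eqP ->|/eqP ->] /esym /orP[/eqP ->|/eqP ->] //.
- by rewrite ltnn.
- by move=> /orP[/andP[a b]|/andP[a b]]; have := ltn_trans a b; rewrite ltnn.
- by rewrite ltnn.
Qed.

(** For k = 2 swapping the two primes gives the same character, so only one of the two orders is
    kept, the one that gives more characters; hence the factor 2. *)
Lemma exists_pair_char_fset (gp : seq (nat * nat)) : uniq gp ->
  (forall x, x \in gp -> [/\ x.1 \in c, x.2 \in c & x.1 != x.2]) ->
  exists A : {fset (nat -> R[i])}, (size gp <= 2 * #|` A|)%N /\
    forall psi, psi \in A -> exists2 x, x \in gp & psi = pair_char chi x.1 x.2.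
Proof.
move=> ugp hgp.
have half (P : pred (nat * nat)) :
    (forall x, P x -> (x.1 < x.2)%N) \/ (forall x, P x -> (x.2 < x.1)%N) ->
    exists A : {fset (nat -> R[i])}, (count P gp <= #|` A|)%N /\
    forall psi, psi \in A -> exists2 x, x \in gp & psi = pair_char chi x.1 x.2.
  move=> hP; pose l : seq (nat -> R[i]) := [seq pair_char chi x.1 x.2 | x <- [seq x <- gp | P x]].
  exists (seq_fset tt l); split.
    rewrite size_seq_fset undup_id ?size_map ?size_filter //.
    rewrite map_inj_in_uniq ?filter_uniq // => x x'.
    rewrite !mem_filter => /andP[Px /hgp[h1 h2 _]] /andP[Px' /hgp[h1' h2' _]] E.
    have [|a b] := pair_char_inj h1 h2 h1' h2' E.
      by case: hP => hP; rewrite (hP x Px) (hP x' Px') ?orbT.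
    by case: x x' a b {Px Px' h1 h2 h1' h2' E} => [? ?] [? ?] /= -> ->.
  move=> psi; rewrite seq_fsetE => /(@seq.mapP _ _ _ _ _)[x + ->].
  by rewrite mem_filter => /andP[_ hx]; exists x.
have [|A1 [hA1 hA1']] := half (fun x => x.1 < x.2)%N; first by left.
have [|A2 [hA2 hA2']] := half (fun x => x.2 < x.1)%N; first by right.
have sz : (size gp <= count (fun x => x.1 < x.2)%N gp + count (fun x => x.2 < x.1)%N gp)%N.
  rewrite -count_predUI (leq_trans _ (leq_addr _ _)) //.
  rewrite -[X in (X <= _)%N]count_predT -!size_filter.
  rewrite !size_filter leq_eqVlt; apply/orP; left; apply/eqP; apply: eq_in_count => x /hgp[_ _].
  by rewrite /= neq_ltn => ->.
have [A12|A21] := leqP #|` A1| #|` A2|.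
  by exists A2; split => //; rewrite mul2n -addnn; lia.
by exists A1; split => //; rewrite mul2n -addnn; lia.
Qed.

End distinct.

(** * Numerical conditions for Q large *)

Section numerics.
Variable R : realType.

Lemma expR_ge_pow5 (x : R) : 0 <= x -> x ^+ 5 / 120 <= expR x.
Proof.
move=> x0; have := expR_ge1Dxn 4 x0.
by rewrite (_ : (5`!)%:R = 120 :> R) //; lra.
Qed.

Lemma expR_ge_pow3 (x : R) : 0 <= x -> x ^+ 3 / 6 <= expR x.
Proof.
move=> x0; have := expR_ge1Dxn 2 x0.
by rewrite (_ : (3`!)%:R = 6 :> R) //; lra.
Qed.

(** Here l stands for log Q. The bound 80 lk <= ln l keeps the number of classes below Q^(1/4), 3 <=
    eg (ln l - 8) gives B >= 3 in [good_pairs_ge], 4 (ln l)^2 <= l absorbs l^4 into exp(l / ln l),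
    and the last one makes a class larger than 1 + ln H. *)
Lemma large_conditions (A lk eg : R) : 1 <= A -> 0 <= lk -> 0 < eg ->
  exists L0, forall l, L0 <= ln l -> 0 < l ->
  [/\ 24 <= ln l, 80 * lk <= ln l, 3 <= eg * (ln l - 8) & 4 * ln l ^+ 2 <= l] /\
  [/\ 64 * A ^+ 2 <= l, 24 <= l & 8 * A * l ^+ 4 <= expR (l / 4)].
Proof.
move=> A1 lk0 eg0.
have eg3 : 0 <= 3 / eg by rewrite divr_ge0 // ltW.
(* The sum of all thresholds. In it 10^6 A exceeds 8 * 120 * 1024 * A, which comes from exp x >= x^5
   / 120 at x = l / 4. *)
exists (24 + 80 * lk + 64 * A ^+ 2 + 1000 * (1000 * A) + 3 / eg) => l hl l0.
have A2 : 0 <= A ^+ 2 by rewrite exprn_ge0 //; lra.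
have ll : ln l <= l - 1 by exact: ln_le_subr1.
have l1 : 24 <= ln l by lra.
split; split; try lra.
- have : eg * (3 / eg) <= eg * (ln l - 8) by rewrite ler_wpM2l ?(ltW eg0) //; lra.
  by rewrite mulrCA divff ?gt_eqF // mulr1.
- have := @expR_ge_pow3 (ln l) (le_trans (ler0n _ _) l1); rewrite lnK ?posrE //.
  apply: le_trans; have z0 : 0 <= ln l ^+ 2 by exact: sqr_ge0.
  by rewrite (exprS _ 2); move: (ln l ^+ 2) z0 => z z0; nra.
- have l4 : 0 <= l / 4 by lra.
  apply: le_trans (expR_ge_pow5 l4).
  have lA : 1000 * (1000 * A) <= l by lra.
  have p4 : 0 <= l ^+ 4 by rewrite exprn_ge0 // ltW.
  have -> : (l / 4) ^+ 5 / 120 = l / (120 * 1024) * l ^+ 4 by field.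
  by rewrite ler_wpM2r //; lra.
Qed.

(** Here S = Q^(1/2), N counts the primes, K the classes, M is the size of the class, G counts the
    good pairs and a the characters; the conclusion bounds Q by a times the loss. *)
Lemma count_lower (A l S K M N G a kap : R) : 1 <= A -> 24 <= l -> 64 * A ^+ 2 <= l ->
  0 <= S -> 0 <= M -> 0 <= K -> 0 <= a -> S <= 4 * A * l * N -> N <= K * M ->
  M ^+ 2 <= G * (3 + l) -> G <= 2 * a -> K <= expR kap ->
  S ^+ 2 <= l ^+ 4 * expR kap ^+ 2 * a.
Proof.
move=> A1 l24 lA S0 M0 K0 a0 hS hN hM hG hK.
have e0 := expR_gt0 kap.
have al : 0 <= 4 * A * l by rewrite !mulr_ge0 //; lra.
have h1 : S <= 4 * A * l * (expR kap * M).
  apply: (le_trans hS); rewrite ler_wpM2l //; apply: (le_trans hN).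
  by rewrite ler_wpM2r.
have h2 : S ^+ 2 <= (4 * A * l * (expR kap * M)) ^+ 2.
  by rewrite lerXn2r ?nnegrE // !mulr_ge0 // ?expR_ge0 //; lra.
apply: (le_trans h2).
have -> : (4 * A * l * (expR kap * M)) ^+ 2 = 16 * A ^+ 2 * l ^+ 2 * expR kap ^+ 2 * M ^+ 2 by ring.
have h3 : M ^+ 2 <= 4 * l * a.
  apply: (le_trans hM); have : G * (3 + l) <= 2 * a * (2 * l); last lra.
  by apply: le_trans (ler_wpM2l _ (_ : 3 + l <= 2 * l)); [rewrite ler_wpM2r|lra|lra]; lra.
have c0 : 0 <= 16 * A ^+ 2 * l ^+ 2 * expR kap ^+ 2.
  by rewrite !mulr_ge0 // ?exprn_ge0 ?expR_ge0 //; lra.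
apply: (le_trans (ler_wpM2l c0 h3)).
have -> : 16 * A ^+ 2 * l ^+ 2 * expR kap ^+ 2 * (4 * l * a) =
  64 * A ^+ 2 * (l ^+ 3 * expR kap ^+ 2 * a) by ring.
have -> : l ^+ 4 * expR kap ^+ 2 * a = l * (l ^+ 3 * expR kap ^+ 2 * a) by ring.
by rewrite ler_wpM2r // !mulr_ge0 // ?exprn_ge0 ?expR_ge0 //; lra.
Qed.

End numerics.

Theorem theorem1p2 (R : realType) (k : nat) (hk : (2 <= k)%N) :
  exists c C Q0 : R, 0 < c /\
    forall Q : R, Q0 <= Q ->
    exists A : {fset (nat -> R[i])},
      Q * expR (- c * (ln Q / ln (ln Q))) <= (#|` A|)%:R /\
      forall chi : nat -> R[i], chi \in A ->
        exists q : nat,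
          [/\ primitive_character q chi, is_order q chi k, q%:R <= Q &
              exists2 E : R, `|E| <= C &
                (expR (euler_gamma R) * ln (ln Q) + E)%:C
                  <= `|dirichlet_L chi 1|].
Proof.
have [A [A0 hA]] := primes_one_mod_ge R hk.
set eg := expR (euler_gamma R); have eg0 : 0 < eg by exact: expR_gt0.
have lk0 : 0 <= ln (k%:R : R) by exact: ln_nat_ge0.
have A1 : 1 <= A%:R :> R by rewrite ler1n.
have [L0 hL0] := large_conditions A1 lk0 eg0.
(* The exponent collects 2 [kap], that is 40 ln k times l / ln l, and 4 ln l <= l / ln l from the
   factor l^4. In the error, 3 is the threshold of [good_pairs], and 8 comes from the 7 of
   [smooth_sum_ge] and ln y >= ln l - 1. *)
exists (40 * ln k%:R + 1), (8 * eg + 3), (expR (expR L0)); split; first by lra.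
move=> Q hQ; have Q0 : 0 < Q by apply: lt_le_trans hQ; exact: expR_gt0.
set l := ln Q.
have hl : expR L0 <= l by rewrite -(expRK (expR L0)) ler_ln ?posrE ?expR_gt0.
have l0 : 0 < l by apply: lt_le_trans hl; exact: expR_gt0.
have hLm : L0 <= ln l by rewrite -(expRK L0) ler_ln ?posrE ?expR_gt0.
have [[c24 c80 c3 c4] [c64 l24 cexp]] := hL0 l hLm l0.
set Lm := ln l in hLm c24 c80 c3 c4 *.
pose S := expR (l / 2); have S0 : 0 < S by exact: expR_gt0.
have S2 : S ^+ 2 = Q.
  by rewrite /S -expRM_natl (_ : 2 * (l / 2) = l) ?lnK ?posrE //; lra.
pose X := Num.truncn S; pose y := Num.truncn l.
have /andP[XS SX] := truncn_itv (ltW S0); rewrite -/X in XS SX.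
have /andP[yl ly] := truncn_itv (ltW l0); rewrite -/y in yl ly.
rewrite -natr1 in SX; rewrite -natr1 in ly.
have S_big : 8 * A%:R * l ^+ 4 <= S.
  by apply: (le_trans cexp); rewrite ler_expR; lra.
have l4 : 1 <= l ^+ 2 by rewrite expr2; nra.
have Al2 : 4 * A%:R * l ^+ 2 <= S.
  apply: le_trans S_big; have -> : l ^+ 4 = l ^+ 2 * l ^+ 2 by ring.
  have : 0 <= A%:R * l ^+ 2 by rewrite mulr_ge0 // exprn_ge0 // ltW.
  nra.
have S_A : 2 * A%:R <= S by nra.
have AX : (A <= X)%N by rewrite -(ler_nat R); lra.
have X0 : (0 < X)%N by apply: leq_trans AX.
have X0R : (0 : R) < X%:R by rewrite ltr0n.
have y1 : (1 < y)%N by rewrite -(ltr_nat R); lra.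
have lnX : ln X%:R <= l / 2.
  by rewrite -[X in _ <= X]expRK ler_ln ?posrE ?expR_gt0.
have lnX2 : ln (X ^ 2)%:R <= l.
  by rewrite natrX lnXn // mulr2n; lra.
pose s := [seq q <- primes_one_mod k X | (y < q)%N].
have us : uniq s by rewrite !filter_uniq // iota_uniq.
have mem_s q : q \in s -> [/\ prime q, (y < q)%N, (q <= X)%N & q = 1 %[mod k]].
  rewrite !mem_filter mem_index_iota ltnS => /and3P[yq /andP[pq /eqP qk] /andP[_ qX]].
  by split.
have size_s : (size (primes_one_mod k X) <= y + size s)%N.
  rewrite -(count_predC (fun q => y < q)%N) addnC leq_add ?size_filter //.
  rewrite -size_filter -[X in (_ <= X)%N](size_iota 1); apply: uniq_leq_size.
    by rewrite !filter_uniq // iota_uniq.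
  move=> q; rewrite mem_filter /= -leqNgt mem_filter => /and3P[qy /andP[pq _] _].
  by rewrite mem_iota add1n ltnS qy prime_gt0.
(* The primes up to y, at most l in number, are discarded; they cost A l^2 <= S / 4. *)
have hN : S <= 4 * A%:R * l * (size s)%:R.
  have h1 := hA X AX.
  have h2 : X%:R <= A%:R * l * (l + (size s)%:R).
    apply: (le_trans h1); apply: ler_pM; rewrite ?mulr_ge0 ?ln_nat_ge0 //.
      by rewrite ler_wpM2l //; lra.
    by apply: (le_trans (_ : _ <= (y + size s)%:R)); [rewrite ler_nat|rewrite natrD lerD2r].
  have -> : 4 * A%:R * l * (size s)%:R = 4 * (A%:R * l * (l + (size s)%:R)) - 4 * A%:R * l ^+ 2 by ring.
  have : 4 <= S by nra.
  lra.
have hchi q : exists chi : nat -> R[i], q \in s -> has_order k q chi.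
  have [/mem_s[pq _ _ qk]|_] := boolP (q \in s); last by exists (fun=> 0).
  by have [chi hchi] := exists_has_order R hk pq qk; exists chi.
have [chi chi_order] := choice hchi.
have s_prime q : q \in s -> prime q by move=> /mem_s[].
have s_gt q : q \in s -> (y < q)%N by move=> /mem_s[].
have [P [hP same]] := exists_class hk s_prime s_gt chi_order.
pose c := [seq q <- s | P q].
have sub_c q : q \in c -> q \in s by rewrite mem_filter => /andP[].
have c_le q : q \in c -> (q <= X)%N by move=> /sub_c /mem_s[].
(* Long enough to contain all y-smooth integers with exponents at most y, and to
   approximate L(1, chi) up to 1 for all conductors in play. *)
pose H := (y ^ (y * y) * (2 * X ^ 2))%N.
(* From pi(y) <= 10 y / ln y with y <= l and ln y >= (ln l) / 2, the number k^pi(y) of classes is at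
   most exp [kap]. *)
pose kap := 20 * ln k%:R * (l / Lm).
have y0R : (0 : R) < y%:R by rewrite ltr0n ltnW.
have lny : Lm / 2 <= ln y%:R /\ Lm - 1 <= ln y%:R.
  have h : ln (l / 2) <= ln y%:R.
    by rewrite ler_ln ?posrE // ?divr_gt0 //; move: ly l24; clear; lra.
  have : ln (2 : R) <= 1 by apply: (le_trans (ln_le_subr1 _)); clear; lra.
  by move: h; rewrite ln_div ?posrE // -/Lm; move: c24; clear; split; lra.
have hK : (k ^ size (primes_upto y))%:R <= expR kap.
  have h : (size (primes_upto y))%:R <= 20 * (l / Lm).
    rewrite mulrA ler_pdivlMr; last by lra.
    have h1 := size_primes_upto_le R (ltnW y1); have [h2 _] := lny.
    have := ler_wpM2l (ler0n R (size (primes_upto y))) h2; lra.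
  rewrite natrX -[k%:R](@lnK R) ?posrE ?ltr0n ?(ltnW hk) // -expRM_natl ler_expR.
  have -> : kap = 20 * (l / Lm) * ln k%:R by rewrite /kap; ring.
  by rewrite ler_wpM2r.
have hNK : (size s)%:R <= (k ^ size (primes_upto y))%:R * (size c)%:R :> R.
  by rewrite -natrM ler_nat.
have Lm0 : 0 < Lm by apply: lt_le_trans c24; rewrite ltr0n.
have kap0 : 0 <= kap by rewrite /kap !mulr_ge0 ?invr_ge0 ?(ltW l0) ?(ltW Lm0).
have kap4 : kap <= l / 4.
  have h : 20 * ln k%:R / Lm <= 1 / 4 by rewrite ler_pdivrMr //; move: c80; clear; lra.
  have -> : kap = 20 * ln k%:R / Lm * l by rewrite /kap; ring.
  by have := ler_wpM2r (ltW l0) h; clear; lra.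
(* S is the square of exp(l / 4): one factor absorbs the number of classes, the other exceeds 8 A
   l^4. *)
have M_big : 2 * l ^+ 3 <= (size c)%:R.
  have Al : 0 < 4 * A%:R * l by rewrite !mulr_gt0 // ltr0n.
  have h1 : S <= 4 * A%:R * l * (expR (l / 4) * (size c)%:R).
    apply: (le_trans hN); rewrite ler_wpM2l ?(ltW Al) //; apply: (le_trans hNK).
    by rewrite ler_wpM2r // (le_trans hK) // ler_expR.
  have SE : S = expR (l / 4) * expR (l / 4) by rewrite -expRD /S; congr expR; field.
  move: h1; rewrite SE mulrCA ler_pM2l ?expR_gt0 // => /(le_trans cexp).
  have -> : 8 * A%:R * l ^+ 4 = 4 * A%:R * l * (2 * l ^+ 3) by ring.
  by rewrite ler_pM2l.
(* Indeed ln H = y^2 ln y + ln 2 + ln X^2 <= l^3 + 1 + l. *)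
have hM : 1 + ln H%:R <= (size c)%:R :> R.
  apply: le_trans M_big; rewrite /H natrM natrX lnM ?posrE ?exprn_gt0 //; last first.
    by rewrite ltr0n muln_gt0 expn_gt0 X0.
  rewrite lnXn // natrM lnM ?posrE //; last by rewrite ltr0n expn_gt0 X0.
  have ln2 : ln (2 : R) <= 1 by apply: (le_trans (ln_le_subr1 _)); clear; lra.
  have h1 : ln y%:R *+ (y * y) <= l ^+ 3.
    rewrite -[X in X <= _]mulr_natl natrM -[3%N]/(2 + 1)%N exprD expr1 expr2.
    have lnyl : ln y%:R <= l by have := ln_le_subr1 y0R; move: yl; clear; lra.
    by rewrite !ler_pM ?mulr_ge0 ?ln_nat_ge0.
  have h2 : 2 + l <= l ^+ 3.
    have -> : l ^+ 3 = l * l ^+ 2 by ring.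
    by rewrite expr2; move: l24; clear; nra.
  by move: lnX2 ln2 h1 h2; rewrite natrX; clear; lra.
have c_prime q : q \in c -> prime q by move=> /sub_c /s_prime.
have c_gt q : q \in c -> (y < q)%N by move=> /sub_c /s_gt.
have c_order q : q \in c -> has_order k q (chi q) by move=> /sub_c /chi_order.
have c_same q q' p : q \in c -> q' \in c -> prime p -> (p <= y)%N -> chi q p = chi q' p.
  have P_c a : a \in c -> P a by rewrite mem_filter => /andP[].
  move=> hq hq'; exact: same (sub_c _ hq) (sub_c _ hq') (P_c _ hq) (P_c _ hq').
have uc : uniq c by rewrite filter_uniq.
have B_ge := smooth_sum_ge R y1; rewrite -/eg in B_ge.
have B3 : eg * (Lm - 8) <= \sum_(m <- smooth y (primes_upto y)) (m%:R : R)^-1.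
  apply: le_trans B_ge; rewrite ler_wpM2l ?(ltW eg0) //; have [_ h] := lny; move: h; clear; lra.
have H1 : (\prod_(p <- primes_upto y) p ^ y <= H)%N.
  apply: (leq_trans (prod_primes_upto_le y y)).
  by rewrite leq_pmulr // muln_gt0 expn_gt0 X0.
have H2 : (2 * X ^ 2 <= H)%N by rewrite leq_pmull // expn_gt0 ltnW.
have := good_pairs_ge hk uc c_prime c_gt c_le c_order c_same X0 H1 H2 (le_trans c3 B3) hM.
set gp := good_pairs _ _ _ _ => hgp.
have mem_gp x : x \in gp -> [/\ x.1 \in c, x.2 \in c, x.1 != x.2 &
    eg * (Lm - 8) - 3 <= cabs (dirichlet_L (pair_char chi x.1 x.2) 1)].
  rewrite mem_filter => /andP[/andP[h1 h2]] /allpairsP[[a b] [ha hb xE]].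
  move: h1 h2; rewrite xE /= => h1 h2; split => //.
  by apply: le_trans h2; rewrite lerD2r.
have ugp : uniq gp.
  rewrite filter_uniq // allpairs_uniq // => u v _ _; by case: u v => [? ?] [? ?].
have [|AA [hAA hAA']] := exists_pair_char_fset c_prime c_order ugp.
  by move=> x /mem_gp[].
exists AA; split.
  have hG : (size gp)%:R <= 2 * #|` AA|%:R :> R by rewrite -natrM ler_nat.
  have hM2 : (size c)%:R ^+ 2 <= (size gp)%:R * (3 + l).
    by apply: (le_trans hgp); rewrite ler_wpM2l // lerD2l.
  have := count_lower A1 l24 c64 (ltW S0) (ler0n _ _) (ler0n _ _) (ler0n _ _) hN hNK hM2 hG hK.
  rewrite S2 => hQa.
  set T := (40 * ln k%:R + 1) * (l / Lm).
  have lE : l ^+ 4 * expR kap ^+ 2 = expR (4 * Lm + 2 * kap).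
    by rewrite expRD !expRM_natl /Lm lnK.
  have T_ge : 4 * Lm + 2 * kap <= T.
    have h : 4 * Lm <= l / Lm.
      rewrite ler_pdivlMr //.
      by rewrite -mulrA -expr2.
    by move: h; rewrite /T /kap; move: (l / Lm) (4 * Lm) (ln _); clear; move=> a b d; lra.
  rewrite mulNr -/T expRN ler_pdivrMr ?expR_gt0 // (le_trans hQa) // lE mulrC.
  by rewrite ler_wpM2l // ler_expR.
move=> psi /hAA' [[q1 q2] /mem_gp[/= hq1 hq2 q12 hL] ->].
have o1 := c_order _ hq1; have o2 := has_order_conj (c_order _ hq2).
exists (q1 * q2)%N; split.
- exact: primitive_product (c_prime _ hq1) (c_prime _ hq2) q12 o1 o2.
- exact: is_order_product (c_prime _ hq1) (c_prime _ hq2) q12 o1 o2.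
- rewrite -S2 natrM expr2; apply: ler_pM => //; apply: le_trans XS; rewrite ler_nat.
    exact: c_le.
  exact: c_le.
- exists (- (8 * eg + 3)); first by rewrite normrN ger0_norm //; move: eg0; clear; lra.
  by rewrite cabs_normE lecR; apply: le_trans hL; clear; lra.
Qed.
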